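(* Let $K\times\{\varphi_i:i=1,2,3\}$ be a proper set of measurements in $\Omega'$. Suppose $q\in H^1(\Omega)$. Let $G=a/q$ and $\mathrm{tr}(e)=\sum_{k\in K}\sum_{i=1}^3 e_k^{ii}$. Then $\log q$ is the unique (weak, $H^1(\Omega')$) solution $u$ to the problem $$\left\{\begin{array}{l} -\mathrm{div}\bigl(G\,\mathrm{tr}(e)\,\nabla u\bigr)=-\mathrm{div}\bigl(G\,\nabla(\mathrm{tr}(e))\bigr)+2\displaystyle\sum_{k\in K}\sum_{i=1}^3\bigl(E_k^{ii}-k\,e_k^{ii}\bigr)\quad\text{in }\Omega',\\ u=\log q|_{\partial\Omega'}\quad\text{on }\partial\Omega'. \end{array}\right.$$
   Context: Setting. $d\in\{2,3\}$, $\alpha\in(0,1)$, $\Omega'\subseteq\Omega\subseteq\mathbb{R}^d$ are bounded domains of class $\mathcal{C}^{1,\alpha}$. $a\in\mathcal{C}^{0,\alpha}(\overline\Omega)$ is a real scalar function with $\lambda\le a\le\Lambda$ for some $\lambda,\Lambda>0$; $q\in L^\infty(\Omega)$ is real-valued with $\beta_1\le q\le\beta_2$ a.e. in $\Omega$ for some $\beta_1,\beta_2>0$. $K_{ad}=[K_{\min},K_{\max}]$ with $0<K_{\min}<K_{\max}$. $\Sigma$ is the set of Dirichlet eigenvalues, i.e. of those $k$ for which $-\mathrm{div}(a\nabla u)-kqu=0$ in $\Omega$, $u=0$ on $\partial\Omega$ has a nontrivial weak solution in $H^1_0(\Omega;\mathbb{C})$. For $k\notin\Sigma$ and a real boundary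 datum $\varphi_i$ which is the trace on $\partial\Omega$ of a function in $\mathcal{C}^{1,\alpha}(\overline\Omega)$, $u_k^i$ denotes the unique weak solution of $$-\mathrm{div}(a\nabla u_k^i)-k\,q\,u_k^i=0\ \text{ in }\Omega,\qquad u_k^i=\varphi_i\ \text{ on }\partial\Omega,$$ which belongs to $\mathcal{C}^1(\overline\Omega)$. A set of measurements is a product $K\times\{\varphi_i\}$ with $K\subseteq K_{ad}\setminus\Sigma$ finite and finitely many such boundary data. A set of measurements $K\times\{\varphi_i:i=1,2,3\}$ is proper in $\Omega'$ if there are constants $p,r>0$ such that for every $x\in\Omega'$ there exists $\bar k=\bar k(x)\in K$ with $|u_{\bar k}^1(x)|\ge p$ and $|\nabla u_{\bar k}^2(x)|\,|\nabla u_{\bar k}^3(x)|\,|\sin\theta_{\nabla u_{\bar k}^2,\nabla u_{\bar k}^3}(x)|\ge r$, where $\theta_{v,w}=\arccos\frac{v\cdot w}{|v||w|}$ is the angle between nonzero vectors $v,w$. Internal energies: $e_k^{ij}=q\,u_k^i\,u_k^j$ and $E_k^{ij}=a\,\nabla u_k^i\cdot\nabla u_k^j$ for $i,j\in\{1,2,3\}$. Boundary values on $\partial\Omega'$ are in the sense of traces. *)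

(* Defs.v *)
Set Warnings "-notation-incompatible-prefix,-notation-overridden,-ambiguous-paths,-redundant-canonical-projection".
From HB Require Import structures.
From mathcomp Require Import all_boot all_order all_algebra finmap.
From mathcomp Require Import all_classical all_reals all_analysis.
From mathcomp Require Import complex.

Set Implicit Arguments.
Unset Strict Implicit.
Unset Printing Implicit Defensive.
Import Order.TTheory GRing.Theory Num.Theory.
Import numFieldNormedType.Exports.
Local Open Scope classical_set_scope.
Local Open Scope ring_scope.

Fact rV_display : measure_display. Proof. exact: default_measure_display. Qed.

Section measurable_rV.
Context (R : realType) (n : nat).

Let coors : 'I_n -> 'rV[R]_n -> R := fun i x => x ord0 i.

Let rV_set0 : g_sigma_preimage coors set0.
Proof. exact: sigma_algebra0. Qed.

Let rV_setC A : g_sigma_preimage coors A -> g_sigma_preimage coors (~` A).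
Proof. exact: sigma_algebraC. Qed.

Let rV_bigcup (F : _^nat) : (forall i, g_sigma_preimage coors (F i)) ->
  g_sigma_preimage coors (\bigcup_i (F i)).
Proof. exact: sigma_algebra_bigcup. Qed.

(* The product sigma-algebra, i.e. the Borel sets of R^n. *)
HB.instance Definition _ := @isMeasurable.Build rV_display
  'rV[R]_n (g_sigma_preimage coors) rV_set0 rV_setC rV_bigcup.

Lemma measurable_coord (i : 'I_n) :
  measurable_fun [set: 'rV[R]_n] (fun x : 'rV[R]_n => x ord0 i).
Proof.
move=> _ Y mY; rewrite setTI; apply: sub_sigma_algebra => /=.
rewrite -bigcup_seq/=; exists i => /=; first by rewrite mem_index_enum.
by exists Y => //; rewrite setTI.
Qed.

Lemma measurable_fun_rV d (T : measurableType d) (f : T -> 'rV[R]_n) :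
  (forall i, measurable_fun [set: T] (fun t => f t ord0 i)) ->
  measurable_fun [set: T] f.
Proof.
move=> mf; apply: (@measurability _ _ _ _ setT f
  (\big[setU/set0]_(i < n) preimage_set_system setT (coors i) measurable)) => //.
move=> _ [B + <-]; rewrite -bigcup_seq => -[i /= _ [A mA <-]].
by rewrite !setTI -comp_preimage -[X in measurable X]setTI; exact: mf.
Qed.

End measurable_rV.

Section rV_cons.
Context (R : realType) (n : nat).

Definition rV_cons (p : R * 'rV[R]_n) : 'rV[R]_n.+1 := row_mx p.1%:M p.2.
Definition rV_uncons (x : 'rV[R]_n.+1) : R * 'rV[R]_n :=
  (x ord0 ord0, rsubmx (x : 'rV[R]_(1 + n))).

Lemma rV_consK : cancel rV_cons rV_uncons.
Proof.
move=> [x y]; rewrite /rV_uncons /rV_cons row_mxKr /=; congr pair.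
transitivity ((row_mx x%:M y : 'rV[R]_(1 + n)) ord0 (lshift n ord0)).
  by congr (_ _ _); apply: val_inj.
by rewrite row_mxEl mxE eqxx mulr1n.
Qed.

Lemma rV_unconsK : cancel rV_uncons rV_cons.
Proof.
move=> x; apply: etrans (@hsubmxK _ 1 1 n x).
apply: (f_equal2 (@row_mx R 1 1 n)) => //=.
apply/rowP => i; rewrite !mxE !ord1 ?eqxx ?mulr1n.
by congr (x _ _); apply: val_inj.
Qed.

Lemma measurable_rV_cons : measurable_fun setT rV_cons.
Proof.
apply: measurable_fun_rV => i; case: (@split_ordP 1 n i) => j ->.
- apply: (eq_measurable_fun fst) => [p _|]; last exact: measurable_fst.
  by apply/esym; apply: etrans (row_mxEl _ _ _ _) _; rewrite !ord1 mxE eqxx.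
- apply: (eq_measurable_fun (fun p : R * 'rV[R]_n => p.2 ord0 j)) => [p _|].
    by apply/esym; exact: row_mxEr.
  exact: measurableT_comp (measurable_coord j) measurable_snd.
Qed.

Lemma measurable_rV_uncons : measurable_fun setT rV_uncons.
Proof.
apply: measurable_fun_pair; first exact: measurable_coord.
apply: measurable_fun_rV => i; under eq_fun do rewrite mxE.
exact: measurable_coord.
Qed.

Variable mu : {sigma_finite_measure set 'rV[R]_n -> \bar R}.

Definition leb_cons : set 'rV[R]_n.+1 -> \bar R :=
  pushforward (@lebesgue_measure R \x mu)%E rV_cons.

Let leb_cons0 : leb_cons set0 = 0%E.
Proof. by rewrite /leb_cons /pushforward preimage_set0 measure0. Qed.

Let leb_cons_ge0 A : (0 <= leb_cons A)%E.
Proof. by rewrite /leb_cons /pushforward; exact: measure_ge0. Qed.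

Let leb_cons_sigma_additive : semi_sigma_additive leb_cons.
Proof.
move=> F mF tF mUF; rewrite /leb_cons /pushforward preimage_bigcup.
apply: measure_semi_sigma_additive.
- by move=> k; rewrite -[X in measurable X]setTI; exact: measurable_rV_cons.
- apply/trivIsetP => /= i j _ _ ij; rewrite -preimage_setI.
  by move/trivIsetP : tF => /(_ _ _ _ _ ij) ->//; rewrite preimage_set0.
- by rewrite -preimage_bigcup -[X in measurable X]setTI;
    exact: measurable_rV_cons.
Qed.

HB.instance Definition _ := isMeasure.Build _ _ _
  leb_cons leb_cons0 leb_cons_ge0 leb_cons_sigma_additive.

Let leb_cons_sigma_finite : sigma_finite setT leb_cons.
Proof.
have /sigma_finiteP[F [TF ndF Foo]] := sigma_finiteT (@lebesgue_measure R).
have /sigma_finiteP[G [TG ndG Goo]] := sigma_finiteT mu.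
exists (fun k => rV_uncons @^-1` (F k `*` G k)).
  apply/esym; rewrite -subTset => x _.
  have [i _ Fi] : (\bigcup_i F i) (rV_uncons x).1 by rewrite -TF.
  have [j _ Gj] : (\bigcup_i G i) (rV_uncons x).2 by rewrite -TG.
  exists (maxn i j) => //; split.
  - by move: Fi; exact/subsetPset/ndF/leq_maxl.
  - by move: Gj; exact/subsetPset/ndG/leq_maxr.
move=> k; have [mF Fk] := Foo k; have [mG Gk] := Goo k; split.
  rewrite -[X in measurable X]setTI; apply: measurable_rV_uncons => //.
  exact: measurableX.
rewrite /leb_cons /pushforward -comp_preimage.
rewrite (_ : _ \o _ = id) ?preimage_id; last exact/funext/rV_consK.
by rewrite product_measure1E// lte_mul_pinfty// ge0_fin_numE.
Qed.

HB.instance Definition _ := Measure_isSigmaFinite.Build _ _ _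
  leb_cons leb_cons_sigma_finite.

End rV_cons.

(* n-dimensional Lebesgue measure, as an n-fold product; R^0 carries a unit
   mass. *)
Fixpoint leb (R : realType) (n : nat) :
    {sigma_finite_measure set 'rV[R]_n -> \bar R} :=
  match n with
  | 0 => @dirac _ 'rV[R]_0 0 R
  | m.+1 => leb_cons (leb R m)
  end.

Section classical.
Context (R : realType).
Implicit Types (n d : nat) (al : R).

Definition dot n (x y : 'rV[R]_n) : R := \sum_i x ord0 i * y ord0 i.

(* The norm `|x| that MathComp-Analysis puts on 'rV[R]_n is the sup norm. *)
Definition enorm n (x : 'rV[R]_n) : R := Num.sqrt (dot x x).

Definition angle n (x y : 'rV[R]_n) : R := acos (dot x y / (enorm x * enorm y)).

Definition partial n (i : 'I_n) (f : 'rV[R]_n -> R) (x : 'rV[R]_n) : R :=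
  'D_(delta_mx ord0 i) f x.

Definition grad n (f : 'rV[R]_n -> R) (x : 'rV[R]_n) : 'rV[R]_n :=
  \row_i partial i f x.

Definition bdry n (A : set 'rV[R]_n) : set 'rV[R]_n := closure A `\` interior A.

Definition holder_on n al (A : set 'rV[R]_n) (f : 'rV[R]_n -> R) : Prop :=
  exists C : R, forall x y, A x -> A y -> `|f x - f y| <= C * enorm (x - y) `^ al.

(* C^{0,al}(closure O); for bounded O, boundedness is automatic. *)
Definition C0_holder n al (O : set 'rV[R]_n) (f : 'rV[R]_n -> R) : Prop :=
  holder_on al (closure O) f.

(* C^1(closure O) with gradient g: f is continuous on the closure and its
   gradient on the open set O extends to g, continuous on the closure. *)
Definition C1_closure_with n (O : set 'rV[R]_n) (f : 'rV[R]_n -> R)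
    (g : 'rV[R]_n -> 'rV[R]_n) : Prop :=
  [/\ {within closure O, continuous f},
      {within closure O, continuous g} &
      forall x, O x -> differentiable f x /\ grad f x = g x].

Definition C1_closure n (O : set 'rV[R]_n) (f : 'rV[R]_n -> R) : Prop :=
  exists g, C1_closure_with O f g.

Definition C1_holder n al (O : set 'rV[R]_n) (f : 'rV[R]_n -> R) : Prop :=
  exists2 g, C1_closure_with O f g &
    forall i, holder_on al (closure O) (fun x => g x ord0 i).

(* Near each boundary point, and up to permuting and reflecting the coordinate
   axes, the set is the strict epigraph of a C^{1,al} function of the remaining
   n - 1 coordinates.  [ball] is a cube here. *)
Definition C1_holder_boundary n al (O : set 'rV[R]_n) : Prop :=
  forall x0, bdry O x0 ->
    exists r : R, 0 < r /\
    exists (i : 'I_n) (s : bool) (g : 'rV[R]_n.-1 -> R),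
      C1_holder al (ball (col' i x0) r) g /\
      forall x, ball x0 r x -> (O x <-> g (col' i x) < (-1) ^+ s * x ord0 i).

Definition bounded_domain_C1_holder n al (O : set 'rV[R]_n) : Prop :=
  [/\ O !=set0, open O, connected O, bounded_set O & C1_holder_boundary al O].

Fixpoint Cn n (k : nat) (f : 'rV[R]_n -> R) : Prop :=
  match k with
  | 0 => continuous f
  | j.+1 => (forall x, differentiable f x) /\ forall i, Cn j (partial i f)
  end.

(* C_c^oo(O), by iterated partial derivatives *)
Definition test_fun n (O : set 'rV[R]_n) (f : 'rV[R]_n -> R) : Prop :=
  [/\ forall k, Cn k f,
      compact (closure [set x | f x != 0]) &
      closure [set x | f x != 0] `<=` O].

Definition L2 n (O : set 'rV[R]_n) (f : 'rV[R]_n -> R) : Prop :=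
  measurable_fun O f /\ (leb R n).-integrable O (fun x => (f x ^+ 2)%:E).

Definition Linfty n (O : set 'rV[R]_n) (f : 'rV[R]_n -> R) : Prop :=
  measurable_fun O f /\
  exists M : R, {ae leb R n, forall x, O x -> `|f x| <= M}.

Definition weak_grad n (O : set 'rV[R]_n) (f : 'rV[R]_n -> R)
    (Df : 'rV[R]_n -> 'rV[R]_n) : Prop :=
  forall phi, test_fun O phi -> forall i,
    \int[leb R n]_(x in O) (f x * partial i phi x) =
    - \int[leb R n]_(x in O) (Df x ord0 i * phi x).

(* f is in H^1(O) and Df is its weak gradient *)
Definition H1 n (O : set 'rV[R]_n) (f : 'rV[R]_n -> R)
    (Df : 'rV[R]_n -> 'rV[R]_n) : Prop :=
  [/\ L2 O f, forall i, L2 O (fun x => Df x ord0 i) & weak_grad O f Df].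

Definition H1_norm2 n (O : set 'rV[R]_n) (f : 'rV[R]_n -> R)
    (Df : 'rV[R]_n -> 'rV[R]_n) : R :=
  \int[leb R n]_(x in O) (f x ^+ 2 + dot (Df x) (Df x)).

(* f is in H^1_0(O), the closure of C_c^oo(O) in H^1(O), with weak gradient Df *)
Definition H10 n (O : set 'rV[R]_n) (f : 'rV[R]_n -> R)
    (Df : 'rV[R]_n -> 'rV[R]_n) : Prop :=
  H1 O f Df /\
  forall e : R, 0 < e -> exists2 phi, test_fun O phi &
    H1_norm2 O (fun x => f x - phi x) (fun x => Df x - grad phi x) < e.

(* f and g, both in H^1(O), have the same trace on the boundary of O: as is
   usual for weak solutions of Dirichlet problems, the trace of a function of
   H^1(O) is its class in H^1(O) / H^1_0(O). *)
Definition eq_trace n (O : set 'rV[R]_n) (f g : 'rV[R]_n -> R) : Prop :=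
  exists D, H10 O (fun x => f x - g x) D.

(* phi, of which only the values on the boundary matter, is the trace of
   Phi in C^{1,al}(closure O) *)
Definition trace_of n al (O : set 'rV[R]_n) (phi Phi : 'rV[R]_n -> R) : Prop :=
  C1_holder al O Phi /\ {in bdry O, phi =1 Phi}.

Definition boundary_datum n al (O : set 'rV[R]_n) (phi : 'rV[R]_n -> R) : Prop :=
  exists Phi, trace_of al O phi Phi.

Local Notation C := R[i].

Definition cintegral n (O : set 'rV[R]_n) (f : 'rV[R]_n -> C) : C :=
  ((\int[leb R n]_(x in O) complex.Re (f x))
   +i* (\int[leb R n]_(x in O) complex.Im (f x)))%C.

(* H^1_0(O; C): real and imaginary parts in H^1_0(O) *)
Definition cH10 n (O : set 'rV[R]_n) (f : 'rV[R]_n -> C)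
    (Df : 'rV[R]_n -> 'rV[C]_n) : Prop :=
  H10 O (fun x => complex.Re (f x)) (fun x => map_mx (@complex.Re R) (Df x)) /\
  H10 O (fun x => complex.Im (f x)) (fun x => map_mx (@complex.Im R) (Df x)).

Definition dirichlet_eigenvalue n (O : set 'rV[R]_n) (a q : 'rV[R]_n -> R)
    (k : R) : Prop :=
  exists (u : 'rV[R]_n -> C) (Du : 'rV[R]_n -> 'rV[C]_n),
    [/\ cH10 O u Du,
        ~ {ae leb R n, forall x, O x -> u x = 0} &
        forall v Dv, cH10 O v Dv ->
          cintegral O (fun x =>
            (a x)%:C%C * (\sum_i Du x ord0 i * (Dv x ord0 i)^*%C)
            - (k * q x)%:C%C * u x * (v x)^*%C) = 0].

(* u is a weak solution of - div (a grad u) - k q u = 0 in O, u = phi on the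
   boundary of O *)
Definition helmholtz_solution n al (O : set 'rV[R]_n) (a q : 'rV[R]_n -> R)
    (k : R) (phi u : 'rV[R]_n -> R) : Prop :=
  [/\ exists2 Du, H1 O u Du &
        forall v Dv, H10 O v Dv ->
          \int[leb R n]_(x in O) (a x * dot (Du x) (Dv x) - k * q x * u x * v x)
          = 0 &
      exists2 Phi, trace_of al O phi Phi & eq_trace O u Phi].

Definition proper_measurements n (O : set 'rV[R]_n) (K : {fset R})
    (u1 u2 u3 : R -> 'rV[R]_n -> R) : Prop :=
  exists p r : R, [/\ 0 < p, 0 < r &
    forall x, O x -> exists k : R, [/\ k \in K, p <= `|u1 k x| &
      r <= enorm (grad (u2 k) x) * enorm (grad (u3 k) x) *
           `|sin (angle (grad (u2 k) x) (grad (u3 k) x))|]].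

Definition energy_e n (q : 'rV[R]_n -> R) (u : R -> 'I_3 -> 'rV[R]_n -> R)
    (k : R) (i j : 'I_3) (x : 'rV[R]_n) : R := q x * u k i x * u k j x.

Definition energy_E n (a : 'rV[R]_n -> R) (u : R -> 'I_3 -> 'rV[R]_n -> R)
    (k : R) (i j : 'I_3) (x : 'rV[R]_n) : R :=
  a x * dot (grad (u k i) x) (grad (u k j) x).

Definition tr_e n (q : 'rV[R]_n -> R) (u : R -> 'I_3 -> 'rV[R]_n -> R)
    (K : {fset R}) (x : 'rV[R]_n) : R :=
  \sum_(k <- K) \sum_(i < 3) energy_e q u k i i x.

(* w in H^1(O) is a weak solution of
     - div (G t grad w) = - div (G grad t) + f in O,
     w = g on the boundary of O,
   where t and g are themselves required to be in H^1(O). *)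
Definition divergence_solution n (O : set 'rV[R]_n) (G t f g w : 'rV[R]_n -> R)
    : Prop :=
  [/\ exists Dw Dt, [/\ H1 O w Dw, H1 O t Dt &
        forall v Dv, H10 O v Dv ->
          \int[leb R n]_(x in O) (G x * t x * dot (Dw x) (Dv x)) =
          \int[leb R n]_(x in O) (G x * dot (Dt x) (Dv x) + f x * v x)],
      exists Dg, H1 O g Dg &
      eq_trace O w g].

End classical.

(* Main.v *)
Require Import Defs.
Set Warnings "-notation-incompatible-prefix,-notation-overridden,-ambiguous-paths".
From mathcomp Require Import all_boot all_order all_algebra finmap.
From mathcomp Require Import all_classical all_reals all_analysis.
From mathcomp Require Import measurable_realfun ring lra.

Set Implicit Arguments.
Unset Strict Implicit.
Unset Printing Implicit Defensive.
Import Order.TTheory GRing.Theory Num.Theory.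
Import numFieldNormedType.Exports.
Local Open Scope classical_set_scope.
Local Open Scope ring_scope.

(** Write S for the sum of (u_k^i)^2 over k in K and i, so that tr(e) = q S and
    G tr(e) = a S.

    Existence.  Multiplying the equation of u = u_k^i by u gives the identity
    - div (a u grad u) + a |grad u|^2 - k q u^2 = 0, in weak form the equation
    tested with u phi (helm_test).  Summation over k and i gives
    div (a grad S) = 2 sum (E_k^{ii} - k e_k^{ii}), since a grad S is twice the
    sum of the fluxes a u grad u.  On the other hand
    grad (tr e) = q grad S + S grad q, whence
    G grad (tr e) = a grad S + G tr(e) grad (log q); taking divergences yields
    the equation of log q (log_identity).

    Uniqueness.  The difference z of a solution and log q is in H^1_0 and
    satisfies div (a S grad z) = 0.  Properness bounds |u_k^1| below by p > 0
    for some k at every point, so a S >= lam p^2 > 0; testing with z gives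
    grad z = 0, and z = 0 by Poincare's inequality (log_unique, H10_grad0).

    These computations are carried out with weak gradients on an arbitrary open
    set of finite measure, which rests on the following facts.  Test functions
    are dense in L^2 (test_fun_dense), so that weak gradients are unique
    (weak_grad_unique) and classical gradients may be substituted for them.
    The product of a function of H^1 and a test function is in H^1_0, being
    approximated by its mollifications (H10_mul_test): this makes u phi an
    admissible test function and yields the product rule for bounded functions
    of H^1 (H1bM).  Identities tested with smooth functions extend to H^1_0
    (H10_pairing).  Finally log q is in H^1 with gradient grad q / q (H1b_ln):
    on an interval [b1, b2] with b1 > 0 the logarithm is approximated by
    polynomials together with its derivative, and for polynomials the chain
    rule is the product rule. *)

(** * Lebesgue measure on row vectors *)

Section lebesgue_rV.
Context {R : realType}.

Lemma normr_coord_le n (x : 'rV[R]_n) i : `|x ord0 i| <= `|x|.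
Proof.
rewrite [leRHS]/Num.norm /= mx_normrE.
exact: (le_bigmax _ (fun ij : 'I_1 * 'I_n => `|x ij.1 ij.2|) (ord0, i)).
Qed.

Lemma normr_rV_lt n (x : 'rV[R]_n) (r : R) : 0 < r ->
  (`|x| < r) <-> (forall i, `|x ord0 i| < r).
Proof.
move=> r0; split=> [xr i|xr]; first exact: le_lt_trans (normr_coord_le _ _) xr.
rewrite /Num.norm /= mx_normrE; apply/bigmax_ltP; split => // -[i j] _ /=.
by rewrite ord1.
Qed.

Lemma normr_rV_le n (x : 'rV[R]_n) (r : R) : 0 <= r ->
  (`|x| <= r) <-> (forall i, `|x ord0 i| <= r).
Proof.
move=> r0; split=> [xr i|xr]; first exact: le_trans (normr_coord_le _ _) xr.
rewrite /Num.norm /= mx_normrE; apply/bigmax_leP; split => // -[i j] _ /=.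
by rewrite ord1.
Qed.

Lemma ballE (V : normedModType R) (c : V) r : ball c r = [set y | `|c - y| < r].
Proof. by rewrite -ball_normE. Qed.

Lemma measurable_ball_rV n (c : 'rV[R]_n) r : measurable (ball c r).
Proof.
have [r0|r0] := leP r 0.
  rewrite (_ : ball c r = set0) //; apply/seteqP; split => // y.
  rewrite ballE /= => /lt_le_trans/(_ r0).
  by rewrite ltNge normr_ge0.
rewrite (_ : ball c r =
    \bigcap_(i in [set: 'I_n]) ((fun x => x ord0 i) @^-1` ball (c ord0 i) r)).
  apply: fin_bigcap_measurable; first exact: finite_finset.
  move=> i _; rewrite -[X in measurable X]setTI; apply: measurable_coord => //.
  by apply: measurable_realfun.open_measurable; exact: ball_open.
apply/seteqP; split => y.
  by rewrite ballE /= => /(normr_rV_lt _ r0) cy i _; have := cy i;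
    rewrite !mxE ballE.
move=> cy; rewrite ballE; apply/(normr_rV_lt _ r0) => i.
by have := cy i I; rewrite /= ballE /= !mxE.
Qed.

(** The closed cube is kept inside U so that a bump function on the open cube
    is a test function of U. *)
Lemma rational_ball n (U : set 'rV[R]_n) x : open U -> U x ->
  exists p : 'rV[rat]_n * nat, ball (map_mx ratr p.1 : 'rV[R]_n) p.2.+1%:R^-1 x /\
    [set y | `|(map_mx ratr p.1 : 'rV[R]_n) - y| <= p.2.+1%:R^-1] `<=` U.
Proof.
move=> oU Ux; have /nbhs_ballP[e /= e0 xeU] : nbhs x U by exact: open_nbhs_nbhs.
have e20 : 0 < e / 2 by rewrite divr_gt0.
have [m _ /(_ m (leqnn m)) /= me] := near_infty_natSinv_lt (PosNum e20).
have c_ i : {c : rat | `|x ord0 i - ratr c| < m.+1%:R^-1}.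
  apply/cid; have [c] := @rat_in_itvoo _ (x ord0 i - m.+1%:R^-1) (x ord0 i + m.+1%:R^-1)
    ltac:(by rewrite ltrD2l gtrN// invr_gt0).
  by rewrite in_itv /= => /andP[c1 c2]; exists c; rewrite ltr_distlC c1.
pose y0 : 'rV[R]_n := map_mx ratr (\row_i sval (c_ i)).
have xc : ball y0 m.+1%:R^-1 x.
  rewrite ballE /=; apply/normr_rV_lt => // i; rewrite !mxE distrC.
  exact: (svalP (c_ i)).
exists (\row_i sval (c_ i), m); split => //= y cy; apply: xeU.
rewrite ballE /= -(subrKA y0) (le_lt_trans (ler_normD _ _))// (splitr e).
rewrite ltrD ?(le_lt_trans cy)// distrC.
by move: xc; rewrite ballE /= => /lt_trans; apply.
Qed.

(** Cubes with rational centres and radii form a countable basis, so the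
    product sigma-algebra contains the open sets. *)
Lemma open_measurable_rV n (U : set 'rV[R]_n) : open U -> measurable U.
Proof.
move=> oU.
pose B (p : 'rV[rat]_n * nat) : set 'rV[R]_n :=
  ball (map_mx ratr p.1 : 'rV[R]_n) (p.2.+1%:R^-1).
rewrite (_ : U = \bigcup_p (if `[< B p `<=` U >] then B p else set0)).
  apply: countable_bigcupT_measurable => // p.
  by case: ifP => // _; exact: measurable_ball_rV.
apply/seteqP; split; last by move=> x [p _]; case: asboolP => // BU /BU.
move=> x Ux; have [p [px pU]] := rational_ball oU Ux.
exists p => //; rewrite asboolT//= => y; rewrite /B ballE /= => /ltW; exact: pU.
Qed.

Lemma measurable_fun_continuous_rV n (D : set 'rV[R]_n) (f : 'rV[R]_n -> R) :
  open D -> (forall x, D x -> {for x, continuous f}) -> measurable_fun D f.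
Proof.
move=> oD cf; apply: (measurability _ (RGenOpens.measurableE R)) => _ [_ [a [b ->] <-]].
apply: open_measurable_rV; rewrite openE => x [Dx /= fx].
have : nbhs x (f @^-1` `]a, b[%classic).
  by apply: (cf x Dx); apply: open_nbhs_nbhs; split => //; exact: interval_open.
by move=> h; apply: filterI => //; apply: open_nbhs_nbhs.
Qed.

Let mcons n : @measurable_fun _ _ (measurableTypeR R * 'rV[R]_n)%type 'rV[R]_n.+1
  setT (@rV_cons R n).
Proof. exact: measurable_rV_cons. Qed.

Lemma ge0_integral_leb_cons n (f : 'rV[R]_n.+1 -> \bar R) :
  measurable_fun setT f -> (forall x, 0 <= f x)%E ->
  (\int[leb R n.+1]_x f x =
   \int[leb R n]_y \int[@lebesgue_measure R]_s f (rV_cons (s, y)))%E.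
Proof.
move=> mf f0.
have mfc := measurableT_comp mf (@mcons n).
transitivity (\int[@lebesgue_measure R \x leb R n]_z (f \o @rV_cons R n) z)%E.
  have -> : leb R n.+1 =
      pushforward (@lebesgue_measure R \x leb R n)%E (@rV_cons R n)
      :> (set _ -> \bar R) by [].
  by rewrite (ge0_integral_pushforward (@mcons n)).
exact: (@fubini_tonelli2 _ _ _ _ _ (@lebesgue_measure R) (leb R n) _ mfc (fun z => f0 _)).
Qed.

Lemma ge0_integral_lebesgue_shift (f : R -> \bar R) (a : R) :
  measurable_fun setT f -> (forall x, 0 <= f x)%E ->
  (\int[@lebesgue_measure R]_s f (s + a)%R = \int[@lebesgue_measure R]_s f s)%E.
Proof.
move=> mf f0.
have ma : @measurable_fun _ _ (measurableTypeR R) (measurableTypeR R) setT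
    (fun s => s + a) by exact: measurable_funD.
have mf' : @measurable_fun _ _ (measurableTypeR R) _ setT f := mf.
rewrite -(ge0_integral_pushforward ma (@lebesgue_measure R) measurableT mf'
  (fun x _ => f0 x)).
apply: eq_measure_integral => A mA _; apply/esym.
apply: lebesgue_measure_unique => //= _ [[x y] _ <-].
rewrite /pushforward /=.
rewrite (_ : _ @^-1` _ = `]x - a, y - a]%classic); last first.
  by apply/seteqP; split => z /=; rewrite !in_itv /= ltrBlDr lerBrDr.
rewrite !lebesgue_measure_itv /= !lte_fin ltrD2r.
by case: ifPn => // _; rewrite -!EFinB; congr (_%:E); ring.
Qed.

Lemma rV_consD n (s : R) (y : 'rV[R]_n) (a : 'rV[R]_n.+1) :
  rV_cons (s, y) + a = rV_cons (s + (rV_uncons a).1, y + (rV_uncons a).2).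
Proof.
rewrite -[a in LHS]rV_unconsK; case: (rV_uncons a) => t b /=.
by rewrite /rV_cons /= -[LHS]/(row_mx _ _ + row_mx _ _ :> 'rV[R]_(1 + n)) add_row_mx raddfD.
Qed.

Lemma measurable_shift_rV n (a : 'rV[R]_n) : measurable_fun setT (fun x : 'rV[R]_n => x + a).
Proof.
apply: measurable_fun_rV => i; under eq_fun do rewrite mxE.
by apply: measurable_funD => //; exact: measurable_coord.
Qed.

(** Translation invariance passes from dimension n to n + 1 by Tonelli. *)
Lemma ge0_integral_leb_shift n (f : 'rV[R]_n -> \bar R) (a : 'rV[R]_n) :
  measurable_fun setT f -> (forall x, 0 <= f x)%E ->
  (\int[leb R n]_x f (x + a)%R = \int[leb R n]_x f x)%E.
Proof.
elim: n f a => [|n IH] f a mf f0.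
  by rewrite (_ : a = 0) ?[a]thinmx0 //; under eq_integral do rewrite addr0.
have ms := measurableT_comp mf (measurable_shift_rV a).
rewrite (ge0_integral_leb_cons mf f0) (ge0_integral_leb_cons ms (fun x => f0 _)).
pose g y := (\int[@lebesgue_measure R]_s f (rV_cons (s, y)))%E.
transitivity (\int[leb R n]_y g (y + (rV_uncons a).2)%R)%E.
  apply: eq_integral => y _; rewrite /g /=.
  under eq_integral do rewrite rV_consD.
  apply: (ge0_integral_lebesgue_shift _
    (f := fun s => f (rV_cons (s, y + (rV_uncons a).2)))) => //.
  apply: (measurableT_comp mf); apply: (measurableT_comp (@mcons n)).
  exact: pair2_measurable.
apply: IH => [|y]; last exact: integral_ge0.
have := @measurable_fun_fubini_tonelli_G _ _ _ _ R (@lebesgue_measure R)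
  (fun p => f (rV_cons p)); apply => //.
exact: measurableT_comp mf (@mcons n).
Qed.

Lemma normr_rV_cons n (p : R * 'rV[R]_n) (r : R) : 0 < r ->
  `|rV_cons p| < r <-> `|p.1| < r /\ `|p.2| < r.
Proof.
have E1 (j : 'I_1) : rV_cons p ord0 (lshift n j) = p.1.
  by apply: etrans (row_mxEl _ _ _ _) _; rewrite mxE !ord1 eqxx.
have E2 i : rV_cons p ord0 (rshift 1 i) = p.2 ord0 i by exact: row_mxEr.
move=> r0; rewrite !normr_rV_lt//; split=> [h|[h1 h2] i].
  by split=> [|i]; [have := h (lshift n (ord0 : 'I_1)); rewrite E1|
    have := h (rshift 1 i); rewrite E2].
by case: (@split_ordP 1 n i) => j ->; rewrite ?E1 ?E2.
Qed.

Lemma leb_ball n (c : 'rV[R]_n) (r : R) : 0 < r ->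
  leb R n (ball c r) = ((r *+ 2) ^+ n)%:E.
Proof.
move=> r0; elim: n c => [|n IH] c.
  by rewrite expr0 /= diracE mem_set// ballE /= [c]thinmx0 subrr normr0.
rewrite /= /leb_cons /pushforward.
rewrite (_ : _ @^-1` _ = ball (rV_uncons c).1 r `*` ball (rV_uncons c).2 r).
  rewrite product_measure1E ?IH//; last first.
  - exact: measurable_ball_rV.
  - by apply: measurable_realfun.open_measurable; exact: ball_open.
  transitivity ((@lebesgue_measure R (ball (rV_uncons c).1 r)) *
    ((r *+ 2) ^+ n)%:E)%E; first by [].
  by rewrite lebesgue_measure_ball ?ltW// -EFinM exprS.
have cE s y : `|c - rV_cons (s, y)| < r <->
    `|(rV_uncons c).1 - s| < r /\ `|(rV_uncons c).2 - y| < r.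
  rewrite distrC rV_consD normr_rV_cons//= !mxE distrC.
  rewrite (_ : _ + _ = - (@rsubmx R 1 1 n c - y)) ?normrN//.
  by apply/rowP => i; rewrite !mxE opprB.
by apply/seteqP; split => -[s y] /=; rewrite !ballE /= => /cE.
Qed.

Lemma bounded_leb_lty n (A : set 'rV[R]_n) : measurable A -> bounded_set A ->
  (leb R n A < +oo)%E.
Proof.
move=> mA [M [_ /(_ (`|M| + 1)) AM]].
have M0 : 0 < `|M| + 1 by rewrite ltr_wpDl.
apply: (@le_lt_trans _ _ (leb R n (ball 0 (`|M| + 1 + 1)))); last first.
  by rewrite leb_ball ?ltry// addr_gt0.
apply: le_measure; rewrite ?inE//; first exact: measurable_ball_rV.
move=> x Ax; rewrite ballE /= sub0r normrN (le_lt_trans (AM _ _ Ax)) ?ltrDl//.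
by rewrite (le_lt_trans (ler_norm _))// ltrDl.
Qed.

End lebesgue_rV.

(** * Smooth functions and test functions *)

Section smooth.
Context {R : realType} {n : nat}.
Implicit Types (f g : 'rV[R]_n -> R) (x y z h : 'rV[R]_n).

Definition smooth f := forall k, Cn k f.

Lemma partialD f g i x : differentiable f x -> differentiable g x ->
  partial i (fun y => f y + g y) x = partial i f x + partial i g x.
Proof. by move=> df dg; apply: deriveD; exact: diff_derivable. Qed.

Lemma partialM f g i x : differentiable f x -> differentiable g x ->
  partial i (fun y => f y * g y) x = f x * partial i g x + g x * partial i f x.
Proof. by move=> df dg; apply: deriveM; exact: diff_derivable. Qed.

Lemma partial_cst (c : R) i x : partial i (fun=> c) x = 0.
Proof. exact: derive_cst. Qed.

Lemma Cn_continuous k f : Cn k f -> continuous f.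
Proof.
by case: k => // k [df _] x; exact: differentiable_continuous.
Qed.

Lemma CnW k f : Cn k.+1 f -> Cn k f.
Proof.
elim: k f => [|k IH] f; first exact: Cn_continuous.
by move=> [df pf]; split => // i; exact/IH/pf.
Qed.

Lemma Cn_cst k (c : R) : Cn k (fun _ : 'rV[R]_n => c).
Proof.
elim: k c => [|k IH] c /=; first exact: cst_continuous.
split=> [x|i]; first exact: differentiable_cst.
by rewrite (_ : partial i _ = fun=> 0) //; apply/funext => x; exact: partial_cst.
Qed.

Lemma CnD k f g : Cn k f -> Cn k g -> Cn k (fun x => f x + g x).
Proof.
elim: k f g => [|k IH] f g /=; first by move=> cf cg x; exact: cvgD (cf x) (cg x).
move=> [df pf] [dg pg]; split=> [x|i]; first exact: differentiableD.
rewrite (_ : partial i _ = fun x => partial i f x + partial i g x); first exact: IH.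
by apply/funext => x; exact: partialD.
Qed.

Lemma CnM k f g : Cn k f -> Cn k g -> Cn k (fun x => f x * g x).
Proof.
elim: k f g => [|k IH] f g; first by move=> cf cg x; exact: cvgM (cf x) (cg x).
move=> Cf Cg; have := Cf; have := Cg => -[dg pg] [df pf].
split=> [x|i]; first exact: differentiableM.
rewrite (_ : partial i _ = fun x => f x * partial i g x + g x * partial i f x).
  exact: (CnD (IH _ _ (CnW Cf) (pg i)) (IH _ _ (CnW Cg) (pf i))).
by apply/funext => x; exact: partialM.
Qed.

Lemma smooth_differentiable f : smooth f -> forall x, differentiable f x.
Proof. by move=> /(_ 1%N) []. Qed.

Lemma smooth_continuous f : smooth f -> continuous f.
Proof. by move=> /(_ 0%N). Qed.

Lemma smooth_partial f i : smooth f -> smooth (partial i f).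
Proof. by move=> sf k; have [_ /(_ i)] := sf k.+1. Qed.

Lemma smooth_cst c : smooth (fun=> c).
Proof. by move=> k; exact: Cn_cst. Qed.

Lemma smoothD f g : smooth f -> smooth g -> smooth (fun x => f x + g x).
Proof. by move=> sf sg k; exact: CnD. Qed.

Lemma smoothM f g : smooth f -> smooth g -> smooth (fun x => f x * g x).
Proof. by move=> sf sg k; exact: CnM. Qed.

Lemma smoothB f g : smooth f -> smooth g -> smooth (fun x => f x - g x).
Proof.
move=> sf sg; rewrite (_ : (fun _ => _) = fun x => f x + (-1) * g x).
  by apply: smoothD => //; apply: smoothM => //; exact: smooth_cst.
by apply/funext => x; rewrite mulN1r.
Qed.

Lemma smoothX f m : smooth f -> smooth (fun x => f x ^+ m).
Proof.
move=> sf; elim: m => [|m IH]; first exact: smooth_cst.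
by under eq_fun do rewrite exprS; exact: smoothM.
Qed.

Lemma smooth_prod (I : Type) (s : seq I) (F : I -> 'rV[R]_n -> R) :
  (forall i, smooth (F i)) -> smooth (fun x => \prod_(i <- s) F i x).
Proof.
move=> sF; elim: s => [|i s IH].
  by under eq_fun do rewrite big_nil; exact: smooth_cst.
by under eq_fun do rewrite big_cons; exact: smoothM.
Qed.

Lemma smooth_sum (I : Type) (s : seq I) (F : I -> 'rV[R]_n -> R) :
  (forall i, smooth (F i)) -> smooth (fun x => \sum_(i <- s) F i x).
Proof.
move=> sF; elim: s => [|i s IH].
  by under eq_fun do rewrite big_nil; exact: smooth_cst.
by under eq_fun do rewrite big_cons; exact: smoothD.
Qed.

Lemma partial_coord i j x : partial j (fun x => x ord0 i) x = (i == j)%:R.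
Proof.
rewrite /partial deriveE; last exact: differentiable_coord.
have @l : {linear 'rV[R]_n -> R}.
  by exists (fun N : 'rV[R]_n => N ord0 i); do 2![eexists]; do ?[constructor];
    rewrite ?mxE// => ? *; rewrite ?mxE//; move=> ?; rewrite !mxE.
rewrite (_ : (fun x => x ord0 i) = l) // diff_lin /= ?mxE ?eqxx//.
exact: coord_continuous.
Qed.

Lemma smooth_coord i : smooth (fun x => x ord0 i).
Proof.
case=> [|k]; first by move=> x; exact/differentiable_continuous/differentiable_coord.
split=> [x|j]; first exact: differentiable_coord.
rewrite (_ : partial j _ = fun=> (i == j)%:R); first exact: Cn_cst.
by apply/funext => x; rewrite partial_coord.
Qed.

Lemma derive_partial f x h : differentiable f x ->
  'D_h f x = \sum_i h ord0 i * partial i f x.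
Proof.
move=> df; rewrite deriveE// {1}(row_sum_delta h) linear_sum.
by apply: eq_bigr => i _; rewrite linearZ /= /partial deriveE.
Qed.

Lemma is_derive_line f x h (t : R) : differentiable f (x + t *: h) ->
  is_derive t 1 (fun s : R => f (x + s *: h))
    (\sum_i h ord0 i * partial i f (x + t *: h)).
Proof.
move=> df; rewrite -derive_partial//.
pose l (s : R) := x + s *: h.
have dl : is_diff t l (fun s => s *: h).
  by apply: is_diff_eq; rewrite add0r.
have dfl : differentiable (f \o l) t by exact: differentiable_comp.
split; first exact/derivable1_diffP.
rewrite deriveE//.
by rewrite (@diff_comp _ _ _ _ l f)//= diff_val scale1r deriveE.
Qed.

Lemma is_diff_reflect f x y : differentiable f (x - y) ->
  is_diff y (fun z => f (x - z)) (fun h => - 'd f (x - y) h).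
Proof.
move=> df; pose l z := x - z.
have dl : is_diff y l (fun z => - z) by apply: is_diff_eq; rewrite sub0r.
have dfl := @is_diff_comp _ _ _ _ l _ f _ y dl (differentiableP df).
by apply: is_diff_eq; apply/funext => z /=; rewrite linearN.
Qed.

Lemma partial_reflect f x i y : differentiable f (x - y) ->
  partial i (fun z => f (x - z)) y = - partial i f (x - y).
Proof.
move=> df; have dfl := is_diff_reflect df.
by rewrite /partial deriveE// diff_val deriveE.
Qed.

Lemma smooth_reflect f x : smooth f -> smooth (fun z => f (x - z)).
Proof.
move=> sf k; elim: k f sf => [|k IH] f sf.
  move=> y; apply: differentiable_continuous.
  exact: (@ex_diff _ _ _ _ _ _ _ (is_diff_reflect (smooth_differentiable sf _))).
split=> [y|i].
  exact: (@ex_diff _ _ _ _ _ _ _ (is_diff_reflect (smooth_differentiable sf _))).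
rewrite (_ : partial i _ = fun z => (-1) * partial i f (x - z)).
  by apply: CnM; [exact: Cn_cst|exact/IH/smooth_partial].
by apply/funext => z; rewrite partial_reflect ?mulN1r//; exact: smooth_differentiable.
Qed.

Lemma mean_value f x h : (forall z, differentiable f z) ->
  exists2 c : R, 0 < c < 1 &
    f (x + h) - f x = \sum_i h ord0 i * partial i f (x + c *: h).
Proof.
move=> df.
have [|||c c01 fE] := @MVT R (fun s => f (x + s *: h))
  (fun s => \sum_i h ord0 i * partial i f (x + s *: h)) 0 1.
- exact: ltr01.
- by move=> s _; exact: is_derive_line.
- apply: derivable_within_continuous => s _.
  by have [] := is_derive_line (df (x + s *: h)).
- by exists c => //; move: fE; rewrite scale1r scale0r addr0 subr0 mulr1.
Qed.

Lemma norm_sum_coord_le h (b : 'I_n -> R) (M : R) : (forall i, `|b i| <= M) ->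
  `|\sum_i h ord0 i * b i| <= n%:R * M * `|h|.
Proof.
move=> bM; apply: le_trans (ler_norm_sum _ _ _) _.
rewrite [leRHS](_ : _ = \sum_(i < n) `|h| * M); last first.
  by rewrite sumr_const card_ord mulr_natl -mulrnAl mulrC; ring.
by apply: ler_sum => i _; rewrite normrM ler_pM// normr_coord_le.
Qed.

Lemma lipschitz_partial f (M : R) : (forall z, differentiable f z) ->
  (forall i z, `|partial i f z| <= M) ->
  forall x y, `|f x - f y| <= n%:R * M * `|x - y|.
Proof.
move=> df fM x y; have [c _] := mean_value y (x - y) df.
by rewrite subrKC => ->; exact: norm_sum_coord_le.
Qed.

(** A quadratic bound on the remainder is an inequality, hence passes through
    integrals; differentiability of convolutions will be read off from it. *)
Lemma differentiable_of_remainder f x (l : 'I_n -> R) (C : R) :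
  (forall h, `|f (x + h) - f x - \sum_i h ord0 i * l i| <= C * `|h| ^+ 2) ->
  differentiable f x /\ forall i, partial i f x = l i.
Proof.
move=> fC.
have [L LE] : exists L : {linear 'rV[R]_n -> R},
    (L : 'rV[R]_n -> R) = fun h => \sum_i h ord0 i * l i.
  unshelve eexists.
    exists (fun h : 'rV[R]_n => \sum_i h ord0 i * l i); do 2![eexists]; do ?[constructor].
    - by rewrite big1// => i _; rewrite mxE mul0r.
    - move=> u v; rewrite -big_split /=; apply: eq_bigr => i _.
      by rewrite mxE mulrDl.
    - move=> a u; rewrite scaler_sumr; apply: eq_bigr => i _.
      by rewrite mxE -mulrA.
  by [].
have cL : continuous L.
  rewrite LE; apply: smooth_continuous; apply: smooth_sum => i.
  by apply: smoothM; [exact: smooth_coord|exact: smooth_cst].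
pose V : normedModType R := 'rV[R]_n.
have fL : (f : V -> R^o) \o shift x = cst (f x) + (L : V -> R^o) +o_ (0 : V) id.
  apply/eqaddoP => _/posnumP[e]; near=> h.
  rewrite /= -[X in `|X|]/(f (h + x) - (f x + L h)) opprD addrA [h + x]addrC LE.
  apply: le_trans (fC h) _; rewrite expr2 mulrA ler_wpM2r//.
  have C1 : 0 < `|C| + 1 by rewrite ltr_wpDl.
  apply: (@le_trans _ _ ((`|C| + 1) * `|h|)).
    by rewrite ler_wpM2r// (le_trans (ler_norm C))// lerDl.
  rewrite mulrC -ler_pdivlMr//; near: h.
have dL := @diff_unique _ V R^o f L x cL fL.
have df : differentiable f x.
  by apply/(@diff_locallyP _ V R^o); rewrite dL.
split=> // i; rewrite /partial deriveE// dL LE (bigD1 i)//= big1 ?addr0.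
  by rewrite mxE !eqxx mul1r.
by move=> j ji; rewrite mxE eqxx (negPf ji) mul0r.
Unshelve. all: by end_near. Qed.

End smooth.

Section bump.
Context {R : realType}.

(** All derivatives of s |-> exp (-1 / s), extended by 0, have this form. *)
Definition theta (P : {poly R}) (s : R) : R :=
  if 0 < s then P.[s^-1] * expR (- s^-1) else 0.

(** This is (1 + t / m)^m <= exp t; it makes exp (-1 / s) flatter at 0 than any
    power of s. *)
Lemma exprn_le_expR m (t : R) : 0 <= t -> t ^+ m <= m%:R ^+ m * expR t.
Proof.
move=> t0; case: m => [|m]; first by rewrite !expr0 mul1r -expR0 ler_expR.
have m0 : 0 < m.+1%:R :> R by [].
rewrite {2}(_ : t = (t / m.+1%:R) * m.+1%:R); last by rewrite divfK// gt_eqF.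
rewrite expRM_natr -exprMn lerXn2r// ?nnegrE ?mulr_ge0 ?expR_ge0//.
rewrite -ler_pdivrMl// mulrC.
by apply: le_trans (expR_ge1Dx _); rewrite lerDr.
Qed.

(** The quadratic bound is what the derivative at 0 needs in order to exist
    and vanish. *)
Lemma theta_le_sqr P : exists2 C, 0 <= C & forall s, `|theta P s| <= C * s ^+ 2.
Proof.
exists (\sum_(i < size P) `|P`_i| * ((i + 2)%:R ^+ (i + 2))).
  by apply: sumr_ge0 => i _; rewrite mulr_ge0// exprn_ge0.
move=> s; rewrite /theta; case: ifPn => s0; last first.
  rewrite normr0 mulr_ge0 ?sqr_ge0//.
  by apply: sumr_ge0 => i _; rewrite mulr_ge0// exprn_ge0.
rewrite normrM (ger0_norm (expR_ge0 _)) expRN ler_pdivrMr ?expR_gt0//.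
rewrite mulrAC -ler_pdivrMr ?exprn_gt0//.
rewrite horner_coef -exprVn mulrC -{1}[s^-1 ^+ 2]ger0_norm ?exprn_ge0 ?invr_ge0 ?(ltW s0)//.
rewrite -normrM mulr_sumr; apply: le_trans (ler_norm_sum _ _ _) _.
rewrite mulr_suml; apply: ler_sum => i _.
rewrite mulrCA normrM -exprD addnC -mulrA ler_wpM2l//.
by rewrite ger0_norm ?exprn_ge0 ?invr_ge0 ?(ltW s0)// exprn_le_expR// invr_ge0 ltW.
Qed.

Lemma is_derive_theta (P : {poly R}) (s : R) : is_derive s 1 (theta P) (theta ('X^2 * (P - P^`())) s).
Proof.
have [s0|s0|->] := ltgtP s 0.
- rewrite {2}/theta ltNge (ltW s0) /=.
  apply: (@near_eq_is_derive _ _ _ (cst 0)).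
  near=> x; rewrite /theta ifF//; apply/negbTE; rewrite -leNgt.
  by apply: ltW; near: x; exact: lt_nbhsl.
- rewrite {2}/theta s0.
  have dV : is_derive s 1 (fun x : R => x^-1) (- s^-2).
    split; first by apply: derivableV => //; rewrite gt_eqF.
    by rewrite deriveV ?gt_eqF//= derive_id /GRing.scale /= mulr1.
  have dP := @is_derive1_comp _ (horner P) _ s _ _ (is_derive_poly P s^-1) dV.
  have dE : is_derive s 1 (fun x : R => expR (- x^-1)) (s^-2 * expR (- s^-1)).
    have := @is_derive1_comp _ expR (fun x => - x^-1) s _ _
      (is_derive_expR _) (is_deriveN dV).
    by rewrite opprK mulrC.
  apply: (near_eq_is_derive _ (is_derive_eq (is_deriveM dP dE) _)).
    near=> x; rewrite /theta ifT//; near: x; exact: lt_nbhsr.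
  rewrite hornerM hornerXn hornerD hornerN /= /GRing.scale /= exprVn.
  ring.
- have [C C0 PC] := theta_le_sqr P.
  have C1 : 0 < C + 1 by rewrite ltr_wpDl.
  rewrite {2}/theta ltxx.
  have P0 : theta P 0 = 0 by rewrite /theta ltxx.
  have h : h^-1 *: ((theta P \o shift 0) (h *: 1) - theta P 0) @[h --> 0^'] --> (0 : R).
    rewrite P0; apply/cvgr0Pnorm_le => /= e e0; near=> h.
    rewrite subr0 /= addr0 /GRing.scale /= mulr1 normrM normfV.
    have h0 : h != 0 by near: h; exact: nbhs_dnbhs_neq.
    rewrite ler_pdivrMl ?normr_gt0//.
    apply: le_trans (PC h) _; rewrite -real_normK ?num_real// expr2 mulrCA.
    rewrite ler_wpM2l//; apply: (@le_trans _ _ ((C + 1) * `|h|)).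
      by rewrite ler_wpM2r// lerDl.
    rewrite mulrC -ler_pdivlMr//; near: h; apply: nbhs_dnbhs.
    apply/nbhs_ballP; exists (e / (C + 1)); first exact: divr_gt0.
    by move=> h; rewrite ballE /= sub0r normrN => /ltW.
  by split; [apply/cvg_ex; exists 0|exact/cvg_lim].
Unshelve. all: by end_near. Qed.

Lemma smooth_theta_comp n P (w : 'rV[R]_n -> R) : smooth w -> smooth (fun x => theta P (w x)).
Proof.
move=> sw k; elim: k P => [|k IH] P.
  move=> x; apply: differentiable_continuous.
  apply: (@differentiable_comp _ _ _ _ w (theta P)); first exact: smooth_differentiable.
  by apply/derivable1_diffP; have [] := is_derive_theta P (w x).
have dt x : differentiable (theta P) (w x).
  by apply/derivable1_diffP; have [] := is_derive_theta P (w x).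
split=> [x|i].
  by apply: (@differentiable_comp _ _ _ _ w (theta P)) => //; exact: smooth_differentiable.
rewrite (_ : partial i _ =
    fun x => theta ('X^2 * (P - P^`())) (w x) * partial i w x).
  by apply: CnM; [exact: IH|exact: smooth_partial].
apply/funext => x; have dw := smooth_differentiable sw x.
rewrite /partial deriveE; last exact: (@differentiable_comp _ _ _ _ w (theta P)).
have dP := is_derive_theta P (w x).
rewrite (@diff_comp _ _ _ _ w (theta P))//= deriv1E//.
by rewrite derive1E derive_val -deriveE// /GRing.scale /= mulrC.
Qed.

Lemma theta1_ge0 (s : R) : 0 <= theta 1 s.
Proof. by rewrite /theta; case: ifP => // _; rewrite hornerC mul1r expR_ge0. Qed.

Lemma theta1_le1 (s : R) : theta 1 s <= 1.
Proof.
rewrite /theta; case: ifP => // s0; rewrite hornerC mul1r -expR0 ler_expR.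
by rewrite oppr_le0 invr_ge0 ltW.
Qed.

Lemma theta1_gt0 (s : R) : (0 < theta 1 s) = (0 < s).
Proof.
by rewrite /theta; case: ifP => // s0; rewrite ?ltxx// hornerC mul1r expR_gt0.
Qed.

Section bump_def.
Context {n : nat}.
Implicit Types (c x : 'rV[R]_n).

(** Balls of the sup norm are cubes, hence a product of one-variable bumps. *)
Definition bump c (r : R) x : R := \prod_i theta 1 (r ^+ 2 - (x ord0 i - c ord0 i) ^+ 2).

Lemma smooth_bump c r : smooth (bump c r).
Proof.
apply: smooth_prod => i; apply: smooth_theta_comp; apply: smoothB.
  exact: smooth_cst.
by apply: smoothX; apply: smoothB; [exact: smooth_coord|exact: smooth_cst].
Qed.

Lemma bump_ge0 c r x : 0 <= bump c r x.
Proof. by apply: prodr_ge0 => i _; exact: theta1_ge0. Qed.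

Lemma bump_le1 c r x : bump c r x <= 1.
Proof.
suff /andP[] : 0 <= bump c r x <= 1 by [].
rewrite /bump; elim/big_rec : _ => [|i y _ /andP[y0 y1]]; first by rewrite ler01 lexx.
by rewrite mulr_ge0 ?theta1_ge0//= mulr_ile1 ?theta1_ge0 ?theta1_le1.
Qed.

Lemma bump_gt0 c r x : 0 < r -> (0 < bump c r x) <-> ball c r x.
Proof.
move=> r0; rewrite ballE /= normr_rV_lt//.
have sqE i : (0 < r ^+ 2 - (x ord0 i - c ord0 i) ^+ 2) =
    (`|(c - x) ord0 i| < r).
  rewrite subr_gt0 !mxE distrC -[X in X < _]real_normK ?num_real//.
  by rewrite ltr_pXn2r// nnegrE ltW.
split=> [|h]; last by apply: prodr_gt0 => i _; rewrite theta1_gt0 sqE.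
rewrite lt_neqAle eq_sym => /andP[/prodf_neq0 b0 _] i.
by rewrite -sqE -theta1_gt0 lt_neqAle eq_sym b0// theta1_ge0.
Qed.

Lemma bump_eq0 c r x : 0 < r -> ~ ball c r x -> bump c r x = 0.
Proof.
move=> r0 cx; apply/eqP; rewrite eq_le bump_ge0 andbT leNgt; apply/negP.
by move/(bump_gt0 _ _ r0).
Qed.

Lemma bumpC c r x : bump c r x = bump x r c.
Proof. by apply: eq_bigr => i _; congr (theta 1 _); ring. Qed.

Lemma bump_sub x r y : bump 0 r (x - y) = bump x r y.
Proof. by apply: eq_bigr => i _; rewrite !mxE; congr (theta 1 _); ring. Qed.

End bump_def.
End bump.

Section test_functions.
Context {R : realType} {n : nat}.
Implicit Types (f g : 'rV[R]_n -> R) (x c : 'rV[R]_n) (O K : set 'rV[R]_n).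

Lemma closed_compact_rV K : compact K -> closed K.
Proof. by apply: compact_closed; exact: norm_hausdorff. Qed.

Lemma test_fun_intro O K f : smooth f -> compact K -> K `<=` O ->
  (forall x, ~ K x -> f x = 0) -> test_fun O f.
Proof.
move=> sf cK KO f0.
have sK : closure [set x | f x != 0] `<=` K.
  rewrite closureE; apply: smallest_sub; first exact: closed_compact_rV.
  by move=> x /= fx; apply: contrapT => /f0 fx0; rewrite fx0 eqxx in fx.
split => //; last exact: subset_trans KO.
by apply: subclosed_compact sK => //; exact: closed_closure.
Qed.

Lemma test_fun_smooth O f : test_fun O f -> smooth f.
Proof. by case. Qed.

Lemma test_fun_support O f : test_fun O f ->
  exists K, [/\ compact K, K `<=` O & forall x, ~ K x -> f x = 0].
Proof.
move=> [_ cK KO]; exists (closure [set x | f x != 0]); split => // x nx.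
by apply/eqP; apply: contrapT => /negP fx; apply/nx/subset_closure.
Qed.

Lemma partial_off f K i x : closed K -> (forall y, ~ K y -> f y = 0) ->
  ~ K x -> partial i f x = 0.
Proof.
move=> cK f0 nKx; rewrite -[RHS](partial_cst (0 : R) i x); apply: near_eq_derive.
have : nbhs x (~` K) by apply: open_nbhs_nbhs; split => //; exact: closed_openC.
by apply: filterS => y /f0.
Qed.

Lemma test_fun_partial O f i : test_fun O f -> test_fun O (partial i f).
Proof.
move=> tf; have [K [cK KO f0]] := test_fun_support tf.
apply: (test_fun_intro _ cK KO); first by apply: smooth_partial; case: tf.
by move=> x; apply: partial_off => //; exact: closed_compact_rV.
Qed.

Lemma test_funM O f g : test_fun O f -> smooth g -> test_fun O (fun x => f x * g x).
Proof.
move=> tf sg; have [K [cK KO f0]] := test_fun_support tf.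
apply: (test_fun_intro _ cK KO); first by apply: smoothM => //; case: tf.
by move=> x /f0 ->; rewrite mul0r.
Qed.

Lemma test_funZ O (c : R) f : test_fun O f -> test_fun O (fun x => c * f x).
Proof.
move=> tf; under eq_fun do rewrite mulrC.
exact: (test_funM tf (smooth_cst c)).
Qed.

Lemma test_funD O f g : test_fun O f -> test_fun O g ->
  test_fun O (fun x => f x + g x).
Proof.
move=> tf tg; have [K [cK KO f0]] := test_fun_support tf.
have [L [cL LO g0]] := test_fun_support tg.
apply: (@test_fun_intro _ (K `|` L)).
- by apply: smoothD; [case: tf|case: tg].
- exact: compactU.
- by rewrite subUset.
- by move=> x; rewrite /setU /= => /not_orP[/f0 -> /g0 ->]; rewrite addr0.
Qed.

Lemma test_fun0 O : test_fun O (fun=> 0).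
Proof.
by apply: (@test_fun_intro _ set0) => //; [exact: smooth_cst|exact: compact0].
Qed.

Lemma test_funS O O' f : O `<=` O' -> test_fun O f -> test_fun O' f.
Proof. by move=> OO' [sf cf fO]; split => //; exact: subset_trans OO'. Qed.

Lemma test_fun_bounded O f : test_fun O f -> exists2 M, 0 <= M & forall x, `|f x| <= M.
Proof.
move=> tf; have [K [cK _ f0]] := test_fun_support tf.
have [K0|/set0P K0] := eqVneq K set0.
  by exists 0 => // x; rewrite f0 ?normr0// K0.
have [c _ cM] : exists2 c, c \in K & forall t, t \in K -> `|f t| <= `|f c|.
  apply: (@EVT_max_rV _ _ (fun x => `|f x|) K K0 cK).
  apply: continuous_subspaceT => x; apply: continuous_comp.
    by apply: smooth_continuous; case: tf.
  exact: norm_continuous.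
exists `|f c| => // x; have [Kx|/f0 ->] := pselect (K x); first by apply: cM; rewrite inE.
by rewrite normr0.
Qed.

Lemma bounded_ball0 (A : set 'rV[R]_n) : bounded_set A ->
  exists2 B : R, 0 < B & A `<=` ball 0 B.
Proof.
move=> [M [_ /(_ (`|M| + 1)) AM]]; exists (`|M| + 1 + 1); first by rewrite addr_gt0// ltr_wpDl.
move=> x Ax; rewrite ballE /= sub0r normrN (le_lt_trans (AM _ _ Ax)) ?ltrDl//.
by rewrite (le_lt_trans (ler_norm _))// ltrDl.
Qed.

Lemma test_fun_bounded_support O f : test_fun O f ->
  exists2 B : R, 0 < B & forall x, ~ ball 0 B x -> f x = 0.
Proof.
move=> tf; have [K [cK _ f0]] := test_fun_support tf.
have [B B0 KB] := bounded_ball0 (compact_bounded cK).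
by exists B => // x nx; apply: f0 => /KB.
Qed.

Lemma compact_closed_ball_rV c (r : R) : compact [set x | `|c - x| <= r].
Proof.
apply: bounded_closed_compact.
  exists (`|c| + r); split; first exact: num_real.
  move=> M rM x /= cx; rewrite (le_trans _ (ltW rM))//.
  rewrite -[x](subKr c) (le_trans (ler_normB _ _))// lerD2l//.
rewrite (_ : mkset _ = (fun x => `|c - x|) @^-1` [set s | s <= r]) //.
apply: preimage_closed; last exact: closed_le.
move=> x _; apply: continuous_comp; last exact: norm_continuous.
by apply: continuousB; [exact: cst_continuous|].
Qed.

Lemma test_fun_bump O c (r : R) : 0 < r -> [set x | `|c - x| <= r] `<=` O ->
  test_fun O (bump c r).
Proof.
move=> r0 cO; apply: (@test_fun_intro _ [set x | `|c - x| <= r]) => //.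
- exact: smooth_bump.
- exact: compact_closed_ball_rV.
- move=> x /= nx; apply: bump_eq0 => //; rewrite ballE /= => /ltW; exact: nx.
Qed.

Lemma measurable_smooth (D : set 'rV[R]_n) f : measurable D -> smooth f -> measurable_fun D f.
Proof.
move=> mD sf; apply: (measurable_funS measurableT) => //.
apply: measurable_fun_continuous_rV; first exact: openT.
by move=> x _; exact: smooth_continuous.
Qed.

End test_functions.

(** * Square-integrable functions *)

Section L2_theory.
Context {R : realType} {n : nat}.
Implicit Types (f g : 'rV[R]_n -> R) (O : set 'rV[R]_n).

Definition sqn O f : R := \int[leb R n]_(x in O) (f x ^+ 2).

Section fixed_domain.
Variable O : set 'rV[R]_n.
Hypothesis mO : measurable O.

Let mu := leb R n.
Local Notation intg f := (mu.-integrable O (fun x => (f x)%:E)).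

Lemma intgD f g : intg f -> intg g -> intg (fun x => f x + g x).
Proof. by move=> fi gi; exact: integrableD fi gi. Qed.

Lemma intgB f g : intg f -> intg g -> intg (fun x => f x - g x).
Proof. by move=> fi gi; exact: integrableB fi gi. Qed.

Lemma intgZ (c : R) f : intg f -> intg (fun x => c * f x).
Proof. by move=> fi; exact: integrableZl fi. Qed.

Lemma intg0 : intg (fun=> 0).
Proof. exact: integrable0. Qed.

Lemma intg_sum (I : Type) (s : seq I) (F : I -> 'rV[R]_n -> R) :
  (forall i, intg (F i)) -> intg (fun x => \sum_(i <- s) F i x).
Proof.
move=> LF; elim: s => [|i s IH]; first by under eq_fun do rewrite big_nil; exact: intg0.
by under eq_fun do rewrite big_cons; exact: intgD.
Qed.

Lemma sqn_ge0 f : 0 <= sqn O f.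
Proof. by apply: Rintegral_ge0 => x _; exact: sqr_ge0. Qed.

Lemma L2_ae_le f g : measurable_fun O f -> L2 O g ->
  {ae leb R n, forall x, O x -> `|f x| <= `|g x|} -> L2 O f.
Proof.
move=> mf [mg ig] fg; split => //.
have mf2 : measurable_fun O (fun x => (f x ^+ 2)%:E).
  by apply/measurable_EFinP; exact: measurable_funX.
apply/integrableP; split => //.
have /integrableP[mg2] := ig; apply: le_lt_trans.
apply: ae_ge0_le_integral => //.
- exact: measurableT_comp.
- exact: measurableT_comp.
- apply: filterS fg => x + Ox => /(_ Ox) fgx.
  rewrite /= !ger0_norm ?sqr_ge0// lee_fin -[X in X <= _]real_normK ?num_real//.
  by rewrite -[X in _ <= X]real_normK ?num_real// lerXn2r// nnegrE.
Qed.

Lemma L2_le f g : measurable_fun O f -> L2 O g ->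
  (forall x, O x -> `|f x| <= `|g x|) -> L2 O f.
Proof. by move=> mf Lg fg; apply: (L2_ae_le mf Lg); exact: aeW. Qed.

Lemma L2_mul_integrable f g : L2 O f -> L2 O g ->
  (leb R n).-integrable O (fun x => (f x * g x)%:E).
Proof.
move=> [mf f2] [mg g2].
apply: (@le_integrable _ _ _ _ _ mO _ (fun x => (f x ^+ 2)%:E + (g x ^+ 2)%:E)%E) => //.
- by apply/measurable_EFinP; exact: measurable_funM.
- move=> x _; rewrite -EFinD lee_fin [leRHS]ger0_norm ?addr_ge0 ?sqr_ge0// normrM.
  rewrite -[f x ^+ 2]real_normK ?num_real// -[g x ^+ 2]real_normK ?num_real//.
  have := sqr_ge0 (`|f x| - `|g x|); have := mulr_ge0 (normr_ge0 (f x)) (normr_ge0 (g x)).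
  by nra.
- exact: intgD.
Qed.

Lemma L2D f g : L2 O f -> L2 O g -> L2 O (fun x => f x + g x).
Proof.
move=> Lf Lg; have [mf f2] := Lf; have [mg g2] := Lg; split.
  exact: measurable_funD.
under eq_fun do rewrite sqrrD -mulr_natl.
by apply: intgD => //; apply: intgD => //; apply: intgZ; exact: L2_mul_integrable.
Qed.

Lemma L2Z (c : R) f : L2 O f -> L2 O (fun x => c * f x).
Proof.
move=> [mf f2]; split; first exact: measurable_funM.
by under eq_fun do rewrite exprMn; exact: intgZ.
Qed.

Lemma L2N f : L2 O f -> L2 O (fun x => - f x).
Proof. by move=> Lf; under eq_fun do rewrite -mulN1r; exact: L2Z. Qed.

Lemma L2B f g : L2 O f -> L2 O g -> L2 O (fun x => f x - g x).
Proof. by move=> Lf Lg; apply: L2D => //; exact: L2N. Qed.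

Lemma L20 : L2 O (fun=> 0).
Proof.
by split => //; under eq_fun do rewrite expr0n; exact: integrable0.
Qed.

Lemma L2_sum (I : Type) (s : seq I) (F : I -> 'rV[R]_n -> R) :
  (forall i, L2 O (F i)) -> L2 O (fun x => \sum_(i <- s) F i x).
Proof.
move=> LF; elim: s => [|i s IH]; first by under eq_fun do rewrite big_nil; exact: L20.
by under eq_fun do rewrite big_cons; exact: L2D.
Qed.

Lemma L2_ae_bounded_mul (b : 'rV[R]_n -> R) (M : R) f : measurable_fun O b ->
  {ae leb R n, forall x, O x -> `|b x| <= M} -> L2 O f -> L2 O (fun x => b x * f x).
Proof.
move=> mb bM Lf; have [mf _] := Lf.
apply: (L2_ae_le _ (L2Z M Lf)); first exact: measurable_funM.
apply: filterS bM => x + Ox => /(_ Ox) bM; rewrite !normrM ler_wpM2r//.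
exact: le_trans (ler_norm _).
Qed.

Lemma L2_bounded_mul (b : 'rV[R]_n -> R) (M : R) f : measurable_fun O b ->
  (forall x, O x -> `|b x| <= M) -> L2 O f -> L2 O (fun x => b x * f x).
Proof. by move=> mb bM Lf; apply: (L2_ae_bounded_mul (M := M) mb _ Lf); exact: aeW. Qed.

Lemma sqnZ (c : R) f : L2 O f -> sqn O (fun x => c * f x) = c ^+ 2 * sqn O f.
Proof.
move=> [mf f2]; rewrite /sqn; under eq_Rintegral do rewrite exprMn.
by rewrite RintegralZl.
Qed.

Lemma le_sqn f g : L2 O f -> L2 O g -> (forall x, O x -> `|f x| <= `|g x|) ->
  sqn O f <= sqn O g.
Proof.
move=> [mf f2] [mg g2] fg; apply: le_Rintegral => // x Ox.
rewrite -[X in X <= _]real_normK ?num_real// -[X in _ <= X]real_normK ?num_real//.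
by rewrite lerXn2r ?nnegrE//; exact: fg.
Qed.

Lemma sqnD_le f g : L2 O f -> L2 O g ->
  sqn O (fun x => f x + g x) <= 2 * sqn O f + 2 * sqn O g.
Proof.
move=> Lf Lg; have [mf f2] := Lf; have [mg g2] := Lg.
have [_ fg2] := L2D Lf Lg.
rewrite /sqn -!RintegralZl// -RintegralD//; try exact: intgZ.
apply: le_Rintegral => //; first by apply: intgD => //; exact: intgZ.
by move=> x _; have := sqr_ge0 (f x - g x); nra.
Qed.

(** The inequality 2ab <= d a^2 + b^2 / d, integrated: together with the
    freedom in d it replaces Cauchy--Schwarz in all limiting arguments. *)
Lemma normr_integral_mul_le f g (d : R) : 0 < d -> L2 O f -> L2 O g ->
  `|\int[leb R n]_(x in O) (f x * g x)| <= d * sqn O f + d^-1 * sqn O g.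
Proof.
move=> d0 Lf Lg; have [mf f2] := Lf; have [mg g2] := Lg.
have ifg := L2_mul_integrable Lf Lg.
apply: le_trans (le_normr_Rintegral _ ifg) _ => //.
rewrite /sqn -!RintegralZl// -RintegralD//; try exact: intgZ.
apply: le_Rintegral => //.
- rewrite (_ : _ \o _ = (fun x => `|(f x * g x)%:E|)%E)//.
  exact: integrable_abse.
- by apply: intgD => //; exact: intgZ.
- move=> x _; rewrite -[X in _ <= _ + X]mulrC -[_ * _^-1]/(_ / _).
  have := sqr_ge0 (d * `|f x| - `|g x|).
  rewrite normrM -[f x ^+ 2]real_normK ?num_real// -[g x ^+ 2]real_normK ?num_real//.
  move=> h; rewrite -(ler_pM2l d0) mulrDr mulrCA [d * (_ / d)]mulrCA divff ?gt_eqF// mulr1.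
  have := normr_ge0 (f x); have := normr_ge0 (g x); move: h d0.
  set a := `|f x|; set b := `|g x|; nra.
Qed.

Lemma sqn_eq0 f : L2 O f -> sqn O f = 0 ->
  {ae leb R n, forall x, O x -> f x = 0}.
Proof.
move=> [mf f2] s0.
have : (\int[leb R n]_(x in O) (f x ^+ 2)%:E = 0)%E.
  rewrite -(fineK (integrable_fin_num mO f2)).
  by move: s0; rewrite /sqn /Rintegral => ->.
have mf2 : measurable_fun O (fun x => (f x ^+ 2)%:E).
  by apply/measurable_EFinP; exact: measurable_funX.
move=> h; have /(ae_eq_integral_abs (leb R n) mO mf2) : (\int[leb R n]_(x in O) `|(f x ^+ 2)%:E| = 0)%E.
  by rewrite -[RHS]h; apply: eq_integral => x _; rewrite gee0_abs ?lee_fin ?sqr_ge0.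
apply: filterS => x h' Ox; have [/eqP] := h' Ox.
by rewrite sqrf_eq0 => /eqP.
Qed.

(** Dominated convergence in the mean square. *)
Lemma sqn_cvg0 (F : nat -> 'rV[R]_n -> R) f (g : 'rV[R]_n -> R) :
  (forall m, measurable_fun O (F m)) -> measurable_fun O f -> L2 O g ->
  (forall x, O x -> F m x @[m --> \oo] --> f x) ->
  (forall m x, O x -> `|F m x - f x| <= g x) ->
  sqn O (fun x => F m x - f x) @[m --> \oo] --> (0 : R).
Proof.
move=> mF mf [mg g2] Ff Fg.
have [] := @dominated_convergence _ _ _ mu O mO
  (fun m x => ((F m x - f x) ^+ 2)%:E) (cst 0%E) (fun x => (g x ^+ 2)%:E).
- by move=> m; apply/measurable_EFinP/measurable_funX; exact: measurable_funB.
- by [].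
- apply: aeW => x Ox; apply: cvg_EFin; first by near=> m.
  have : F m x - f x @[m --> \oo] --> (0 : R) by apply/subr_cvg0/Ff.
  by move=> h; rewrite -[X in _ --> X](mulr0 (0 : R)); exact: (cvgM h h).
- exact: g2.
- apply: aeW => x m Ox; rewrite gee0_abs ?lee_fin ?sqr_ge0//.
  rewrite -real_normK ?num_real// lerXn2r ?nnegrE//; last exact: Fg.
  exact: le_trans (normr_ge0 _) (Fg m x Ox).
- move=> _ _; rewrite integral0 => h.
  exact: (@fine_cvg R _ _ _ _ 0 h).
Unshelve. all: by end_near. Qed.

Hypothesis fO : (leb R n O < +oo)%E.

Lemma L2_ae_bounded (M : R) f : measurable_fun O f ->
  {ae leb R n, forall x, O x -> `|f x| <= M} -> L2 O f.
Proof.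
move=> mf fM; apply: (@L2_ae_le _ (cst M)) => //; last first.
  by apply: filterS fM => x h Ox; apply: le_trans (h Ox) (ler_norm _).
split=> //=; apply/integrableP; split; first exact: measurable_cst.
by rewrite integral_cst// lte_mul_pinfty.
Qed.

Lemma L2_bounded (M : R) f : measurable_fun O f ->
  (forall x, O x -> `|f x| <= M) -> L2 O f.
Proof. by move=> mf fM; apply: (L2_ae_bounded (M := M)) => //; exact: aeW. Qed.

Lemma L2_integrable f : L2 O f -> intg f.
Proof.
move=> Lf; have L1 : L2 O (fun=> 1) by apply: (@L2_bounded 1) => // x _; rewrite normr1.
by have := L2_mul_integrable Lf L1; under eq_fun do rewrite mulr1.
Qed.

End fixed_domain.
End L2_theory.

(** * Integration by parts *)

Section integration_by_parts.
Context {R : realType} {n : nat}.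
Implicit Types (f g psi phi : 'rV[R]_n -> R) (O K : set 'rV[R]_n).
Let mu := leb R n.
Let cube (r : R) : set 'rV[R]_n := ball 0 r.

Lemma integral_leb_shift (f : 'rV[R]_n -> \bar R) (a : 'rV[R]_n) :
  measurable_fun setT f ->
  (\int[leb R n]_x f (x + a)%R = \int[leb R n]_x f x)%E.
Proof.
move=> mf; rewrite integralE [RHS]integralE; congr (_ - _)%E.
  rewrite -(ge0_integral_leb_shift a (measurable_funepos mf)) ?funepos_ge0//.
  by apply: eq_integral => x _; rewrite !funeposE.
rewrite -(ge0_integral_leb_shift a (measurable_funeneg mf)) ?funeneg_ge0//.
by apply: eq_integral => x _; rewrite !funenegE.
Qed.

Lemma integrable_bounded_support f (M B : R) : 0 < B -> measurable_fun setT f ->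
  (forall x, `|f x| <= M) -> (forall x, ~ cube B x -> f x = 0) ->
  mu.-integrable setT (fun x => (f x)%:E).
Proof.
move=> B0 mf fM fB.
have mB : measurable (cube B) by exact: measurable_ball_rV.
have fiB : (mu (cube B) < +oo)%E.
  by rewrite /mu /cube leb_ball// ltry.
have : mu.-integrable (cube B) (fun x => (f x)%:E).
  apply: (L2_integrable mB fiB); apply: (L2_bounded mB fiB (M := M)) => //.
  exact: measurable_funTS.
rewrite integrable_mkcond//; apply: eq_integrable => // x _.
rewrite /restrict; case: ifPn => // /negP nx; rewrite fB// => Bx.
by apply: nx; rewrite inE.
Qed.

(** The integral of a difference quotient vanishes by translation invariance;
    the mean value theorem dominates these quotients. *)
Lemma integral_partial_eq0 psi i (M B : R) : 0 < B ->
  (forall x, differentiable psi x) -> (forall x, `|psi x| <= M) ->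
  (forall x, `|partial i psi x| <= M) -> (forall x, ~ cube B x -> psi x = 0) ->
  mu.-integrable setT (fun x => (partial i psi x)%:E) /\
  (\int[leb R n]_x (partial i psi x)%:E = 0)%E.
Proof.
move=> B0 dpsi pM dM pB.
pose t (m : nat) : R := m.+1%:R^-1.
have t0 m : 0 < t m by rewrite invr_gt0.
pose e : 'rV[R]_n := delta_mx ord0 i.
have mpsi : measurable_fun setT psi.
  apply: measurable_fun_continuous_rV; first exact: openT.
  by move=> x _; exact: differentiable_continuous.
pose sh (m : nat) (x : 'rV[R]_n) : R := psi (x + t m *: e).
pose F (m : nat) (x : 'rV[R]_n) : R := (t m)^-1 * (sh m x - psi x).
have ipsi : mu.-integrable setT (fun x => (psi x)%:E).
  exact: integrable_bounded_support B0 mpsi pM pB.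
have mshift m : measurable_fun setT (sh m).
  exact: (measurableT_comp mpsi (measurable_shift_rV _)).
have ne1 : `|e| <= 1.
  apply/normr_rV_le => // j; rewrite mxE eqxx /=.
  by case: (_ == _); rewrite ?normr1 ?normr0.
have bB : cube (B + 1) = [set x | `|x| < B + 1].
  by rewrite /cube ballE; apply/seteqP; split => x /=; rewrite sub0r normrN.
have farB m x : ~ cube (B + 1) x -> sh m x = 0.
  rewrite bB /= => nx; apply: pB; rewrite /cube ballE /= sub0r normrN => h; apply: nx.
  rewrite -[x](addrK (t m *: e)) (le_lt_trans (ler_normB _ _))// ltr_leD//.
  rewrite normrZ gtr0_norm// -[leRHS]mul1r ler_pM//; first exact: ltW.
  by rewrite invf_le1 ?ler1n.
have farB' x : ~ cube (B + 1) x -> psi x = 0.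
  rewrite bB /= => nx; apply: pB; rewrite /cube ballE /= sub0r normrN => h; apply: nx.
  by rewrite (lt_trans h)// ltrDl.
have ishift m : mu.-integrable setT (fun x => (sh m x)%:E).
  exact: (integrable_bounded_support (M := M) (addr_gt0 B0 ltr01) (mshift m) (fun x => pM _) (farB m)).
have F0 m : (\int[mu]_x (F m x)%:E = 0)%E.
  rewrite /F; under eq_integral do rewrite EFinM EFinB.
  rewrite integralZl//; last exact: integrableB.
  rewrite integralB//.
  rewrite (integral_leb_shift _ (f := fun x => (psi x)%:E)); last exact/measurable_EFinP.
  by rewrite subee ?mule0// integrable_fin_num.
have Fcvg x : F m x @[m --> \oo] --> partial i psi x.
  have hl : h^-1 *: ((psi \o shift x) (h *: e) - psi x) @[h --> 0^'] -->
    partial i psi x by exact: (diff_derivable (dpsi x)).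
  have tcvg : (forall m, t m != 0) /\ t m @[m --> \oo] --> (0 : R).
    by split=> [m|]; [rewrite gt_eqF|exact: cvg_harmonic].
  move/(cvgr_dnbhsP _ _ _).1/(_ t tcvg) : hl.
  by rewrite /= /GRing.scale /=; under eq_fun do rewrite [_ *: e + x]addrC.
have MB m x : `|F m x| <= M * \1_(cube (B + 1)) x.
  have M0 : 0 <= M by apply: le_trans (pM 0).
  have [xB|xB] := pselect (cube (B + 1) x); last first.
    by rewrite /F farB// farB'// subrr mulr0 normr0 mulr_ge0.
  rewrite indicE mem_set// mulr1 /F normrM (gtr0_norm (_ : 0 < (t m)^-1)) ?invr_gt0//.
  rewrite ler_pdivrMl// /sh.
  have [c _ ->] := mean_value x (t m *: e) dpsi.
  rewrite (bigD1 i)//= big1 ?addr0.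
    by rewrite !mxE !eqxx mulr1 normrM gtr0_norm// ler_wpM2l// ltW.
  by move=> j ji; rewrite !mxE eqxx (negPf ji) mulr0 mul0r.
have mF m : measurable_fun setT (F m).
  by apply: measurable_funM => //; exact: measurable_funB.
have mdpsi : measurable_fun setT (partial i psi).
  exact: (measurable_fun_cvg mF (fun x _ => Fcvg x)).
have mB1 : measurable (cube (B + 1)) by exact: measurable_ball_rV.
have [] := @dominated_convergence _ _ _ mu setT measurableT
  (fun m x => (F m x)%:E) (fun x => (partial i psi x)%:E)
  (fun x => (M * \1_(cube (B + 1)) x)%:E).
- by move=> m; exact/measurable_EFinP.
- exact/measurable_EFinP.
- by apply: aeW => x _; apply: cvg_EFin; [near=> m|exact: Fcvg].
- apply: (@integrable_bounded_support _ M (B + 1)).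
  + exact: addr_gt0.
  + by apply: measurable_funM => //; exact: measurable_indic.
  + move=> x; rewrite normrM indicE; case: (_ \in _); rewrite ?normr1 ?normr0 ?mulr1 ?mulr0//.
      by rewrite ger0_norm// (le_trans _ (pM 0)).
    by rewrite (le_trans _ (pM 0)).
  + by move=> x nx; rewrite indicE memNset// mulr0.
- by apply: aeW => x m _; rewrite lee_fin; exact: MB.
move=> h1 _ h2; split => //; apply/esym.
apply: (cvg_unique _ _ h2) => //.
rewrite (_ : [sequence _]_m = cst 0%E); first exact: cvg_cst.
by apply/funext => m /=; rewrite F0.
Unshelve. all: by end_near. Qed.

(** Near x the function vanishes, and far from x boundedness alone yields a
    quadratic bound.  This handles products with a cut-off at the points where
    the other factor is not known to be regular. *)
Lemma differentiable_locally0 f (K : set 'rV[R]_n) (M : R) x : closed K ->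
  (forall y, `|f y| <= M) -> (forall y, ~ K y -> f y = 0) -> ~ K x ->
  differentiable f x.
Proof.
move=> cK fM f0 nKx.
have /nbhs_ballP[r /= r0 rK] : nbhs x (~` K).
  by apply: open_nbhs_nbhs; split => //; exact: closed_openC.
have [] // := @differentiable_of_remainder R n f x (fun=> 0) (M / r ^+ 2).
move=> h; rewrite (f0 _ nKx) subr0 big1 ?subr0; last by move=> i _; rewrite mulr0.
have M0 : 0 <= M by apply: le_trans (fM 0).
have [hr|hr] := ltP `|h| r.
  rewrite f0; last by apply: rK; rewrite ballE /= opprD addNKr normrN.
  by rewrite normr0 mulr_ge0 ?divr_ge0 ?exprn_ge0// (ltW r0).
rewrite (le_trans (fM _))// mulrAC ler_pdivlMr ?exprn_gt0//.
by rewrite ler_wpM2l// lerXn2r ?nnegrE// (ltW r0).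
Qed.

Section classical_gradient.
Variable O : set 'rV[R]_n.
Hypotheses (oO : open O) (fO : (leb R n O < +oo)%E).
Let mO : measurable O := open_measurable_rV oO.

Lemma test_fun_L2 phi : test_fun O phi -> L2 O phi.
Proof.
move=> tp; have [M M0 pM] := test_fun_bounded tp.
by apply: (L2_bounded mO fO _ (fun x _ => pM x)); apply: measurable_smooth => //; case: tp.
Qed.

(** The product f phi is differentiable on the whole space, as it vanishes off
    the support of phi; so the integral of its derivative is zero. *)
Lemma integral_partial_mul_eq0 f phi i (M : R) : test_fun O phi ->
  (forall x, O x -> differentiable f x) -> (forall x, O x -> `|f x| <= M) ->
  (forall x, O x -> `|partial i f x| <= M) ->
  \int[leb R n]_(x in O) (f x * partial i phi x + phi x * partial i f x) = 0.
Proof.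
move=> tp df fM dfM; have [K [cK KO p0]] := test_fun_support tp.
have clK := closed_compact_rV cK.
have tdp := test_fun_partial i tp.
have [P P0 pP] := test_fun_bounded tp; have [Q Q0 pQ] := test_fun_bounded tdp.
have [B B0 pB] := test_fun_bounded_support tp.
have offO x : ~ O x -> ~ K x by move=> nOx /KO.
pose psi x := f x * phi x.
have psi0 x : ~ K x -> psi x = 0 by move=> /p0 px; rewrite /psi px mulr0.
pose M' := Num.max M 0.
have M'0 : 0 <= M' by rewrite le_max lexx orbT.
have fM' x : O x -> `|f x| <= M' by move=> /fM /le_trans; apply; rewrite le_max lexx.
have dfM' x : O x -> `|partial i f x| <= M'.
  by move=> /dfM /le_trans; apply; rewrite le_max lexx.
have psiM x : `|psi x| <= M' * P.
  have [Ox|nOx] := pselect (O x); last by rewrite psi0 ?normr0 ?mulr_ge0//; exact: offO.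
  by rewrite normrM ler_pM// fM'.
have dpsi x : differentiable psi x.
  have [Ox|nOx] := pselect (O x).
    by apply: differentiableM; [exact: df|exact: smooth_differentiable (test_fun_smooth tp) _].
  by apply: (differentiable_locally0 clK psiM psi0); exact: offO.
have dpsiE x : partial i psi x = (fun x => f x * partial i phi x + phi x * partial i f x) \_ O x.
  rewrite /restrict; case: ifPn => [/set_mem Ox|/negP nOx].
    by rewrite partialM//; [exact: df|exact: smooth_differentiable (test_fun_smooth tp) _].
  by apply: (partial_off i clK psi0); apply: offO => Ox; apply: nOx; rewrite inE.
have psiN x : `|psi x| <= M' * P + (M' * Q + P * M').
  by rewrite (le_trans (psiM x))// lerDl !addr_ge0 ?mulr_ge0.
have dpsiN x : `|partial i psi x| <= M' * P + (M' * Q + P * M').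
  rewrite dpsiE /restrict; case: ifPn => [/set_mem Ox|_]; last first.
    by rewrite normr0 !addr_ge0 ?mulr_ge0.
  rewrite -[leLHS]add0r lerD ?mulr_ge0// (le_trans (ler_normD _ _))//.
  by rewrite !normrM lerD// ler_pM// ?fM' ?dfM'.
have psiB x : ~ ball 0 B x -> psi x = 0 by move=> /pB; rewrite /psi => ->; rewrite mulr0.
have [_ ipsi] := integral_partial_eq0 B0 dpsi psiN dpsiN psiB.
rewrite /Rintegral integral_mkcond.
transitivity (fine (\int[leb R n]_x (partial i psi x)%:E)%E).
  congr fine; apply: eq_integral => x _; rewrite dpsiE !patchE.
  by case: ifPn.
by rewrite ipsi.
Qed.

Lemma weak_grad_classical f (M : R) :
  (forall x, O x -> differentiable f x) -> (forall x, O x -> `|f x| <= M) ->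
  (forall i x, O x -> `|partial i f x| <= M) ->
  (forall i, measurable_fun O (partial i f)) ->
  weak_grad O f (grad f).
Proof.
move=> df fM dfM mdf phi tp i.
have := integral_partial_mul_eq0 tp df fM (dfM i).
have mf : measurable_fun O f.
  by apply: measurable_fun_continuous_rV => // x Ox; exact/differentiable_continuous/df.
have Lf : L2 O f by exact: (L2_bounded mO fO mf fM).
have Ldf : L2 O (partial i f) by exact: (L2_bounded mO fO (mdf i) (dfM i)).
rewrite RintegralD//; first last.
- exact: (L2_mul_integrable mO (test_fun_L2 tp) Ldf).
- exact: (L2_mul_integrable mO Lf (test_fun_L2 (test_fun_partial i tp))).
move/eqP; rewrite addr_eq0 => /eqP ->; congr (- _).
by apply: eq_Rintegral => x _; rewrite mxE mulrC.
Qed.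

End classical_gradient.
End integration_by_parts.

(** * Density of test functions *)

Section density.
Context {R : realType} {n : nat}.
Variable O : set 'rV[R]_n.
Hypotheses (oO : open O) (fO : (leb R n O < +oo)%E).
Let mO : measurable O := open_measurable_rV oO.

Definition approximable (f : 'rV[R]_n -> R) := forall e : R, 0 < e ->
  exists2 phi, test_fun O phi & sqn O (fun x => f x - phi x) < e.

Lemma approximable_closed f : L2 O f ->
  (forall e : R, 0 < e -> exists g, [/\ L2 O g, approximable g &
    sqn O (fun x => f x - g x) < e]) -> approximable f.
Proof.
move=> Lf fg e e0; have e40 : 0 < e / 4 by rewrite divr_gt0.
have [g [Lg ag sfg]] := fg _ e40; have [phi tphi sgphi] := ag _ e40.
exists phi => //; have Lphi := test_fun_L2 oO fO tphi.
have -> : (fun x => f x - phi x) = fun x => (f x - g x) + (g x - phi x).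
  by apply/funext => x; rewrite addrA subrK.
apply: le_lt_trans (sqnD_le mO (L2B mO Lf Lg) (L2B mO Lg Lphi)) _.
lra.
Qed.

Lemma approximableD f g : L2 O f -> L2 O g -> approximable f -> approximable g ->
  approximable (fun x => f x + g x).
Proof.
move=> Lf Lg af ag e e0; have e40 : 0 < e / 4 by rewrite divr_gt0.
have [phi tphi sf] := af _ e40; have [psi tpsi sg] := ag _ e40.
exists (fun x => phi x + psi x); first exact: test_funD.
have -> : (fun x => f x + g x - (phi x + psi x)) = fun x => (f x - phi x) + (g x - psi x).
  by apply/funext => x; ring.
apply: le_lt_trans (sqnD_le mO (L2B mO Lf (test_fun_L2 oO fO tphi))
  (L2B mO Lg (test_fun_L2 oO fO tpsi))) _.
lra.
Qed.

Lemma approximableZ (c : R) f : L2 O f -> approximable f ->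
  approximable (fun x => c * f x).
Proof.
move=> Lf af e e0; have c0 : 0 < c ^+ 2 + 1 by rewrite ltr_wpDl// sqr_ge0.
have [phi tphi sf] := af _ (divr_gt0 e0 c0).
exists (fun x => c * phi x); first exact: test_funZ.
under eq_fun do rewrite -mulrBr.
rewrite sqnZ//; last by apply: L2B => //; exact: test_fun_L2.
move: sf; rewrite ltr_pdivlMr// => sf; apply: le_lt_trans sf.
by rewrite mulrC ler_wpM2l ?sqn_ge0// lerDl.
Qed.

(** Dominated pointwise limits of approximable functions are approximable; this
    carries the density from indicators of open sets to those of measurable
    sets, and on to nonnegative functions. *)
Lemma approximable_cvg (F : nat -> 'rV[R]_n -> R) f (g : 'rV[R]_n -> R) :
  (forall m, L2 O (F m)) -> (forall m, approximable (F m)) -> L2 O f -> L2 O g ->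
  (forall x, O x -> F m x @[m --> \oo] --> f x) ->
  (forall m x, O x -> `|F m x - f x| <= g x) ->
  approximable f.
Proof.
move=> LF aF Lf Lg Ff Fg; apply: approximable_closed => // e e0.
have := sqn_cvg0 mO (fun m => (LF m).1) Lf.1 Lg Ff Fg.
move/cvgr0Pnorm_lt => /(_ _ e0)[m _ /(_ m (leqnn m))] sm.
exists (F m); split => //; apply: le_lt_trans sm.
rewrite /sqn; under eq_Rintegral do rewrite -opprB sqrrN.
exact: ler_norm.
Qed.

Lemma approximable_test phi : test_fun O phi -> approximable phi.
Proof.
move=> tphi e e0; exists phi => //; rewrite /sqn /Rintegral integral0_eq// => x _.
by rewrite subrr expr0n.
Qed.

Lemma L2_indic A : measurable A -> L2 O (\1_A : _ -> R).
Proof.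
move=> mA; apply: (@L2_bounded _ _ _ mO fO 1) => [|x _].
  exact: measurable_indic.
by rewrite indicE; case: (_ \in _); rewrite ?normr1 ?normr0.
Qed.

(** Functions equal to 1 off a compact subset of O: finite products of factors
    1 - b, with b a test function, stay in this class. *)
Let cotest (G : 'rV[R]_n -> R) := smooth G /\ test_fun O (fun x => 1 - G x).

Let cotestM G H : cotest G -> cotest H -> cotest (fun x => G x * H x).
Proof.
move=> [sG tG] [sH tH]; split; first exact: smoothM.
rewrite (_ : (fun _ => _) = fun x => (1 - G x) + (1 - H x) * G x).
  by apply: test_funD => //; exact: test_funM.
by apply/funext => x; ring.
Qed.

Let cotest1 : cotest (fun=> 1).
Proof.
by split; [exact: smooth_cst|under eq_fun do rewrite subrr; exact: test_fun0].
Qed.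

Let cotestX G m : cotest G -> cotest (fun x => G x ^+ m).
Proof.
move=> cG; elim: m => [|m IH]; first exact: cotest1.
by under eq_fun do rewrite exprS; exact: cotestM.
Qed.

Let cotest_prod (G : nat -> 'rV[R]_n -> R) m : (forall j, cotest (G j)) ->
  cotest (fun x => \prod_(j < m) G j x).
Proof.
move=> cG; elim: m => [|m IH].
  by under eq_fun do rewrite big_ord0; exact: cotest1.
by under eq_fun do rewrite big_ord_recr /=; exact: cotestM.
Qed.

(** With bumps b_j supported in countably many cubes that exhaust U, the
    functions 1 - (1 - b_0)^m ... (1 - b_(m-1))^m tend to the indicator of U. *)
Lemma approximable_indic_open (U : set 'rV[R]_n) : open U -> approximable (\1_U : _ -> R).
Proof.
move=> oU; pose V := U `&` O.
have oV : open V by exact: openI.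
pose I : countType := ('rV[rat]_n * nat)%type.
pose ctr (p : I) : 'rV[R]_n := map_mx ratr p.1.
pose rad (p : I) : R := p.2.+1%:R^-1.
pose inV (p : I) := `[< [set y | `|ctr p - y| <= rad p] `<=` V >].
pose b (j : nat) : 'rV[R]_n -> R :=
  if @choice.unpickle I j is Some p then
    if inV p then bump (ctr p) (rad p) else fun=> 0
  else fun=> 0.
have rad0 p : 0 < rad p by rewrite invr_gt0.
have tb j : test_fun V (b j).
  rewrite /b; case: choice.unpickle => [p|]; last exact: test_fun0.
  case: ifPn => [/asboolP pV|_]; last exact: test_fun0.
  exact: test_fun_bump.
have b01 j x : 0 <= 1 - b j x <= 1.
  rewrite subr_ge0 gerBl /b; case: choice.unpickle => [p|]; rewrite ?ler01 ?lexx//.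
  by case: ifPn => _; rewrite ?ler01 ?lexx// bump_le1 bump_ge0.
have bV j x : ~ V x -> b j x = 0.
  by have [K [_ KV K0]] := test_fun_support (tb j); move=> nV; apply: K0 => /KV.
have cb j : cotest (fun x => 1 - b j x).
  split; first by apply: smoothB; [exact: smooth_cst|exact: test_fun_smooth (tb j)].
  by under eq_fun do rewrite opprB subrKC; apply: test_funS (tb j) => x [].
pose G m x := \prod_(j < m) (1 - b j x) ^+ m.
have cG m : cotest (G m).
  apply: (@cotest_prod (fun j x => (1 - b j x) ^+ m)) => j; exact: cotestX.
have G01 m x : 0 <= G m x <= 1.
  rewrite prodr_ge0 ?prodr_ile1//= => j _; have /andP[h0 h1] := b01 j x.
    by rewrite exprn_ge0//= exprn_ile1.
  exact: exprn_ge0.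
have mU : measurable U by exact: open_measurable_rV.
have L1 : L2 O (fun=> 1) by apply: (@L2_bounded _ _ _ mO fO 1) => // x _; rewrite normr1.
have tF m : test_fun O (fun x => 1 - G m x) by case: (cG m).
apply: (@approximable_cvg (fun m x => 1 - G m x) _ (fun=> 1)) => //.
- by move=> m; exact: test_fun_L2.
- by move=> m; exact: approximable_test.
- exact: L2_indic.
- move=> x Ox; have [Ux|nUx] := pselect (U x); last first.
    have nVx : ~ V x by case.
    rewrite indicE memNset//=.
    rewrite (_ : (fun m => _) = cst 0); first exact: cvg_cst.
    apply/funext => m /=; rewrite /G big1 ?subrr// => j _.
    by rewrite bV// subr0 expr1n.
  rewrite indicE mem_set//=.
  have [p [px pV]] := rational_ball oV (conj Ux Ox).
  pose j := @choice.pickle I p; have bj : 0 < b j x.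
    by rewrite /b choice.pickleK /inV asboolT//; apply/bump_gt0.
  have bj1 : 1 - b j x < 1 by rewrite ltrBlDr ltrDl.
  have h : 1 - (1 - b j x) ^+ m @[m --> \oo] --> (1 : R).
    rewrite -[X in _ --> X](subr0 (1 : R)); apply: cvgB; first exact: cvg_cst.
    by apply: cvg_expr; rewrite ger0_norm//; case/andP: (b01 j x).
  apply: (squeeze_cvgr _ h (cvg_cst _)); near=> m.
  have jm : (j < m)%N by near: m; exact: nbhs_infty_gt.
  rewrite lerD2l lerN2 /G (bigD1 (Ordinal jm))//= gerBl.
  have /andP[h0 _] := b01 j x.
  rewrite mulr_ge0 ?exprn_ge0 ?prodr_ge0 ?andbT//; last first.
    by move=> k _; rewrite exprn_ge0//; case/andP: (b01 k x).
  rewrite ler_piMr ?exprn_ge0// prodr_ile1// => k _.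
  by have /andP[k0 k1] := b01 k x; rewrite exprn_ge0//= exprn_ile1.
- move=> m x Ox; have /andP[G0 G1] := G01 m x.
  by rewrite indicE; case: (_ \in _) => /=; rewrite ler_norml; lra.
Unshelve. all: by end_near. Qed.

(** The generators of the product sigma-algebra are preimages of open sets
    under coordinates; open sets being stable under intersection, this form
    suits Dynkin's theorem. *)
Lemma measurable_rV_open : @measurable _ 'rV[R]_n = <<s [set U : set 'rV[R]_n | open U] >>.
Proof.
apply/seteqP; split; last first.
  apply: smallest_sub; first exact: sigma_algebra_measurable.
  by move=> U; exact: open_measurable_rV.
pose T := g_sigma_algebraType [set U : set 'rV[R]_n | open U].
have mc (i : 'I_n) : @measurable_fun _ _ T R setT (fun x : 'rV[R]_n => x ord0 i).
  apply: (measurability _ (RGenOpens.measurableE R)) => _ [_ [a [b ->] <-]].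
  apply: sub_sigma_algebra; rewrite /= setTI.
  by apply: open_comp => [x _|]; [exact: coord_continuous|exact: interval_open].
have mid : @measurable_fun _ _ T 'rV[R]_n setT (fun x : 'rV[R]_n => x).
  exact: (@measurable_fun_rV R n _ T).
by move=> A mA; have := mid measurableT A mA; rewrite setTI.
Qed.

(** The measurable sets with approximable indicator are closed under complement
    and countable disjoint union, and contain the open sets: Dynkin's pi-lambda
    theorem applies. *)
Lemma approximable_indic A : measurable A -> approximable (\1_A : _ -> R).
Proof.
move=> mA; pose P A := measurable A -> approximable (\1_A : _ -> R).
suff : P A by apply.
rewrite measurable_rV_open in mA; move: A mA.
have L1 : L2 O (fun=> 1) by apply: (@L2_bounded _ _ _ mO fO 1) => // x _; rewrite normr1.
apply: (dynkin_induction measurable_rV_open).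
- by move=> A B oA oB; exact: openI.
- by move=> _; apply: approximable_indic_open; exact: openT.
- by move=> U oU _; exact: approximable_indic_open.
- move=> A mA PA _.
  have -> : \1_(~` A) = (fun x => 1 + (-1) * \1_A x) :> ('rV[R]_n -> R).
    by apply/funext => x; rewrite !indicE in_setC; case: (_ \in _) => /=; ring.
  apply: approximableD => //; first by apply: L2Z => //; exact: L2_indic.
  + have -> : (fun=> 1) = \1_[set: 'rV[R]_n] :> ('rV[R]_n -> R).
      by apply/funext => x; rewrite indicE in_setT.
    exact: approximable_indic_open openT.
  + by apply: approximableZ; [exact: L2_indic|exact: PA].
- move=> F mF tF PF _.
  pose S m x : R := \sum_(k < m) \1_(F k) x.
  have LS m : L2 O (S m) by apply: L2_sum => // k; exact: L2_indic.
  have aS m : approximable (S m).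
    elim: m => [|m IH].
      rewrite (_ : S 0%N = fun=> 0); first by apply: approximable_test; exact: test_fun0.
      by apply/funext => x; rewrite /S big_ord0.
    rewrite (_ : S m.+1 = fun x => S m x + \1_(F m) x); last first.
      by apply/funext => x; rewrite /S big_ord_recr.
    by apply: approximableD => //; [exact: L2_indic|exact: PF].
  have mUF : measurable (\bigcup_k F k) by exact: bigcupT_measurable.
  have S0 m x : ~ (\bigcup_k F k) x -> S m x = 0.
    move=> nx; rewrite /S big1// => k _; rewrite indicE memNset// => Fx.
    by apply: nx; exists k.
  have S1 m k x : F k x -> S m x = (k < m)%:R.
    move=> Fk; have off j : j != k -> \1_(F j) x = 0 :> R.
      move=> jk; rewrite indicE memNset// => Fj.
      by move/trivIsetP : tF => /(_ j k I I jk)/seteqP[/(_ x)] h _; apply: h.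
    have [km|km] := ltnP k m.
      rewrite /S (bigD1 (Ordinal km))//= indicE mem_set// big1 ?addr0// => j jk.
      exact: off.
    by rewrite /S big1// => j _; apply: off; rewrite ltn_eqF// (leq_trans _ km).
  apply: (@approximable_cvg S _ (fun=> 1)) => //; first exact: L2_indic.
  + move=> x _; have [[k _ Fk]|nx] := pselect ((\bigcup_k F k) x); last first.
      rewrite indicE memNset// (_ : (fun m => _) = cst 0); first exact: cvg_cst.
      by apply/funext => m; rewrite S0.
    rewrite indicE mem_set; last by exists k.
    apply: cvg_near_cst; near=> m; rewrite (S1 _ k)//.
    by rewrite (_ : (k < m)%N)//; near: m; exact: nbhs_infty_gt.
  + move=> m x _; have [[k _ Fk]|nx] := pselect ((\bigcup_k F k) x); last first.
      by rewrite S0// indicE memNset// subrr normr0.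
    rewrite (S1 _ k)// indicE mem_set; last by exists k.
    by case: (k < m)%N => /=; rewrite ?subrr ?normr0// sub0r normrN normr1.
Unshelve. all: by end_near. Qed.

Import HBNNSimple.

Lemma approximable_ge0 f : L2 O f -> (forall x, O x -> 0 <= f x) -> approximable f.
Proof.
move=> Lf f0; have mf := Lf.1.
have mEf : measurable_fun O (fun x => (f x)%:E) by exact/measurable_EFinP.
pose F := nnsfun_approx mO mEf.
have Ff m x : O x -> F m x <= f x.
  by move=> Ox; rewrite -lee_fin /F nnsfun_approxE le_approx// => y Oy; rewrite lee_fin f0.
have LF m : L2 O (F m).
  apply: (L2_le mO _ Lf) => [|x Ox]; first exact: measurable_funTS.
  by rewrite !ger0_norm ?f0// Ff.
apply: (@approximable_cvg F f f) => //.
- move=> m.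
  have -> : F m = (fun x => \sum_(y <- fset_set (range (F m))) y * \1_(F m @^-1` [set y]) x) :> (_ -> R).
    by apply/funext => x; rewrite fimfunE fsbig_finite.
  elim: (fset_set _ : seq R) => [|y s IH].
    by under eq_fun do rewrite big_nil; apply: approximable_test; exact: test_fun0.
  have mind z : measurable (F m @^-1` [set z]) by exact: measurable_funPTI.
  under eq_fun do rewrite big_cons.
  apply: approximableD => //.
  + by apply: L2Z => //; exact: L2_indic.
  + by apply: L2_sum => // z; apply: L2Z => //; exact: L2_indic.
  + by apply: approximableZ; [exact: L2_indic|exact: approximable_indic].
- move=> x Ox; apply: (@fine_cvg R _ _ _ (EFin \o F ^~ x)).
  by apply: cvg_nnsfun_approx => // y Oy; rewrite lee_fin f0.
- move=> m x Ox; rewrite distrC ger0_norm ?subr_ge0 ?Ff//.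
  by rewrite gerBl.
Qed.

Lemma test_fun_dense f : L2 O f -> approximable f.
Proof.
move=> Lf; have mf := Lf.1.
have Lp : L2 O (fun x => Num.max (f x) 0).
  apply: (L2_le mO _ Lf) => [|x Ox]; first exact: measurable_maxr.
  by rewrite maxEle; case: ifPn; rewrite ?normr0.
have Ln : L2 O (fun x => Num.max (- f x) 0).
  apply: (L2_le mO _ Lf) => [|x Ox].
    by apply: measurable_maxr => //; exact: measurableT_comp.
  by rewrite maxEle; case: ifPn; rewrite ?normr0 ?normrN.
rewrite (_ : f = fun x => Num.max (f x) 0 + (-1) * Num.max (- f x) 0); last first.
  apply/funext => x; rewrite mulN1r !maxEle oppr_le0.
  by case: (ltgtP (f x) 0) => fx; rewrite ?subr0 ?opprK ?add0r ?fx ?addr0 ?oppr0//.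
apply: approximableD => //; first exact: L2Z.
  by apply: approximable_ge0 => // x _; rewrite le_max lexx orbT.
by apply: approximableZ => //; apply: approximable_ge0 => // x _; rewrite le_max lexx orbT.
Qed.

(** A function orthogonal to all test functions is orthogonal to itself. *)
Lemma fundamental_lemma g : L2 O g ->
  (forall phi, test_fun O phi -> \int[leb R n]_(x in O) (g x * phi x) = 0) ->
  {ae leb R n, forall x, O x -> g x = 0}.
Proof.
move=> Lg g0; apply: sqn_eq0 => //; apply/eqP; rewrite eq_le sqn_ge0 andbT.
apply/ler_addgt0Pl => e e0; rewrite addr0.
have e40 : 0 < e / 4 by rewrite divr_gt0.
have [phi tphi sg] := test_fun_dense Lg e40.
have Lphi := test_fun_L2 oO fO tphi.
have h2 : (0 : R) < 2^-1 by rewrite invr_gt0.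
have := normr_integral_mul_le mO h2 Lg (L2B mO Lg Lphi).
have <- : sqn O g = \int[leb R n]_(x in O) (g x * (g x - phi x)).
  rewrite /sqn; under [RHS]eq_Rintegral do rewrite mulrBr.
  rewrite RintegralB//; try exact: L2_mul_integrable.
  by rewrite (g0 _ tphi) subr0; apply: eq_Rintegral => x _; rewrite expr2.
rewrite ger0_norm ?sqn_ge0// invrK => h; move: h sg.
set s := sqn O g; set s' := sqn O _; lra.
Qed.

End density.

(** * Mollification *)

Section mollification.
Context {R : realType} {n : nat}.

Lemma Rintegral_sum (O : set 'rV[R]_n) (I : Type) (s : seq I)
    (F : I -> 'rV[R]_n -> R) : measurable O ->
  (forall i, (leb R n).-integrable O (fun x => (F i x)%:E)) ->
  \int[leb R n]_(x in O) (\sum_(i <- s) F i x) =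
  \sum_(i <- s) \int[leb R n]_(x in O) F i x.
Proof.
move=> mO iF; elim: s => [|i s IH].
  rewrite big_nil /Rintegral integral0_eq// => x _.
  by rewrite big_nil.
under eq_Rintegral do rewrite big_cons.
rewrite RintegralD//; [by rewrite big_cons IH|exact: iF|exact: (intg_sum mO s iF)].
Qed.

Lemma test_fun_partial_bounded (O : set 'rV[R]_n) phi : test_fun O phi ->
  exists2 M, 0 <= M & forall i x, `|partial i phi x| <= M.
Proof.
move=> tphi.
have /boolp.choice[M MP] i : exists M, 0 <= M /\ forall x, `|partial i phi x| <= M.
  by have [M M0 pM] := test_fun_bounded (test_fun_partial i tphi); exists M.
exists (\sum_i M i) => [|i x]; first by apply: sumr_ge0 => i _; case: (MP i).
rewrite (bigD1 i)//= (le_trans ((MP i).2 x))// lerDl.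
by apply: sumr_ge0 => j _; case: (MP j).
Qed.

(** A remainder that is quadratic uniformly in the base point: after
    integration against g it still identifies the differential of a
    convolution with g. *)
Lemma test_fun_taylor (O : set 'rV[R]_n) phi : test_fun O phi ->
  exists2 C, 0 <= C & forall z h,
    `|phi (z + h) - phi z - \sum_i h ord0 i * partial i phi z| <= C * `|h| ^+ 2.
Proof.
move=> tphi.
have /boolp.choice[M MP] i : exists M, 0 <= M /\ forall j x, `|partial j (partial i phi) x| <= M.
  by have [M M0 pM] := test_fun_partial_bounded (test_fun_partial i tphi); exists M.
pose S := \sum_i M i; have S0 : 0 <= S by apply: sumr_ge0 => i _; case: (MP i).
have MS i j x : `|partial j (partial i phi) x| <= S.
  rewrite /S (bigD1 i)//= (le_trans ((MP i).2 j x))// lerDl.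
  by apply: sumr_ge0 => k _; case: (MP k).
exists (n%:R * (n%:R * S)); first by rewrite !mulr_ge0.
move=> z h; have sphi := test_fun_smooth tphi.
have [c /andP[c0 c1] ->] := mean_value z h (smooth_differentiable sphi).
rewrite -sumrB; under eq_bigr do rewrite -mulrBr.
rewrite [leRHS](_ : _ = n%:R * (n%:R * S * `|h|) * `|h|); last by ring.
apply: norm_sum_coord_le => i.
have := lipschitz_partial (smooth_differentiable (smooth_partial i sphi)) (MS i)
  (z + c *: h) z.
move/le_trans; apply; rewrite addrC addKr normrZ gtr0_norm// ler_wpM2l ?mulr_ge0//.
by rewrite ler_piMl// ltW.
Qed.

Section fixed_domain.
Variable O : set 'rV[R]_n.
Hypotheses (oO : open O) (fO : (leb R n O < +oo)%E).
Let mO : measurable O := open_measurable_rV oO.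
Implicit Types (f g b phi : 'rV[R]_n -> R).

Definition conv g b x : R := \int[leb R n]_(y in O) (g y * b (x - y)).

Lemma test_fun_reflect_L2 b x : test_fun setT b -> L2 O (fun y => b (x - y)).
Proof.
move=> tb; have [M M0 bM] := test_fun_bounded tb.
apply: (L2_bounded mO fO _ (fun y _ => bM (x - y))).
by apply: measurable_smooth => //; apply: smooth_reflect; exact: test_fun_smooth tb.
Qed.

Lemma conv_integrable g b x : L2 O g -> test_fun setT b ->
  (leb R n).-integrable O (fun y => (g y * b (x - y))%:E).
Proof. by move=> Lg tb; apply: L2_mul_integrable => //; exact: test_fun_reflect_L2. Qed.

Lemma convD f g b x : L2 O f -> L2 O g -> test_fun setT b ->
  conv (fun y => f y + g y) b x = conv f b x + conv g b x.
Proof.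
move=> Lf Lg tb; rewrite /conv; under eq_Rintegral do rewrite mulrDl.
by rewrite RintegralD//; exact: conv_integrable.
Qed.

(** Derivatives fall on the smooth factor, so g may be merely square
    integrable. *)
Lemma conv_differentiable g b x : L2 O g -> test_fun setT b ->
  differentiable (conv g b) x /\
  forall i, partial i (conv g b) x = conv g (partial i b) x.
Proof.
move=> Lg tb; have [C C0 bC] := test_fun_taylor tb.
have Lng : L2 O (fun y => `|g y|).
  apply: (L2_le mO _ Lg); first exact: (measurableT_comp (@normr_measurable R setT) Lg.1).
  by move=> y _; rewrite normr_id.
have ing := L2_integrable mO fO Lng.
apply: (differentiable_of_remainder (C := C * \int[leb R n]_(y in O) `|g y|)) => h.
have icv c z : test_fun setT c -> (leb R n).-integrable O (fun y => (g y * c (z - y))%:E).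
  exact: conv_integrable.
have tpb i := test_fun_partial i tb.
pose T y := b (x - y + h) - b (x - y) - \sum_i h ord0 i * partial i b (x - y).
have E : conv g b (x + h) - conv g b x - \sum_i h ord0 i * conv g (partial i b) x =
    \int[leb R n]_(y in O) (g y * T y).
  rewrite /conv -RintegralB//; try exact: icv.
  rewrite (_ : \sum_i _ = \int[leb R n]_(y in O)
      \sum_i (h ord0 i * (g y * partial i b (x - y)))); last first.
    rewrite Rintegral_sum// => [|i]; last by apply: intgZ => //; exact: icv.
    by apply: eq_bigr => i _; rewrite RintegralZl//; exact: icv.
  rewrite -RintegralB//; first last.
  - by apply: intg_sum => // i; apply: intgZ => //; exact: icv.
  - by apply: intgB => //; exact: icv.
  apply: eq_Rintegral => y _; rewrite /T !mulrBr mulr_sumr [x + h - y]addrAC.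
  by congr (_ - _ - _); apply: eq_bigr => i _; rewrite mulrCA.
rewrite E.
have mgT : measurable_fun O (fun y => g y * T y).
  apply: measurable_funM; first exact: Lg.1.
  apply: measurable_smooth => //; rewrite /T.
  have sr c z : test_fun setT c -> smooth (fun y => c (z - y)).
    by move=> tc; apply: smooth_reflect; exact: test_fun_smooth tc.
  under eq_fun do rewrite [x - _ + h]addrAC.
  apply: smoothB; first by apply: smoothB; exact: sr.
  by apply: smooth_sum => i; apply: smoothM; [exact: smooth_cst|exact: sr].
have gTle y : `|g y * T y| <= C * `|h| ^+ 2 * `|g y|.
  by rewrite normrM mulrC ler_wpM2r// /T bC.
have iCg : (leb R n).-integrable O (fun y => (C * `|h| ^+ 2 * `|g y|)%:E).
  exact: intgZ.
have igT : (leb R n).-integrable O (fun y => (g y * T y)%:E).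
  apply: (le_integrable mO _ _ iCg); first exact/measurable_EFinP.
  by move=> y _; rewrite lee_fin [leRHS]ger0_norm// !mulr_ge0.
rewrite (le_trans (le_normr_Rintegral _ igT))//.
have iabs : (leb R n).-integrable O (fun y => `|g y * T y|%:E).
  exact: (integrable_abse igT).
by rewrite mulrAC -RintegralZl//; apply: le_Rintegral.
Qed.

Lemma smooth_conv g b : L2 O g -> test_fun setT b -> smooth (conv g b).
Proof.
move=> Lg + k; elim: k b => [|k IH] b tb.
  by move=> x; apply: differentiable_continuous; have [] := conv_differentiable x Lg tb.
split=> [x|i]; first by have [] := conv_differentiable x Lg tb.
rewrite (_ : partial i _ = conv g (partial i b)); first exact/IH/test_fun_partial.
by apply/funext => x; have [_] := conv_differentiable x Lg tb.
Qed.

(** The normalisation is by the integral itself, so no formula for the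
    dependence of that integral on the radius is needed. *)
Definition mollifier (r : R) (x : 'rV[R]_n) : R :=
  (\int[leb R n]_y bump 0 r y)^-1 * bump 0 r x.

Definition mollify (r : R) g : 'rV[R]_n -> R := conv g (mollifier r).

Lemma test_fun_bump0 (r : R) : 0 < r -> test_fun setT (bump (0 : 'rV[R]_n) r).
Proof. by move=> r0; exact: test_fun_bump. Qed.

Lemma integrable_bump0 (r : R) : 0 < r ->
  (leb R n).-integrable setT (fun y => (bump (0 : 'rV[R]_n) r y)%:E).
Proof.
move=> r0; apply: (@integrable_bounded_support _ _ _ 1 r) => //.
- by apply: measurable_smooth => //; exact: smooth_bump.
- by move=> x; rewrite ger0_norm ?bump_ge0// bump_le1.
- by move=> x; exact: bump_eq0.
Qed.

Lemma integral_bump_gt0 (r : R) : 0 < r -> 0 < \int[leb R n]_y bump (0 : 'rV[R]_n) r y.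
Proof.
move=> r0; rewrite lt_neqAle Rintegral_ge0 ?andbT; last by move=> x _; exact: bump_ge0.
apply/negP => /eqP i0.
have ib := integrable_bump0 r0.
have mb : measurable_fun setT (fun y : 'rV[R]_n => (bump 0 r y)%:E) by case/integrableP : ib.
have : (\int[leb R n]_y `|(bump (0 : 'rV[R]_n) r y)%:E| = 0)%E.
  under eq_integral do rewrite gee0_abs ?lee_fin ?bump_ge0//.
  by rewrite -(fineK (integrable_fin_num measurableT ib)) -[fine _]i0.
move/(ae_eq_integral_abs (leb R n) measurableT mb) => -[N [mN N0 bN]].
have bB : ball (0 : 'rV[R]_n) r `<=` N.
  move=> x xr; apply: bN => /= /(_ I) [b0].
  by have := (bump_gt0 0 x r0).2 xr; rewrite b0 ltxx.
have : (leb R n (ball (0%R : 'rV[R]_n) r) <= 0)%E.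
  by rewrite -[X in (_ <= X)%E]N0; apply: le_measure; rewrite ?inE//; exact: measurable_ball_rV.
by rewrite leb_ball// lee_fin leNgt exprn_gt0// mulrn_wgt0.
Qed.

Section radius.
Variables (r : R).
Hypothesis r0 : 0 < r.

Lemma test_fun_mollifier : test_fun setT (mollifier r).
Proof. by apply: test_funZ; exact: test_fun_bump0. Qed.

Lemma mollifier_ge0 x : 0 <= mollifier r x.
Proof. by rewrite mulr_ge0 ?bump_ge0// invr_ge0 ltW// integral_bump_gt0. Qed.

Lemma mollifierN x y : mollifier r (x - y) = mollifier r (y - x).
Proof. by rewrite /mollifier !bump_sub bumpC. Qed.

Lemma mollifier_eq0 x : ~ `|x| < r -> mollifier r x = 0.
Proof.
move=> xr; rewrite /mollifier bump_eq0 ?mulr0// ballE /= sub0r normrN.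
exact: xr.
Qed.

Lemma measurable_mollifier : measurable_fun setT (mollifier r).
Proof. by apply: measurable_smooth => //; exact: test_fun_smooth test_fun_mollifier. Qed.

Lemma integral_mollifier x :
  (\int[leb R n]_y (mollifier r (x - y))%:E = 1)%E.
Proof.
under eq_integral do rewrite mollifierN.
have mm : measurable_fun setT (fun y => (mollifier r y)%:E).
  by apply/measurable_EFinP; exact: measurable_mollifier.
rewrite (integral_leb_shift (- x) mm).
have ib := integrable_bump0 r0.
rewrite /mollifier; under eq_integral do rewrite EFinM.
rewrite integralZl// -(fineK (integrable_fin_num measurableT ib)) -EFinM.
by rewrite mulVf// gt_eqF// integral_bump_gt0.
Qed.

Lemma integral_mollifier_dom x : \int[leb R n]_(y in O) mollifier r (x - y) <= 1.
Proof.
have tm := test_fun_mollifier.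
have ie := L2_integrable mO fO (test_fun_reflect_L2 x tm).
rewrite /Rintegral -lee_fin fineK ?integrable_fin_num// -(integral_mollifier x).
apply: ge0_subset_integral => //.
- apply/measurable_EFinP; apply: measurable_smooth => //; apply: smooth_reflect.
  exact: test_fun_smooth tm.
- by move=> y _; rewrite lee_fin mollifier_ge0.
Qed.

Lemma mollify_sqr_integrable g x : L2 O g ->
  (leb R n).-integrable O (fun y => (g y ^+ 2 * mollifier r (x - y))%:E).
Proof.
move=> Lg; have tm := test_fun_mollifier.
have [M M0 mM] := test_fun_bounded tm.
have ig := intgZ mO M Lg.2.
apply: (le_integrable mO _ _ ig) => [|y _].
  apply/measurable_EFinP; apply: measurable_funM; first by apply: measurable_funX; exact: Lg.1.
  apply: measurable_smooth => //; apply: smooth_reflect; exact: test_fun_smooth tm.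
rewrite lee_fin normrM mulrC [leRHS](ger0_norm (mulr_ge0 M0 (sqr_ge0 (g y)))).
by rewrite (ger0_norm (sqr_ge0 (g y))) ler_wpM2r ?sqr_ge0.
Qed.

(** Jensen's inequality for the weight y |-> mollifier r (x - y), of mass at
    most 1: expand the nonnegative integral of (g y - mollify r g x)^2. *)
Lemma mollify_sqr_le g x : L2 O g ->
  mollify r g x ^+ 2 <= \int[leb R n]_(y in O) (g y ^+ 2 * mollifier r (x - y)).
Proof.
move=> Lg; have tm := test_fun_mollifier; set m := mollify r g x.
have i1 := mollify_sqr_integrable x Lg.
have i2 := conv_integrable x Lg tm.
have i3 := L2_integrable mO fO (test_fun_reflect_L2 x tm).
have : 0 <= \int[leb R n]_(y in O) ((g y - m) ^+ 2 * mollifier r (x - y)).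
  by apply: Rintegral_ge0 => y _; rewrite mulr_ge0 ?sqr_ge0 ?mollifier_ge0.
rewrite (@eq_Rintegral _ _ _ _ _ (fun y => g y ^+ 2 * mollifier r (x - y) +
  ((-2 * m) * (g y * mollifier r (x - y)) + m ^+ 2 * mollifier r (x - y)))); last first.
  by move=> y _; ring.
have i4 := intgZ mO (-2 * m) i2; have i5 := intgZ mO (m ^+ 2) i3.
rewrite RintegralD//; last exact: (intgD mO i4 i5).
rewrite RintegralD// (RintegralZl _ mO i2) (RintegralZl _ mO i3).
rewrite -[\int[leb R n]_(y in O) (g y * _)]/m => h.
have := ler_wpM2l (sqr_ge0 m) (integral_mollifier_dom x); move: h; rewrite mulr1.
set I := \int[leb R n]_(y in O) _; set w := \int[leb R n]_(y in O) _.
by rewrite expr2; nra.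
Qed.

Lemma measurable_mollify g : L2 O g -> measurable_fun setT (mollify r g).
Proof.
by move=> Lg; apply: measurable_smooth => //; apply: smooth_conv => //; exact: test_fun_mollifier.
Qed.

(** Jensen's inequality followed by Tonelli's theorem: the kernel has total
    mass 1 in either variable. *)
Lemma integral_mollify_sqr_le g : L2 O g ->
  (\int[leb R n]_(x in O) (mollify r g x ^+ 2)%:E <=
   \int[leb R n]_(y in O) (g y ^+ 2)%:E)%E.
Proof.
move=> Lg; have tm := test_fun_mollifier.
pose gO := (fun y => g y ^+ 2) \_ O.
have gO0 y : 0 <= gO y by rewrite /gO patchE; case: ifP => // _; exact: sqr_ge0.
have mgO : measurable_fun setT gO.
  by apply/(measurable_restrictT _ mO); apply: measurable_funX; exact: Lg.1.
pose H (z : 'rV[R]_n * 'rV[R]_n) : \bar R := (gO z.2 * mollifier r (z.1 - z.2))%:E.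
have H0 z : (0 <= H z)%E by rewrite lee_fin mulr_ge0// mollifier_ge0.
have mH : measurable_fun setT H.
  apply/measurable_EFinP; apply: measurable_funM.
    exact: measurableT_comp mgO measurable_snd.
  apply: (measurableT_comp measurable_mollifier).
  apply: measurable_fun_rV => i; under eq_fun do rewrite !mxE.
  apply: measurable_funB.
    exact: measurableT_comp (measurable_coord i) measurable_fst.
  exact: measurableT_comp (measurable_coord i) measurable_snd.
have step1 x : ((mollify r g x ^+ 2)%:E <= \int[leb R n]_y H (x, y))%E.
  have i1 := mollify_sqr_integrable x Lg.
  apply: (@le_trans _ _ (\int[leb R n]_(y in O) (g y ^+ 2 * mollifier r (x - y))%:E)%E).
    rewrite -(fineK (integrable_fin_num mO i1)) lee_fin.
    exact: mollify_sqr_le.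
  rewrite integral_mkcond; apply: ge0_le_integral => //.
  - by move=> y _; rewrite patchE; case: ifP => // _; rewrite lee_fin mulr_ge0 ?sqr_ge0 ?mollifier_ge0.
  - by apply/(measurable_restrictT _ mO); case/integrableP : i1.
  - exact: measurableT_comp mH (pair1_measurable x).
  - by move=> y _; rewrite /H /gO !patchE /=; case: ifP => // _; rewrite mul0r.
apply: (@le_trans _ _ (\int[leb R n]_x \int[leb R n]_y H (x, y))%E).
  apply: (@le_trans _ _ (\int[leb R n]_x (mollify r g x ^+ 2)%:E)%E).
    apply: ge0_subset_integral => //.
    - by apply/measurable_EFinP; apply: measurable_funX; exact: measurable_mollify.
    - by move=> x _; rewrite lee_fin sqr_ge0.
  apply: ge0_le_integral => //.
  - by move=> x _; rewrite lee_fin sqr_ge0.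
  - by apply/measurable_EFinP; apply: measurable_funX; exact: measurable_mollify.
  - exact: (measurable_fun_fubini_tonelli_F (m2 := leb R n) _ mH H0).
rewrite (fubini_tonelli (m1 := leb R n) (m2 := leb R n) _ mH H0).
rewrite [leRHS]integral_mkcond; apply: ge0_le_integral => //.
- by move=> y _; exact: integral_ge0.
- exact: (measurable_fun_fubini_tonelli_G (m1 := leb R n) _ mH H0).
- by apply/(measurable_restrictT _ mO); case/integrableP : Lg.2.
move=> y _.
have -> : (\int[leb R n]_x H (x, y) = (gO y)%:E)%E.
  rewrite /H /=; under eq_integral do rewrite EFinM mollifierN.
  rewrite ge0_integralZl_EFin//.
  - by rewrite integral_mollifier mule1.
  - by move=> x _; rewrite lee_fin mollifier_ge0.
  - apply/measurable_EFinP; apply: measurable_smooth => //; apply: smooth_reflect.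
    exact: test_fun_smooth tm.
by rewrite /gO !patchE; case: ifP.
Qed.

Lemma mollify_L2 g : L2 O g -> L2 O (mollify r g).
Proof.
move=> Lg; split; first by apply: measurable_funTS; exact: measurable_mollify.
apply/integrableP; split.
  apply/measurable_EFinP; apply: measurable_funX; apply: measurable_funTS.
  exact: measurable_mollify.
have /integrableP[_ ] := Lg.2; apply: le_lt_trans.
under eq_integral do rewrite gee0_abs ?lee_fin ?sqr_ge0//.
under [leRHS]eq_integral do rewrite gee0_abs ?lee_fin ?sqr_ge0//.
exact: integral_mollify_sqr_le.
Qed.

Lemma sqn_mollify_le g : L2 O g -> sqn O (mollify r g) <= sqn O g.
Proof.
move=> Lg; have Lm := mollify_L2 Lg.
rewrite /sqn /Rintegral -lee_fin !fineK; [exact: integral_mollify_sqr_le| |].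
  exact: integrable_fin_num Lg.2.
exact: integrable_fin_num Lm.2.
Qed.

End radius.

Lemma mollify_test_sub_le phi (L r : R) x : 0 < r -> 0 <= L -> test_fun O phi ->
  (forall y z, `|phi y - phi z| <= L * `|y - z|) ->
  `|mollify r phi x - phi x| <= L * r.
Proof.
move=> r0 L0 tphi phiL.
have tm := test_fun_mollifier r0.
pose e y := mollifier r (x - y).
have me : measurable_fun setT e.
  by apply: measurable_smooth => //; apply: smooth_reflect; exact: test_fun_smooth tm.
have iM : (leb R n).-integrable setT (fun y => (e y)%:E).
  apply/integrableP; split; first exact/measurable_EFinP.
  under eq_integral do rewrite gee0_abs ?lee_fin ?mollifier_ge0//.
  by rewrite integral_mollifier// ltry.
have [K [_ KO p0]] := test_fun_support tphi.
have [P P0 pP] := test_fun_bounded tphi.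
have mphi : measurable_fun setT phi.
  by apply: measurable_smooth => //; exact: test_fun_smooth tphi.
have iphie : (leb R n).-integrable setT (fun y => (phi y * e y)%:E).
  apply: (le_integrable measurableT _ _ (intgZ measurableT P iM)).
    by apply/measurable_EFinP; exact: measurable_funM.
  move=> y _; have e0 : 0 <= e y := mollifier_ge0 r0 _.
  by rewrite lee_fin normrM [leRHS](ger0_norm (mulr_ge0 P0 e0)) (ger0_norm e0) ler_wpM2r.
have E : mollify r phi x - phi x = \int[leb R n]_y ((phi y - phi x) * e y).
  under eq_Rintegral do rewrite mulrBl.
  rewrite RintegralB//; last exact: (intgZ measurableT (phi x) iM).
  rewrite (RintegralZl _ measurableT iM) [X in _ = _ - _ * X]/Rintegral integral_mollifier//= mulr1.
  congr (_ - _); rewrite /mollify /conv Rintegral_mkcond; apply: eq_Rintegral => y _.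
  rewrite patchE; case: ifPn => // /negP nO; rewrite p0 ?mul0r// => /KO Oy.
  by apply: nO; rewrite inE.
have iD : (leb R n).-integrable setT (fun y => ((phi y - phi x) * e y)%:E).
  under eq_fun do rewrite mulrBl.
  by apply: intgB => //; exact: intgZ.
rewrite E (le_trans (le_normr_Rintegral _ iD))//.
rewrite [leRHS](_ : _ = \int[leb R n]_y (L * r * e y)); last first.
  by rewrite (RintegralZl _ measurableT iM) [X in _ = _ * X]/Rintegral integral_mollifier//= mulr1.
apply: le_Rintegral => //.
- exact: (integrable_abse iD).
- exact: intgZ.
move=> y _; have e0 : 0 <= e y := mollifier_ge0 r0 _.
rewrite normrM (ger0_norm e0).
have [xy|xy] := ltP `|x - y| r; last first.
  by rewrite /e mollifier_eq0 ?mulr0//; apply/negP; rewrite -leNgt.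
rewrite ler_wpM2r// (le_trans (phiL _ _))// ler_wpM2l//.
by rewrite distrC ltW.
Qed.

Lemma mollify_test_cvg phi (e : R) : 0 < e -> test_fun O phi ->
  \forall r \near (0 : R)^'+, sqn O (fun x => mollify r phi x - phi x) < e.
Proof.
move=> e0 tphi; have [M M0 pM] := test_fun_partial_bounded tphi.
have phiL := lipschitz_partial (smooth_differentiable (test_fun_smooth tphi)) pM.
pose L := n%:R * M; have L0 : 0 <= L by rewrite mulr_ge0.
pose V := fine (leb R n O); have V0 : 0 <= V by rewrite fine_ge0.
pose d := Num.min 1 (e / (L ^+ 2 * V + 1)).
have c0 : 0 < L ^+ 2 * V + 1 by rewrite ltr_wpDl// mulr_ge0 ?exprn_ge0.
have d0 : 0 < d by rewrite lt_min ltr01 divr_gt0.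
near=> r.
have r0 : 0 < r by near: r; exact: nbhs_right_gt.
have rd : r < d by near: r; exact: nbhs_right_lt.
have Lphi := test_fun_L2 oO fO tphi.
have Lm := mollify_L2 r0 Lphi.
have cL : L2 O (fun=> L * r) by apply: (@L2_bounded _ _ _ mO fO `|L * r|).
apply: (@le_lt_trans _ _ (sqn O (fun=> L * r))).
  apply: le_sqn => //; first exact: L2B.
  move=> x _; rewrite [leRHS]ger0_norm ?mulr_ge0 ?(ltW r0)//.
  exact: mollify_test_sub_le.
rewrite /sqn Rintegral_cst// -/V exprMn.
have r1 : r < 1 by move: rd; rewrite lt_min => /andP[].
have re : r < e / (L ^+ 2 * V + 1) by move: rd; rewrite lt_min => /andP[].
apply: (@le_lt_trans _ _ (r * (L ^+ 2 * V + 1))); last by rewrite -ltr_pdivlMr.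
rewrite mulrAC expr2 mulrA mulrC ler_wpM2l ?(ltW r0)//.
rewrite (@le_trans _ _ (L ^+ 2 * V))// ?lerDl//.
by rewrite -expr2 ler_piMr ?(ltW r1)// mulr_ge0// exprn_ge0.
Unshelve. all: by end_near. Qed.

(** Density reduces the convergence to test functions, since mollification
    is a contraction of the mean-square norm. *)
Lemma mollify_cvg g (e : R) : 0 < e -> L2 O g ->
  \forall r \near (0 : R)^'+, sqn O (fun x => g x - mollify r g x) < e.
Proof.
move=> e0 Lg; have e12 : 0 < e / 12 by rewrite divr_gt0.
have [phi tphi sg] := test_fun_dense oO fO Lg e12.
have Lphi := test_fun_L2 oO fO tphi.
near=> r.
have r0 : 0 < r by near: r; exact: nbhs_right_gt.
have sphi : sqn O (fun x => mollify r phi x - phi x) < e / 12.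
  by near: r; exact: mollify_test_cvg.
have Lgp := L2B mO Lg Lphi.
pose h x := g x - phi x.
have sh := sqn_mollify_le r0 Lgp.
have mE x : mollify r g x = mollify r h x + mollify r phi x.
  rewrite -convD//; last exact: test_fun_mollifier.
  by congr (conv _ _ _); apply/funext => y; rewrite /h subrK.
have -> : (fun x => g x - mollify r g x) =
    fun x => h x + ((-1) * mollify r h x + (-1) * (mollify r phi x - phi x)).
  by apply/funext => x; rewrite mE /h; ring.
have Lmh := mollify_L2 r0 Lgp; have Lmp := mollify_L2 r0 Lphi.
have LD := L2B mO Lmp Lphi.
have s1 := sqnD_le mO Lgp (L2D mO (L2Z mO (-1) Lmh) (L2Z mO (-1) LD)).
have s2 := sqnD_le mO (L2Z mO (-1) Lmh) (L2Z mO (-1) LD).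
rewrite (sqnZ mO (-1) Lmh) (sqnZ mO (-1) LD) sqrrN expr1n !mul1r in s2.
by move: s1 s2 sg sh sphi; rewrite -/h; lra.
Unshelve. all: by end_near. Qed.

(** A positive distance from K to the complement of O is what leaves room for
    mollifying inside O. *)
Lemma compact_thickening (K : set 'rV[R]_n) : compact K -> K `<=` O ->
  exists2 r : R, 0 < r & forall y, K y -> ball y r `<=` O.
Proof.
move=> /compact_near_coveringP cK KO.
have [] := cK R (0 : R)^'+ (fun r y => ball y r `<=` O) _.
  move=> y Ky; have /nbhs_ballP[e /= e0 eO] : nbhs y O.
    by apply: open_nbhs_nbhs; split => //; exact: KO.
  have e20 : 0 < e / 2 by rewrite divr_gt0.
  exists (ball y (e / 2), [set r | r < e / 2]).
    by split; [exact: nbhsx_ballx|exact: nbhs_right_lt].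
  move=> [z r] /= [yz re] w zw; apply: eO; rewrite (splitr e).
  by apply: ball_triangle yz _; apply: le_ball zw; exact: ltW.
move=> e /= e0 eP; exists (e / 2); first by rewrite divr_gt0.
apply: eP; last by rewrite /= divr_gt0.
by rewrite /= sub0r normrN gtr0_norm ?divr_gt0// ltr_pdivrMr// ltr_pMr// ltr1n.
Qed.

Lemma test_fun_mollify g (K : set 'rV[R]_n) (r r0 : R) : L2 O g ->
  compact K -> K `<=` O -> (forall x, ~ K x -> g x = 0) ->
  0 < r -> 2 * r < r0 -> (forall y, K y -> ball y r0 `<=` O) ->
  test_fun O (mollify r g).
Proof.
move=> Lg cK KO g0 r_gt0 rr0 Kr0.
have tm := test_fun_mollifier r_gt0.
have sup x : mollify r g x != 0 -> exists2 y, K y & `|x - y| < r.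
  move=> mx; apply: contrapT => nK; move/eqP: mx; apply.
  rewrite /mollify /conv /Rintegral integral0_eq// => y Oy.
  have [Ky|nKy] := pselect (K y); last by rewrite g0// mul0r.
  rewrite mollifier_eq0 ?mulr0// => xy; apply: nK; by exists y.
(* The support grows by r, and its closure may meet points a further r away. *)
have clos x : closure [set x | mollify r g x != 0] x -> exists2 y, K y & `|x - y| < 2 * r.
  move=> /(_ (ball x r) (nbhsx_ballx x r r_gt0))[z [/sup[y Ky zy]]].
  rewrite ballE /= => xz; exists y => //.
  rewrite -(subrKA z) (le_lt_trans (ler_normD _ _))// mulr_natl mulr2n.
  exact: ltrD.
split; first exact: smooth_conv.
  have [B B0 KB] := bounded_ball0 (compact_bounded cK).
  apply: (subclosed_compact _ (@compact_closed_ball_rV R n 0 (B + 2 * r))).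
    exact: closed_closure.
  move=> x /clos[y Ky xy]; rewrite /= sub0r normrN -[x](subrK y).
  rewrite (le_trans (ler_normD _ _))// addrC lerD ?(ltW xy)//.
  by have := KB _ Ky; rewrite ballE /= sub0r normrN => /ltW.
move=> x /clos[y Ky xy]; apply: (Kr0 _ Ky); rewrite ballE /= distrC.
exact: lt_trans xy rr0.
Qed.

Definition mulgrad f (Df : 'rV[R]_n -> 'rV[R]_n) g (Dg : 'rV[R]_n -> 'rV[R]_n) x :=
  f x *: Dg x + g x *: Df x.

Lemma L2_mul_test f phi : L2 O f -> test_fun O phi -> L2 O (fun x => f x * phi x).
Proof.
move=> Lf tphi; have [M M0 pM] := test_fun_bounded tphi.
under eq_fun do rewrite mulrC.
apply: (L2_bounded_mul mO _ (fun x _ => pM x) Lf).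
by apply: measurable_smooth => //; exact: test_fun_smooth tphi.
Qed.

(** The weak gradient of f tested with phi zeta.  The factor
    zeta will be a translated mollifier, which may reach outside O. *)
Lemma weak_grad_mul_smooth f Df zeta phi i : H1 O f Df -> test_fun O phi -> smooth zeta ->
  \int[leb R n]_(x in O) (f x * phi x * partial i zeta x) =
  - \int[leb R n]_(x in O) ((f x * partial i phi x + phi x * Df x ord0 i) * zeta x).
Proof.
move=> [Lf LDf wf] tphi szeta.
have tpz := test_funM tphi szeta.
have tdpz : test_fun O (fun x => partial i phi x * zeta x).
  exact: test_funM (test_fun_partial i tphi) szeta.
have tpdz : test_fun O (fun x => phi x * partial i zeta x).
  exact: test_funM tphi (smooth_partial i szeta).
have := wf _ tpz i.
rewrite (@eq_Rintegral _ _ _ _ _ (fun x => f x * (phi x * partial i zeta x) +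
    f x * (partial i phi x * zeta x))); last first.
  move=> x _; rewrite partialM ?mulrDr; [by congr (_ + _); rewrite mulrCA mulrC; ring| |].
    exact: smooth_differentiable (test_fun_smooth tphi) _.
  exact: smooth_differentiable szeta _.
rewrite RintegralD//; first last.
- by apply: L2_mul_integrable => //; exact: test_fun_L2.
- by apply: L2_mul_integrable => //; exact: test_fun_L2.
move=> h.
rewrite [X in _ = - X](@eq_Rintegral _ _ _ _ _ (fun x => f x * (partial i phi x * zeta x) +
    Df x ord0 i * (phi x * zeta x))); last by move=> x _; ring.
rewrite RintegralD//; first last.
- by apply: L2_mul_integrable => //; exact: test_fun_L2.
- by apply: L2_mul_integrable => //; exact: test_fun_L2.
rewrite opprD -h addrC addrK.
by apply: eq_Rintegral => x _; rewrite mulrA.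
Qed.

(** Localisation: multiplying by a test function turns a function of H^1 into
    one of H^1_0, approximated by its mollifications. *)
Lemma H10_mul_test f Df phi : H1 O f Df -> test_fun O phi ->
  H10 O (fun x => f x * phi x) (mulgrad f Df phi (grad phi)).
Proof.
move=> Hf tphi; have [Lf LDf wf] := Hf.
pose g x := f x * phi x; pose Dg := mulgrad f Df phi (grad phi).
have DgE i x : Dg x ord0 i = f x * partial i phi x + phi x * Df x ord0 i.
  by rewrite /Dg /mulgrad !mxE.
have Lg : L2 O g by exact: L2_mul_test.
have LDg i : L2 O (fun x => Dg x ord0 i).
  rewrite (_ : (fun x => _) = fun x => f x * partial i phi x + Df x ord0 i * phi x).
    by apply: L2D => //; apply: L2_mul_test => //; exact: test_fun_partial.
  by apply/funext => x; rewrite DgE [phi x * _]mulrC.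
split; first split => //.
  move=> psi tpsi i; rewrite (weak_grad_mul_smooth i Hf tphi (test_fun_smooth tpsi)).
  by congr (- _); apply: eq_Rintegral => x _; rewrite DgE.
move=> e e0.
have [K [cK KO p0]] := test_fun_support tphi.
have [r0 r0_gt0 Kr0] := compact_thickening cK KO.
have d0 : 0 < e / n.+1%:R by rewrite divr_gt0.
have near_all : \forall r \near (0 : R)^'+, forall i : 'I_n,
    sqn O (fun x => Dg x ord0 i - mollify r (fun x => Dg x ord0 i) x) < e / n.+1%:R.
  by apply: filter_forall => i; exact: mollify_cvg.
have r02 : 0 < r0 / 2 by rewrite divr_gt0.
have [r [r_gt0 rr0 sg sDg]] : exists r, [/\ 0 < r, 2 * r < r0,
    sqn O (fun x => g x - mollify r g x) < e / n.+1%:R &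
    forall i : 'I_n, sqn O (fun x => Dg x ord0 i - mollify r (fun x => Dg x ord0 i) x) < e / n.+1%:R].
  near (0 : R)^'+ => r; exists r; split.
  - by near: r; exact: nbhs_right_gt.
  - by rewrite mulrC -ltr_pdivlMr//; near: r; exact: nbhs_right_lt.
  - by near: r; exact: mollify_cvg.
  - by near: r.
have tm := test_fun_mollifier r_gt0.
exists (mollify r g).
  by apply: (test_fun_mollify Lg cK KO _ r_gt0 rr0 Kr0) => x /p0; rewrite /g => ->; rewrite mulr0.
have pE i x : partial i (mollify r g) x = mollify r (fun x => Dg x ord0 i) x.
  have [_ ->] := conv_differentiable x Lg tm.
  have sz : smooth (fun y => mollifier r (x - y)) by apply: smooth_reflect; exact: test_fun_smooth tm.
  have := weak_grad_mul_smooth i Hf tphi sz.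
  rewrite (@eq_Rintegral _ _ _ _ _ (fun y => (-1) * (g y * partial i (mollifier r) (x - y)))).
    rewrite RintegralZl//; last exact: (conv_integrable x Lg (test_fun_partial i tm)).
    rewrite mulN1r => /oppr_inj; rewrite /mollify /conv => ->.
    by apply: eq_Rintegral => y _; rewrite DgE.
  move=> y _; rewrite partial_reflect; first by rewrite /g; ring.
  exact: smooth_differentiable (test_fun_smooth tm) _.
have Lm := mollify_L2 r_gt0 Lg.
have LmD i := mollify_L2 r_gt0 (LDg i).
rewrite /H1_norm2 (@eq_Rintegral _ _ _ _ _ (fun x => (g x - mollify r g x) ^+ 2 +
    \sum_i (Dg x ord0 i - mollify r (fun x => Dg x ord0 i) x) ^+ 2)); last first.
  move=> x _; congr (_ + _); apply: eq_bigr => i _.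
  have gE : grad (mollify r g) x ord0 i = mollify r (fun x => Dg x ord0 i) x.
    by rewrite mxE pE.
  have sE (u v : 'rV[R]_n) : (u - v) ord0 i = u ord0 i - v ord0 i by rewrite !mxE.
  by rewrite sE gE -expr2.
rewrite RintegralD//; first last.
- by apply: intg_sum => // i; exact: (L2B mO (LDg i) (LmD i)).2.
- exact: (L2B mO Lg Lm).2.
rewrite Rintegral_sum//; last by move=> i; exact: (L2B mO (LDg i) (LmD i)).2.
apply: (@lt_le_trans _ _ (e / n.+1%:R + \sum_(i < n) e / n.+1%:R)).
  by apply: ltr_leD; [exact: sg|apply: ler_sum => i _; exact: ltW (sDg i)].
by rewrite sumr_const card_ord -mulrS -[_ *+ n.+1]mulr_natr divfK ?pnatr_eq0.
Unshelve. all: by end_near. Qed.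

End fixed_domain.
End mollification.

(** * Calculus in H^1 *)

Section sobolev.
Context {R : realType} {n : nat}.
Variable O : set 'rV[R]_n.
Hypotheses (oO : open O) (fO : (leb R n O < +oo)%E).
Let mO : measurable O := open_measurable_rV oO.
Implicit Types (f g v phi : 'rV[R]_n -> R) (Df Dg Dv G : 'rV[R]_n -> 'rV[R]_n).

Lemma Rintegral_ae_eq f g : measurable_fun O f -> measurable_fun O g ->
  {ae leb R n, forall x, O x -> f x = g x} ->
  \int[leb R n]_(x in O) f x = \int[leb R n]_(x in O) g x.
Proof.
move=> mf mg fg; congr fine; apply: ae_eq_integral => //; try exact/measurable_EFinP.
by apply: filterS fg => x h Ox; rewrite h.
Qed.

Lemma le_sqn_ae f g : L2 O f -> L2 O g ->
  {ae leb R n, forall x, O x -> `|f x| <= `|g x|} -> sqn O f <= sqn O g.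
Proof.
move=> [mf f2] [mg g2] fg; rewrite /sqn /Rintegral -lee_fin !fineK ?integrable_fin_num//.
apply: ae_ge0_le_integral => //.
- by move=> x _; rewrite lee_fin sqr_ge0.
- by case/integrableP : f2.
- by move=> x _; rewrite lee_fin sqr_ge0.
- by case/integrableP : g2.
- apply: filterS fg => x + Ox => /(_ Ox) fgx; rewrite lee_fin.
  rewrite -[X in X <= _]real_normK ?num_real// -[X in _ <= X]real_normK ?num_real//.
  by rewrite lerXn2r// nnegrE.
Qed.

Lemma sqn_ae0 f : L2 O f -> {ae leb R n, forall x, O x -> f x = 0} -> sqn O f = 0.
Proof.
move=> Lf f0; apply/eqP; rewrite eq_le sqn_ge0 andbT.
have -> : 0 = sqn O (fun=> 0 : R).
  by rewrite /sqn /Rintegral integral0_eq// => x _; rewrite expr0n.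
apply: le_sqn_ae => //; first exact: L20.
by apply: filterS f0 => x h Ox; rewrite h.
Qed.

Lemma H10_H1 v Dv : H10 O v Dv -> H1 O v Dv. Proof. by case. Qed.

Lemma L2_partial phi i : test_fun O phi -> L2 O (partial i phi).
Proof. by move=> tphi; apply: test_fun_L2 => //; exact: test_fun_partial. Qed.

Lemma H10_approx v Dv (e : R) : H10 O v Dv -> 0 < e ->
  exists phi, [/\ test_fun O phi, sqn O (fun x => v x - phi x) < e &
    forall i, sqn O (fun x => Dv x ord0 i - partial i phi x) < e].
Proof.
move=> [[Lv LDv _] happ] e0; have [phi tphi] := happ _ e0.
have Ld := L2B mO Lv (test_fun_L2 oO fO tphi).
have LD i := L2B mO (LDv i) (L2_partial i tphi).
rewrite /H1_norm2 (@eq_Rintegral _ _ _ _ _ (fun x => (v x - phi x) ^+ 2 +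
    \sum_i (Dv x ord0 i - partial i phi x) ^+ 2)); last first.
  by move=> x _; congr (_ + _); apply: eq_bigr => i _; rewrite 3!mxE -expr2.
rewrite RintegralD//; [|exact: Ld.2|by apply: intg_sum => // i; exact: (LD i).2].
rewrite Rintegral_sum//; last by move=> i; exact: (LD i).2.
move=> lt_e; exists phi; split => // [|i].
  apply: le_lt_trans lt_e; rewrite lerDl sumr_ge0// => j _; exact: sqn_ge0.
apply: le_lt_trans lt_e; rewrite (bigD1 i)//= addrCA -[leLHS]addr0.
rewrite lerD// ?addr_ge0 ?sqn_ge0// sumr_ge0// => j _; exact: sqn_ge0.
Qed.

Lemma L2_dot_integrable G Dv : (forall i, L2 O (fun x => G x ord0 i)) ->
  (forall i, L2 O (fun x => Dv x ord0 i)) ->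
  (leb R n).-integrable O (fun x => (dot (G x) (Dv x))%:E).
Proof.
by move=> LG LD; apply: intg_sum => // i; exact: L2_mul_integrable.
Qed.

Lemma integral_pairing_split f G v Dv : L2 O f -> (forall i, L2 O (fun x => G x ord0 i)) ->
  L2 O v -> (forall i, L2 O (fun x => Dv x ord0 i)) ->
  \int[leb R n]_(x in O) (f x * v x + dot (G x) (Dv x)) =
  \int[leb R n]_(x in O) (f x * v x) +
  \sum_i \int[leb R n]_(x in O) (G x ord0 i * Dv x ord0 i).
Proof.
move=> Lf LG Lv LD; rewrite RintegralD//; last exact: L2_dot_integrable.
  by rewrite Rintegral_sum// => i; exact: L2_mul_integrable.
exact: L2_mul_integrable.
Qed.

(** A bounded functional of (v, Dv) that vanishes on test functions vanishes
    on H^1_0. *)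
Lemma H10_pairing f G v Dv : L2 O f -> (forall i, L2 O (fun x => G x ord0 i)) ->
  (forall phi, test_fun O phi ->
    \int[leb R n]_(x in O) (f x * phi x + dot (G x) (grad phi x)) = 0) ->
  H10 O v Dv ->
  \int[leb R n]_(x in O) (f x * v x + dot (G x) (Dv x)) = 0.
Proof.
move=> Lf LG fG0 Hv; have [Lv LDv _] := H10_H1 Hv.
apply/eqP; rewrite -normr_le0; apply/ler_addgt0Pl => eta eta0; rewrite addr0.
pose A := sqn O f + \sum_i sqn O (fun x => G x ord0 i).
have A0 : 0 <= A by rewrite addr_ge0 ?sqn_ge0// sumr_ge0// => i _; exact: sqn_ge0.
pose d := eta / (2 * (A + 1)).
have A1 : 0 < A + 1 by rewrite ltr_wpDl.
have d0 : 0 < d by apply: divr_gt0 => //; exact: mulr_gt0.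
pose e := d * eta / (2 * n.+1%:R).
have e0 : 0 < e by apply: divr_gt0; exact: mulr_gt0.
have [phi [tphi sv sD]] := H10_approx Hv e0.
have Lphi := test_fun_L2 oO fO tphi.
have Lgrad i : L2 O (fun x => grad phi x ord0 i).
  by under eq_fun do rewrite mxE; exact: L2_partial.
have Lw := L2B mO Lv Lphi.
have LDw i : L2 O (fun x => (Dv x - grad phi x) ord0 i).
  by under eq_fun do rewrite 2!mxE; exact: L2B.
have -> : \int[leb R n]_(x in O) (f x * v x + dot (G x) (Dv x)) =
    \int[leb R n]_(x in O) (f x * (v x - phi x) + dot (G x) (Dv x - grad phi x)).
  rewrite -[LHS]subr0 -(fG0 _ tphi) -RintegralB//; first last.
  - by apply: intgD => //; [exact: L2_mul_integrable|exact: L2_dot_integrable].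
  - by apply: intgD => //; [exact: L2_mul_integrable|exact: L2_dot_integrable].
  apply: eq_Rintegral => x _; rewrite /dot opprD addrACA -sumrB mulrBr; congr (_ + _).
  by apply: eq_bigr => i _; rewrite -mulrBr !mxE.
rewrite (integral_pairing_split Lf LG Lw LDw).
apply: (@le_trans _ _ ((d * sqn O f + d^-1 * e) +
    \sum_i (d * sqn O (fun x => G x ord0 i) + d^-1 * e))).
  apply: le_trans (ler_normD _ _) _; apply: lerD.
    apply: le_trans (normr_integral_mul_le mO d0 Lf Lw) _.
    by rewrite lerD2l ler_wpM2l ?invr_ge0 ?(ltW d0)// ltW.
  apply: le_trans (ler_norm_sum _ _ _) _; apply: ler_sum => i _.
  apply: le_trans (normr_integral_mul_le mO d0 (LG i) (LDw i)) _.
  rewrite lerD2l ler_wpM2l ?invr_ge0 ?(ltW d0)//.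
  by rewrite (eq_fun (_ : _ =1 (fun x => Dv x ord0 i - partial i phi x))) ?(ltW (sD i))// => x; rewrite !mxE.
rewrite big_split /= sumr_const card_ord addrACA -mulr_sumr -mulrDr -/A -mulrS.
have -> : d^-1 * e *+ n.+1 = eta / 2.
  rewrite /e -mulrA mulKf ?gt_eqF// -mulr_natr.
  by rewrite invfM mulrA divfK// pnatr_eq0.
rewrite [leRHS](splitr eta) lerD2r /d mulrAC ler_pdivrMr ?mulr_gt0//.
rewrite [leRHS](_ : _ = eta * (A + 1)); last by field.
by rewrite ler_wpM2l ?(ltW eta0)// lerDl.
Qed.

(** The identity defining the weak gradient extends by continuity from test
    functions to H^1_0. *)
Lemma weak_grad_H10 f Df v Dv i : H1 O f Df -> H10 O v Dv ->
  \int[leb R n]_(x in O) (f x * Dv x ord0 i) =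
  - \int[leb R n]_(x in O) (Df x ord0 i * v x).
Proof.
move=> [Lf LDf wf] Hv; have [Lv LDv _] := H10_H1 Hv.
pose G x : 'rV[R]_n := f x *: delta_mx ord0 i.
have GE x (y : 'rV[R]_n) : dot (G x) y = f x * y ord0 i.
  rewrite /dot (bigD1 i)//= big1 ?addr0; first by rewrite !mxE !eqxx mulr1.
  by move=> j ji; rewrite !mxE eqxx (negPf ji) mulr0 mul0r.
have LG j : L2 O (fun x => G x ord0 j).
  under eq_fun do rewrite !mxE eqxx /=.
  have [_|_] := eqVneq j i; first by under eq_fun do rewrite mulr1.
  by under eq_fun do rewrite mulr0; exact: L20.
have := @H10_pairing (fun x => Df x ord0 i) G v Dv (LDf i) LG.
under eq_Rintegral do rewrite GE.
rewrite RintegralD//; try exact: L2_mul_integrable.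
move=> h; apply/eqP; rewrite -addr_eq0 addrC; apply/eqP; apply: h => // phi tphi.
under eq_Rintegral do rewrite GE mxE.
rewrite RintegralD//; first by rewrite (wf _ tphi) addrN.
- by apply: L2_mul_integrable => //; exact: test_fun_L2.
- by apply: L2_mul_integrable => //; exact: L2_partial.
Qed.

Lemma weak_grad_unique f Df Dg : H1 O f Df -> H1 O f Dg -> forall i,
  {ae leb R n, forall x, O x -> Df x ord0 i = Dg x ord0 i}.
Proof.
move=> [_ LD wD] [_ LG wG] i.
have := fundamental_lemma oO fO (L2B mO (LD i) (LG i)).
move=> h; have : {ae leb R n, forall x, O x -> Df x ord0 i - Dg x ord0 i = 0}.
  apply: h => phi tphi; under eq_Rintegral do rewrite mulrBl.
  have Lphi := test_fun_L2 oO fO tphi.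
  rewrite RintegralB//; try exact: L2_mul_integrable.
  have := wD _ tphi i; rewrite (wG _ tphi i) => /oppr_inj ->.
  by rewrite subrr.
by apply: filterS => x h' Ox; apply/eqP; rewrite -subr_eq0 h'.
Qed.

Lemma H1D f Df g Dg : H1 O f Df -> H1 O g Dg ->
  H1 O (fun x => f x + g x) (fun x => Df x + Dg x).
Proof.
move=> [Lf LDf wf] [Lg LDg wg]; split; first exact: L2D.
  by move=> i; under eq_fun do rewrite mxE; exact: L2D.
move=> phi tphi i; have Lphi := test_fun_L2 oO fO tphi; have LD := L2_partial i tphi.
under eq_Rintegral do rewrite mulrDl; under [in RHS]eq_Rintegral do rewrite mxE mulrDl.
rewrite !RintegralD//; try exact: L2_mul_integrable.
by rewrite wf// wg// opprD.
Qed.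

Lemma H1Z (c : R) f Df : H1 O f Df -> H1 O (fun x => c * f x) (fun x => c *: Df x).
Proof.
move=> [Lf LDf wf]; split; first exact: L2Z.
  by move=> i; under eq_fun do rewrite mxE; exact: L2Z.
move=> phi tphi i; have Lphi := test_fun_L2 oO fO tphi; have LD := L2_partial i tphi.
under eq_Rintegral do rewrite -mulrA; under [in RHS]eq_Rintegral do rewrite mxE -mulrA.
rewrite !RintegralZl//; try exact: L2_mul_integrable.
by rewrite wf// mulrN.
Qed.

Lemma H1_cst (c : R) : H1 O (fun=> c) (fun=> 0).
Proof.
have Lc : L2 O (fun=> c) by apply: (@L2_bounded _ _ _ mO fO `|c|).
have gE : grad (fun _ : 'rV[R]_n => c) = fun=> 0.
  by apply/funext => x; apply/rowP => i; rewrite !mxE partial_cst.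
split => //; first by move=> i; under eq_fun do rewrite mxE; exact: L20.
rewrite -gE; apply: (weak_grad_classical oO fO (M := `|c|)) => //.
- by move=> i x _; rewrite partial_cst normr0.
- by move=> i; rewrite (_ : partial i _ = cst 0)//; apply/funext => x; rewrite partial_cst.
Qed.

(** H^1 with an almost-everywhere bound: the algebra in which the product and
    chain rules take place. *)
Definition H1b f Df := H1 O f Df /\
  exists M, {ae leb R n, forall x, O x -> `|f x| <= M}.

Lemma H1bD f Df g Dg : H1b f Df -> H1b g Dg ->
  H1b (fun x => f x + g x) (fun x => Df x + Dg x).
Proof.
move=> [Hf [M fM]] [Hg [N gN]]; split; first exact: H1D.
exists (M + N); apply: filterS2 fM gN => x hf hg Ox.
by rewrite (le_trans (ler_normD _ _))// lerD ?hf ?hg.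
Qed.

Lemma H1b_cst (c : R) : H1b (fun=> c) (fun=> 0).
Proof. by split; [exact: H1_cst|exists `|c|; exact: aeW]. Qed.

(** For a test function phi the product g phi is in H^1_0, so the weak
    derivative of f may be moved onto it. *)
Lemma H1bM f Df g Dg : H1b f Df -> H1b g Dg ->
  H1b (fun x => f x * g x) (mulgrad f Df g Dg).
Proof.
move=> [Hf [M fM]] [Hg [N gN]]; have [Lf LDf wf] := Hf; have [Lg LDg wg] := Hg.
have LfDg i : L2 O (fun x => f x * Dg x ord0 i) by exact: (L2_ae_bounded_mul mO Lf.1 fM (LDg i)).
have LgDf i : L2 O (fun x => g x * Df x ord0 i) by exact: (L2_ae_bounded_mul mO Lg.1 gN (LDf i)).
have Lfg : L2 O (fun x => f x * g x) by exact: (L2_ae_bounded_mul mO Lf.1 fM Lg).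
have DE i x : mulgrad f Df g Dg x ord0 i = f x * Dg x ord0 i + g x * Df x ord0 i.
  by rewrite !mxE.
split; last first.
  exists (M * N); apply: filterS2 fM gN => x hf hg Ox.
  by rewrite normrM ler_pM ?hf ?hg.
split => //; first by move=> i; under eq_fun do rewrite DE; exact: L2D.
move=> phi tphi i; have Lphi := test_fun_L2 oO fO tphi; have LD := L2_partial i tphi.
have Hgphi := H10_mul_test oO fO Hg tphi.
have := weak_grad_H10 i Hf Hgphi.
rewrite (@eq_Rintegral _ _ _ _ _ (fun x => f x * g x * partial i phi x +
    (f x * Dg x ord0 i) * phi x)); last by move=> x _; rewrite !mxE; ring.
rewrite RintegralD//; try exact: L2_mul_integrable.
move/eqP; rewrite eq_sym -subr_eq => /eqP <-.
rewrite [in RHS](@eq_Rintegral _ _ _ _ _ (fun x => Df x ord0 i * (g x * phi x) +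
  (f x * Dg x ord0 i) * phi x)); last by move=> x _; rewrite DE; ring.
rewrite RintegralD//; first by rewrite opprD.
- by apply: L2_mul_integrable => //; exact: L2_mul_test.
- exact: L2_mul_integrable.
Qed.

Lemma H1b_eq f f' Df Df' : f =1 f' -> Df =1 Df' -> H1b f Df -> H1b f' Df'.
Proof. by move=> /funext -> /funext ->. Qed.

Lemma H1b_sum (I : eqType) (s : seq I) (F : I -> 'rV[R]_n -> R)
    (DF : I -> 'rV[R]_n -> 'rV[R]_n) : (forall k, k \in s -> H1b (F k) (DF k)) ->
  H1b (fun x => \sum_(k <- s) F k x) (fun x => \sum_(k <- s) DF k x).
Proof.
elim: s => [|k s IH] HF.
  by apply: H1b_eq (H1b_cst 0) => x; rewrite big_nil.
apply: (@H1b_eq (fun x => F k x + \sum_(k <- s) F k x) _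
  (fun x => DF k x + \sum_(k <- s) DF k x)); try by move=> x; rewrite big_cons.
apply: H1bD; first by apply: HF; rewrite mem_head.
by apply: IH => j js; apply: HF; rewrite in_cons js orbT.
Qed.

Lemma H1b_poly (p : {poly R}) f Df : H1b f Df ->
  H1b (fun x => p.[f x]) (fun x => p^`().[f x] *: Df x).
Proof.
move=> Hf; elim/poly_ind: p => [|p c IH].
  by apply: H1b_eq (H1b_cst 0) => x; rewrite ?deriv0 horner0 ?scale0r.
apply: H1b_eq (H1bD (H1bM IH Hf) (H1b_cst c)) => x.
  by rewrite hornerMXaddC.
by rewrite derivMXaddC hornerD hornerMX /mulgrad scalerDl scalerA addr0 [f x * _]mulrC.
Qed.

(** Both sides of the identity defining weak gradients are continuous in mean
    square. *)
Lemma H1_closed f Df : L2 O f -> (forall i, L2 O (fun x => Df x ord0 i)) ->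
  (forall e : R, 0 < e -> exists g Dg, [/\ H1 O g Dg,
    sqn O (fun x => f x - g x) <= e &
    forall i, sqn O (fun x => Df x ord0 i - Dg x ord0 i) <= e]) ->
  H1 O f Df.
Proof.
move=> Lf LDf app; split => // phi tphi i.
have Lphi := test_fun_L2 oO fO tphi; have LD := L2_partial i tphi.
apply/eqP; rewrite -subr_eq0 opprK -normr_le0; apply/ler_addgt0Pl => eta eta0.
rewrite addr0.
pose A := sqn O phi + sqn O (partial i phi).
have A0 : 0 <= A by rewrite addr_ge0 ?sqn_ge0.
have A1 : 0 < A + 1 by rewrite ltr_wpDl.
pose d := eta / (2 * (A + 1)).
have d0 : 0 < d by apply: divr_gt0 => //; exact: mulr_gt0.
pose e := d * eta / 4.
have e0 : 0 < e by apply: divr_gt0 => //; exact: mulr_gt0.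
have [g [Dg [[Lg LDg wg] sf sD]]] := app _ e0.
have L1 := L2B mO Lf Lg; have L2' := L2B mO (LDf i) (LDg i).
have -> : \int[leb R n]_(x in O) (f x * partial i phi x) +
    \int[leb R n]_(x in O) (Df x ord0 i * phi x) =
    \int[leb R n]_(x in O) (partial i phi x * (f x - g x)) +
    \int[leb R n]_(x in O) (phi x * (Df x ord0 i - Dg x ord0 i)).
  under [X in _ = X + _]eq_Rintegral do rewrite mulrC mulrBl.
  under [X in _ = _ + X]eq_Rintegral do rewrite mulrC mulrBl.
  rewrite !RintegralB//; try exact: L2_mul_integrable.
  by rewrite wg// opprK; ring.
apply: le_trans (ler_normD _ _) _.
have h1 := normr_integral_mul_le mO d0 LD L1; have h2 := normr_integral_mul_le mO d0 Lphi L2'.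
have dV0 : 0 <= d^-1 by rewrite invr_ge0 ltW.
have h3 := ler_wpM2l dV0 sf; have h4 := ler_wpM2l dV0 (sD i).
have h5 : d^-1 * e = eta / 4 by rewrite /e -mulrA mulKf ?gt_eqF.
have h6 : d * A <= eta / 2.
  rewrite /d mulrAC ler_pdivrMr ?mulr_gt0//.
  rewrite [leRHS](_ : _ = eta * (A + 1)); last by field.
  by rewrite ler_wpM2l ?(ltW eta0)// lerDl.
move: h1 h2 h3 h4 h5 h6; rewrite /A mulrDr; lra.
Qed.

(** Partial sums of the logarithmic series centred at b2. *)
Definition ln_poly (b2 : R) m : {poly R} :=
  (ln b2)%:P - \sum_(j < m) (j.+1%:R^-1 : R) *: (1 - b2^-1 *: 'X) ^+ j.+1.

Lemma horner_lnfactor (b2 x : R) : (1 - b2^-1 *: 'X : {poly R}).[x] = 1 - x / b2.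
Proof. by rewrite hornerD hornerN hornerZ hornerX hornerC mulrC. Qed.

(** The derivative is a geometric sum in 1 - x / b2. *)
Lemma deriv_ln_poly (b2 x : R) m : b2 != 0 ->
  x * (ln_poly b2 m)^`().[x] = 1 - (1 - x / b2) ^+ m.
Proof.
move=> b20.
have -> : (ln_poly b2 m)^`() = \sum_(j < m) b2^-1 *: (1 - b2^-1 *: 'X) ^+ j.
  rewrite /ln_poly derivB derivC sub0r raddf_sum /= -sumrN; apply: eq_bigr => j _.
  rewrite derivZ deriv_exp derivB derivZ derivX derivC sub0r /=.
  rewrite mulNr mulr_algl mulNrn scalerN opprK -[_ *: _ *+ _]scaler_nat.
  by rewrite !scalerA mulKf// pnatr_eq0.
rewrite horner_sum mulr_sumr.
under eq_bigr do rewrite hornerZ horner_exp horner_lnfactor mulrA.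
rewrite -mulr_sumr.
by rewrite -[RHS]opprB (subrX1 (1 - x / b2)); ring.
Qed.

Lemma ln_poly_b2 (b2 : R) m : b2 != 0 -> (ln_poly b2 m).[b2] = ln b2.
Proof.
move=> b20; rewrite /ln_poly hornerD hornerC hornerN horner_sum big1 ?oppr0 ?addr0// => j _.
by rewrite hornerZ horner_exp horner_lnfactor divff// subrr exprS mul0r mulr0.
Qed.

Lemma deriv_ln_poly_approx (b1 b2 x : R) m : 0 < b1 -> b1 <= x <= b2 ->
  `|x^-1 - (ln_poly b2 m)^`().[x]| <= (1 - b1 / b2) ^+ m / b1.
Proof.
move=> b10 /andP[b1x xb2]; have x0 := lt_le_trans b10 b1x.
have b20 := lt_le_trans x0 xb2.
have -> : x^-1 - (ln_poly b2 m)^`().[x] = (1 - x / b2) ^+ m / x.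
  apply: (mulfI (lt0r_neq0 x0)); rewrite mulrBr deriv_ln_poly ?gt_eqF// divff ?gt_eqF//.
  by rewrite subKr mulrCA divff ?mulr1// gt_eqF.
have r0 : 0 <= 1 - x / b2 by rewrite subr_ge0 ler_pdivrMr// mul1r.
rewrite ger0_norm ?divr_ge0 ?exprn_ge0 ?(ltW x0)//.
rewrite ler_pM ?exprn_ge0 ?invr_ge0 ?(ltW x0)//; last by rewrite lef_pV2.
rewrite lerXn2r ?nnegrE//; last by rewrite lerD2l lerN2 ler_pM2r ?invr_gt0.
by rewrite subr_ge0 ler_pdivrMr// mul1r (le_trans b1x).
Qed.

(** Both functions agree at b2, so the estimate of the derivatives between x and
    b2 integrates. *)
Lemma ln_poly_approx (b1 b2 x : R) m : 0 < b1 -> b1 <= x <= b2 ->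
  `|ln x - (ln_poly b2 m).[x]| <= (1 - b1 / b2) ^+ m / b1 * b2.
Proof.
move=> b10 bx; have /andP[b1x xb2] := bx; have x0 := lt_le_trans b10 b1x.
have b20 := lt_le_trans x0 xb2.
pose h y := ln y - (ln_poly b2 m).[y].
pose dh y := y^-1 - (ln_poly b2 m)^`().[y].
have dhE (y : R) : 0 < y -> is_derive y 1 h (dh y).
  by move=> y0; exact: (is_deriveB (is_derive1_ln y0) (is_derive_poly _ _)).
have d0 : 0 <= (1 - b1 / b2) ^+ m / b1.
  by rewrite divr_ge0 ?(ltW b10)// exprn_ge0// subr_ge0 ler_pdivrMr// mul1r (le_trans b1x).
have [||c cx hE] := @MVT_segment R h dh x b2 xb2.
- by move=> y; rewrite in_itv => /andP[xy _]; exact: dhE (lt_trans x0 xy).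
- apply: derivable_within_continuous => y; rewrite in_itv => /andP[xy _].
  by have [] := dhE y (lt_le_trans x0 xy).
have hb2 : h b2 = 0 by rewrite /h ln_poly_b2 ?gt_eqF// subrr.
rewrite -[X in `|X|]/(h x) -normrN -sub0r -hb2 hE normrM ler_pM//.
  apply: deriv_ln_poly_approx => //; move: cx; rewrite in_itv /= => /andP[xc cb].
  by rewrite (le_trans b1x xc).
by rewrite ger0_norm ?subr_ge0// gerBl ltW.
Qed.

(** Writing 1 / f as f (f^2)^(-1) reduces inversion to a real power of a
    nonnegative base. *)
Lemma measurable_funV (D : set 'rV[R]_n) f : measurable_fun D f ->
  measurable_fun D (fun x => (f x)^-1).
Proof.
move=> mf; rewrite (_ : (fun x => _) = fun x => f x * (f x ^+ 2) `^ (-1)).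
  apply: measurable_funM; first exact: mf.
  exact: (measurableT_comp (@measurable_powR R (-1)) (measurable_funX 2 mf)).
apply/funext => x; rewrite powR_inv1 ?sqr_ge0//.
have [->|fx] := eqVneq (f x) 0; first by rewrite invr0 mul0r.
by rewrite expr2 invfM mulrA divff ?mul1r.
Qed.

(** On [b1, b2] the logarithm and its derivative are uniform limits of
    polynomials and of their derivatives, so the chain rule for polynomials
    passes to the limit. *)
Lemma H1b_ln (b1 b2 : R) f Df : 0 < b1 -> b1 <= b2 ->
  {ae leb R n, forall x, O x -> b1 <= f x <= b2} -> H1 O f Df ->
  H1b (fun x => ln (f x)) (fun x => (f x)^-1 *: Df x).
Proof.
move=> b10 b12 bf Hf; have [Lf LDf wf] := Hf.
have b20 := lt_le_trans b10 b12.
have Hfb : H1b f Df.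
  split => //; exists b2; apply: filterS bf => x h Ox; have /andP[h1 h2] := h Ox.
  by rewrite ger0_norm// (le_trans (ltW b10)).
have lnM : {ae leb R n, forall x, O x -> `|ln (f x)| <= `|ln b1| + `|ln b2|}.
  apply: filterS bf => x h Ox; have /andP[h1 h2] := h Ox.
  have f0 := lt_le_trans b10 h1.
  have l1 : ln b1 <= ln (f x) by rewrite ler_ln ?posrE.
  have l2 : ln (f x) <= ln b2 by rewrite ler_ln ?posrE.
  rewrite ler_norml; have := ler_norm (ln b2); have := ler_norm (- ln b1).
  have := normr_ge0 (ln b1); have := normr_ge0 (ln b2); rewrite normrN; lra.
have mln : measurable_fun O (fun x => ln (f x)).
  exact: (measurableT_comp (@measurable_ln R) Lf.1).
have minv := measurable_funV Lf.1.
have Lln : L2 O (fun x => ln (f x)) by exact: L2_ae_bounded lnM.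
have invM : {ae leb R n, forall x, O x -> `|(f x)^-1| <= b1^-1}.
  apply: filterS bf => x h Ox; have /andP[h1 h2] := h Ox.
  have f0 := lt_le_trans b10 h1.
  by rewrite ger0_norm ?invr_ge0 ?(ltW f0)// lef_pV2.
have LD i : L2 O (fun x => ((f x)^-1 *: Df x) ord0 i).
  by under eq_fun do rewrite mxE; exact: (L2_ae_bounded_mul mO minv invM (LDf i)).
split; last by exists (`|ln b1| + `|ln b2|).
apply: H1_closed => // e e0.
pose V := fine (leb R n O); have V0 : 0 <= V by rewrite fine_ge0.
pose A := b2 ^+ 2 * V + \sum_i sqn O (fun x => Df x ord0 i).
have S0 : 0 <= \sum_i sqn O (fun x => Df x ord0 i) by apply: sumr_ge0 => i _; exact: sqn_ge0.
have B0 : 0 <= b2 ^+ 2 * V by rewrite mulr_ge0 ?exprn_ge0 ?(ltW b20).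
have A0 : 0 <= A by exact: addr_ge0.
pose rho := 1 - b1 / b2.
have rho0 : 0 <= rho by rewrite subr_ge0 ler_pdivrMr// mul1r.
have rho1 : rho < 1 by rewrite ltrBlDr ltrDl divr_gt0.
have [m mA] : exists m, (rho ^+ m / b1) ^+ 2 * (A + 1) <= e.
  have : rho ^+ m @[m --> \oo] --> (0 : R) by apply: cvg_expr; rewrite ger0_norm.
  have A1 : 0 < A + 1 by rewrite ltr_wpDl.
  pose c := Num.min 1 (e / (A + 1)).
  have c0 : 0 < c by rewrite lt_min ltr01 divr_gt0.
  move=> /cvgr0Pnorm_lt /(_ _ (mulr_gt0 b10 c0))[m _ /(_ m (leqnn m))].
  rewrite /= ger0_norm ?exprn_ge0// => rm; exists m.
  have rc : rho ^+ m / b1 <= c by rewrite ler_pdivrMr// mulrC ltW.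
  have r0 : 0 <= rho ^+ m / b1 by rewrite divr_ge0 ?exprn_ge0 ?(ltW b10).
  rewrite -ler_pdivlMr// expr2 -[leRHS]mul1r ler_pM// (le_trans rc)// /c.
    by rewrite ge_min lexx.
  by rewrite ge_min lexx orbT.
pose d := rho ^+ m / b1; have d0 : 0 <= d by rewrite divr_ge0 ?exprn_ge0 ?(ltW b10).
have [[Lp LDp wp] _] := H1b_poly (ln_poly b2 m) Hfb.
exists (fun x => (ln_poly b2 m).[f x]), (fun x => (ln_poly b2 m)^`().[f x] *: Df x).
have dA c : 0 <= c -> c <= A -> d ^+ 2 * c <= e.
  move=> c0 cA; apply: le_trans mA; rewrite -/d ler_wpM2l ?sqr_ge0//.
  by rewrite (le_trans cA)// lerDl.
split => // [|i].
- have Lc : L2 O (fun=> d * b2) by apply: (@L2_bounded _ _ _ mO fO `|d * b2|).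
  apply: (@le_trans _ _ (sqn O (fun=> d * b2))).
    apply: le_sqn_ae => //; first exact: L2B.
    apply: filterS bf => x h Ox.
    by rewrite [leRHS](ger0_norm (mulr_ge0 d0 (ltW b20))); exact: (ln_poly_approx m b10 (h Ox)).
  rewrite /sqn Rintegral_cst// -/V exprMn -mulrA; apply: dA => //.
  by rewrite /A lerDl.
- apply: (@le_trans _ _ (sqn O (fun x => d * Df x ord0 i))).
    apply: le_sqn_ae => //; [exact: L2B|exact: L2Z|].
    apply: filterS bf => x h Ox; rewrite !mxE -mulrBl !(normrM _ (Df x ord0 i)).
    by rewrite ler_wpM2r// (ger0_norm d0); exact: (deriv_ln_poly_approx m b10 (h Ox)).
  rewrite sqnZ//; apply: dA; first exact: sqn_ge0.
  rewrite /A (bigD1 i)//= addrCA lerDl addr_ge0// sumr_ge0// => j _; exact: sqn_ge0.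
Qed.

(** Poincare's inequality comes from integrating the i-th derivative of
    x_i phi^2, which gives int phi^2 = - 2 int x_i phi (d_i phi). *)
Lemma poincare_test (B : R) phi i : O `<=` ball 0 B -> test_fun O phi ->
  sqn O phi <= 16 * B ^+ 2 * sqn O (partial i phi).
Proof.
move=> OB tphi; have sphi := test_fun_smooth tphi; have dphi := smooth_differentiable sphi.
have sx := @smooth_coord R n i; have dx := smooth_differentiable sx.
have txp := test_funM tphi sx.
have [M M0 pM] := test_fun_bounded txp.
have [N N0 pN] := test_fun_partial_bounded txp.
have Lphi := test_fun_L2 oO fO tphi; have LD := L2_partial i tphi.
have xB x : O x -> `|x ord0 i| <= `|B|.
  move=> /OB; rewrite ballE /= sub0r normrN => xB.
  by rewrite (le_trans (normr_coord_le _ _))// (le_trans (ltW xB))// ler_norm.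
have mx : measurable_fun O (fun x : 'rV[R]_n => x ord0 i) by exact: measurable_smooth.
have LxD : L2 O (fun x => x ord0 i * partial i phi x) by exact: L2_bounded_mul xB LD.
have c1 x : O x -> differentiable (fun x => phi x * x ord0 i) x.
  by move=> _; exact: differentiableM.
have c2 x : O x -> `|phi x * x ord0 i| <= M + N by move=> _; rewrite (le_trans (pM x))// lerDl.
have c3 x : O x -> `|partial i (fun x => phi x * x ord0 i) x| <= M + N.
  by move=> _; rewrite (le_trans (pN i x))// lerDr.
have h : sqn O phi + 2 * \int[leb R n]_(x in O) (phi x * (x ord0 i * partial i phi x)) = 0.
  rewrite -(integral_partial_mul_eq0 tphi c1 c2 c3).
  rewrite [RHS](@eq_Rintegral _ _ _ _ _ (fun x => phi x ^+ 2 +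
     2 * (phi x * (x ord0 i * partial i phi x)))); last first.
    move=> x _; rewrite (partialM i (dphi x) (dx x)) partial_coord eqxx /=.
    by rewrite mulr1n; ring.
  rewrite RintegralD//; [|exact: Lphi.2|by apply: intgZ => //; exact: L2_mul_integrable].
  by rewrite RintegralZl//; exact: L2_mul_integrable.
(* With weight 1/4 half of the integral of phi^2 is absorbed on the left; the
   remaining terms give 16 B^2. *)
have d40 : (0 : R) < 4^-1 by rewrite invr_gt0.
have := normr_integral_mul_le mO d40 Lphi LxD; rewrite invrK => h1.
have h2 : sqn O (fun x => x ord0 i * partial i phi x) <= B ^+ 2 * sqn O (partial i phi).
  rewrite -sqnZ//; apply: le_sqn => //; first exact: L2Z.
  by move=> x Ox; rewrite !normrM ler_wpM2r// xB.
have := ler_norm (- \int[leb R n]_(x in O) (phi x * (x ord0 i * partial i phi x))).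
rewrite normrN; move: h h1 h2; lra.
Qed.

(** Poincare's inequality in one direction, for the test functions that
    approximate v: a single vanishing partial derivative suffices. *)
Lemma H10_grad0 (B : R) v Dv i : O `<=` ball 0 B -> H10 O v Dv ->
  {ae leb R n, forall x, O x -> Dv x ord0 i = 0} ->
  {ae leb R n, forall x, O x -> v x = 0}.
Proof.
move=> OB Hv D0; have [Lv LDv _] := H10_H1 Hv; apply: sqn_eq0 => //.
apply/eqP; rewrite eq_le sqn_ge0 andbT; apply/ler_addgt0Pl => e e0; rewrite addr0.
have sD0 := sqn_ae0 (LDv i) D0.
pose C := 2 + 64 * B ^+ 2.
have C0 : 0 < C by rewrite /C; have := sqr_ge0 B; lra.
have [phi [tphi sv sD]] := H10_approx Hv (divr_gt0 e0 C0).
have Lphi := test_fun_L2 oO fO tphi; have LD := L2_partial i tphi.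
have L1 := L2B mO Lv Lphi; have L2' := L2B mO (LDv i) LD.
have h1 := sqnD_le mO L1 Lphi.
rewrite (_ : (fun x => v x - phi x + phi x) = v) in h1; last by apply/funext => x; rewrite subrK.
have h2 := poincare_test i OB tphi.
have h3 := sqnD_le mO (LDv i) (L2Z mO (-1) L2').
rewrite (_ : (fun x => Dv x ord0 i + -1 * (Dv x ord0 i - partial i phi x)) = partial i phi) in h3;
  last by apply/funext => x; ring.
rewrite sD0 (sqnZ mO (-1) L2') sqrrN expr1n mul1r mulr0 add0r in h3.
have h4 := ler_wpM2l (sqr_ge0 B) h3; have h5 := ler_wpM2l (sqr_ge0 B) (ltW (sD i)).
have : C * (e / C) = e by rewrite mulrC divfK ?gt_eqF.
move: (e / C) sv h5 => q sv h5; rewrite /C => h6.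
by move: h1 h2 h4 h5 h6 sv; lra.
Qed.

End sobolev.

(** * The Helmholtz equation tested with products *)

Section dot_theory.
Context {R : realType} {n : nat}.
Implicit Types (x y z : 'rV[R]_n).

Lemma dotDl x y z : dot (x + y) z = dot x z + dot y z.
Proof. by rewrite /dot -big_split; apply: eq_bigr => i _; rewrite mxE mulrDl. Qed.

Lemma dotZl (c : R) x z : dot (c *: x) z = c * dot x z.
Proof. by rewrite /dot mulr_sumr; apply: eq_bigr => i _; rewrite mxE mulrA. Qed.

Lemma dotC x y : dot x y = dot y x.
Proof. by apply: eq_bigr => i _; rewrite mulrC. Qed.

(** The sharp constant is the square root of n; n + 1 is positive in every
    dimension and needs no root. *)
Lemma enorm_le x : enorm x <= n.+1%:R * `|x|.
Proof.
rewrite -[leRHS]ger0_norm ?mulr_ge0// -sqrtr_sqr ler_sqrt ?sqr_ge0//.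
rewrite exprMn; apply: (@le_trans _ _ (n.+1%:R * `|x| ^+ 2)); last first.
  by rewrite ler_wpM2r ?sqr_ge0// expr2 ler_peMr// ler1n.
rewrite (@le_trans _ _ (\sum_(i < n) `|x| ^+ 2))//.
  apply: ler_sum => i _; rewrite -expr2 -real_normK ?num_real//.
  by rewrite lerXn2r ?nnegrE// normr_coord_le.
by rewrite sumr_const card_ord -[_ *+ n]mulr_natl ler_wpM2r ?sqr_ge0 ?ler_nat.
Qed.

End dot_theory.

Section regularity.
Context {R : realType} {n : nat}.
Implicit Types (O : set 'rV[R]_n).

Lemma within_closure_continuous (T : topologicalType) O (f : 'rV[R]_n -> T) x : open O ->
  {within closure O, continuous f} -> O x -> {for x, continuous f}.
Proof.
move=> oO cf Ox.
have : {within O, continuous f}.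
  by apply: continuous_subspaceW cf; exact: subset_closure.
by rewrite continuous_open_subspace//; apply; rewrite inE.
Qed.

Lemma within_closure_bounded O (f : 'rV[R]_n -> R) : bounded_set O ->
  {within closure O, continuous f} -> exists M, forall x, O x -> `|f x| <= M.
Proof.
move=> bO cf; have [B B0 OB] := bounded_ball0 bO.
have cO : compact (closure O).
  apply: (subclosed_compact _ (@compact_closed_ball_rV R n 0 B)); first exact: closed_closure.
  rewrite closureE; apply: smallest_sub.
    by apply: closed_compact_rV; exact: compact_closed_ball_rV.
  by move=> x /OB; rewrite ballE /= => /ltW.
have [M [_ /(_ (`|M| + 1)) fM]] := compact_bounded (continuous_compact cf cO).
exists (`|M| + 1) => x Ox; apply: fM; first by rewrite (le_lt_trans (ler_norm _))// ltrDl.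
by exists x => //; exact: subset_closure.
Qed.

Lemma C1_closure_regular O (u : 'rV[R]_n -> R) : open O -> bounded_set O -> C1_closure O u ->
  (forall x, O x -> differentiable u x) /\
  exists M, [/\ forall x, O x -> `|u x| <= M, forall i x, O x -> `|partial i u x| <= M &
    forall i, measurable_fun O (partial i u)].
Proof.
move=> oO bO [g [cu cg ug]]; split; first by move=> x /ug[].
have cgi i : {within closure O, continuous (fun x => g x ord0 i)}.
  move=> x; exact: (cvg_comp _ _ (cg x) (@coord_continuous R 1 n ord0 i (g x))).
have pE i x : O x -> partial i u x = g x ord0 i by move=> /ug[_ <-]; rewrite mxE.
have [M uM] := within_closure_bounded bO cu.
have /boolp.choice[N gN] i := within_closure_bounded bO (cgi i).
pose S := `|M| + \sum_i `|N i|.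
exists S; split => [x Ox|i x Ox|i].
- rewrite (le_trans (uM x Ox))// /S (le_trans (ler_norm M))// lerDl.
  by apply: sumr_ge0.
- rewrite pE// (le_trans (gN i x Ox))// (le_trans (ler_norm _))// /S (bigD1 i)//=.
  by rewrite addrCA lerDl addr_ge0// sumr_ge0.
- apply: (@eq_measurable_fun _ _ _ _ _ (fun x => g x ord0 i)).
    by move=> x /set_mem Ox; rewrite pE.
  by apply: measurable_fun_continuous_rV => // x Ox; exact: within_closure_continuous (cgi i) Ox.
Qed.

Lemma holder_measurable (al : R) O (a : 'rV[R]_n -> R) : 0 < al -> open O ->
  C0_holder al O a -> measurable_fun O a.
Proof.
move=> al0 oO [C aC]; apply: measurable_fun_continuous_rV => // x Ox.
apply/(@cvgrPdist_le _ _ _ (nbhs x) (nbhs_filter x)) => e e0.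
have C0 : 0 < `|C| + 1 by rewrite ltr_wpDl.
pose d := (e / (`|C| + 1)) `^ al^-1.
have d0 : 0 < d by rewrite powR_gt0// divr_gt0.
have N0 : 0 < n.+1%:R :> R by [].
near=> y.
have Oy : O y by near: y; exact: open_nbhs_nbhs.
have xy : `|x - y| <= d / n.+1%:R.
  by near: y; apply: cvgr_dist_le => //; rewrite divr_gt0.
have exy : enorm (x - y) <= d.
  by rewrite (le_trans (enorm_le _))// mulrC -ler_pdivlMr.
apply: le_trans (aC x y (subset_closure Ox) (subset_closure Oy)) _.
apply: (@le_trans _ _ ((`|C| + 1) * enorm (x - y) `^ al)).
  by rewrite ler_wpM2r ?powR_ge0// (le_trans (ler_norm C))// lerDl.
rewrite mulrC -ler_pdivlMr//.
have -> : e / (`|C| + 1) = d `^ al.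
  by rewrite /d -powRrM mulVf ?gt_eqF// powRr1// divr_ge0 ?(ltW e0)// ltW.
by rewrite ge0_ler_powR ?nnegrE ?sqrtr_ge0 ?(ltW al0)// ltW.
Unshelve. all: by end_near. Qed.

Lemma Rintegral_sub_dom O U (f : 'rV[R]_n -> R) : measurable O -> measurable U ->
  U `<=` O -> (forall x, ~ U x -> f x = 0) ->
  \int[leb R n]_(x in O) f x = \int[leb R n]_(x in U) f x.
Proof.
move=> mO mU UO f0; rewrite Rintegral_mkcond [RHS]Rintegral_mkcond.
apply: eq_Rintegral => x _; rewrite !patchE.
have [Ux|nUx] := pselect (U x).
  by rewrite (mem_set Ux) (mem_set (UO _ Ux)).
by rewrite f0// if_same if_same.
Qed.

Lemma L2S O U (f : 'rV[R]_n -> R) : measurable O -> measurable U -> U `<=` O ->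
  L2 O f -> L2 U f.
Proof.
move=> mO mU UO [mf f2]; split; first exact: measurable_funS mf.
exact: integrableS f2.
Qed.

Lemma test_fun_off O (phi : 'rV[R]_n -> R) x : test_fun O phi -> ~ O x -> phi x = 0.
Proof.
by move=> tphi nOx; have [K [_ KO p0]] := test_fun_support tphi; apply: p0 => /KO.
Qed.

Lemma H1S O U (f : 'rV[R]_n -> R) Df : open O -> open U -> U `<=` O ->
  H1 O f Df -> H1 U f Df.
Proof.
move=> oO oU UO [Lf LDf wf].
have mO := open_measurable_rV oO; have mU := open_measurable_rV oU.
split; [exact: L2S Lf|by move=> i; exact: L2S (LDf i)|].
move=> phi tphi i; have := wf _ (test_funS UO tphi) i.
rewrite (Rintegral_sub_dom mO mU UO) => [->|x nx]; last first.
  by rewrite (test_fun_off (test_fun_partial i tphi) nx) mulr0.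
congr (- _); apply: Rintegral_sub_dom => // x nx.
by rewrite (test_fun_off tphi nx) mulr0.
Qed.

Lemma ae_forall_coord (P : 'I_n -> 'rV[R]_n -> Prop) (U : set 'rV[R]_n) :
  (forall i, {ae leb R n, forall x, U x -> P i x}) ->
  {ae leb R n, forall x, U x -> forall i, P i x}.
Proof.
move=> h; have : {ae leb R n, forall x, forall i, U x -> P i x} by exact: filter_forall.
by apply: filterS => x h' Ux i; exact: h'.
Qed.

Lemma measurable_dot O (f g : 'rV[R]_n -> 'rV[R]_n) :
  (forall i, measurable_fun O (fun x => f x ord0 i)) ->
  (forall i, measurable_fun O (fun x => g x ord0 i)) ->
  measurable_fun O (fun x => dot (f x) (g x)).
Proof. by move=> mf mg; apply: measurable_sum => i; exact: measurable_funM. Qed.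

End regularity.

Section helmholtz_products.
Context {R : realType} {n : nat}.
Variables (O U : set 'rV[R]_n).
Hypotheses (oO : open O) (fO : (leb R n O < +oo)%E) (oU : open U) (UO : U `<=` O).
Variables (a q u : 'rV[R]_n -> R) (k : R) (Du : 'rV[R]_n -> 'rV[R]_n) (A Q M : R).
Hypotheses (ma : measurable_fun O a) (aA : forall x, O x -> `|a x| <= A).
Hypotheses (mq : measurable_fun O q) (qQ : {ae leb R n, forall x, O x -> `|q x| <= Q}).
Hypotheses (du : forall x, O x -> differentiable u x)
  (uM : forall x, O x -> `|u x| <= M)
  (duM : forall i x, O x -> `|partial i u x| <= M)
  (mdu : forall i, measurable_fun O (partial i u)).
Hypothesis HuD : H1 O u Du.
Hypothesis helm : forall v Dv, H10 O v Dv ->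
  \int[leb R n]_(x in O) (a x * dot (Du x) (Dv x) - k * q x * u x * v x) = 0.

(** The weak gradient given with the solution may be replaced by the classical
    one, in terms of which the energies are defined. *)
Lemma H1_classical : H1 O u (grad u).
Proof.
have [Lu _ _] := HuD; split => //.
  move=> i; under eq_fun do rewrite mxE.
  exact: (L2_bounded (open_measurable_rV oO) fO (mdu i) (duM i)).
exact: weak_grad_classical uM duM mdu.
Qed.

Let mO := open_measurable_rV oO.
Let mU := open_measurable_rV oU.
Let mu0 : measurable_fun O u. Proof. by have [[]] := HuD. Qed.
Let mg i : measurable_fun O (fun x => grad u x ord0 i).
Proof. under eq_fun do rewrite mxE; exact: mdu. Qed.

(** E - k e, for the two energies of u. *)
Definition helm_density x := a x * dot (grad u x) (grad u x) - k * (q x * u x * u x).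
(** Half of a grad (u^2). *)
Definition helm_flux x : 'rV[R]_n := (a x * u x) *: grad u x.

Lemma fU : (leb R n U < +oo)%E.
Proof. by apply: le_lt_trans fO; apply: le_measure => //; rewrite inE. Qed.

Lemma L2_helm_density : L2 U helm_density.
Proof.
apply: (L2S mO) => //.
apply: (@L2_ae_bounded _ _ _ mO fO (`|A| * (\sum_(i < n) M * M) + `|k| * (`|Q| * M * M))).
  apply: measurable_funB; first by apply: measurable_funM => //; exact: measurable_dot.
  apply: measurable_funM => //; apply: measurable_funM => //; exact: measurable_funM.
apply: filterS qQ => x hq Ox; rewrite /helm_density.
rewrite (le_trans (ler_normB _ _))// !normrM lerD//.
  apply: ler_pM => //; first by rewrite (le_trans (aA Ox))// ler_norm.
  rewrite (le_trans (ler_norm_sum _ _ _))//; apply: ler_sum => i _.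
  by rewrite normrM; apply: ler_pM => //; rewrite mxE duM.
apply: ler_wpM2l => //; apply: ler_pM => //; last exact: uM.
apply: ler_pM => //; last exact: uM.
by rewrite (le_trans (hq Ox))// ler_norm.
Qed.

Lemma L2_helm_flux i : L2 U (fun x => helm_flux x ord0 i).
Proof.
apply: (L2S mO) => //.
apply: (@L2_bounded _ _ _ mO fO (A * M * M)).
  under eq_fun do rewrite !mxE.
  by apply: measurable_funM => //; exact: measurable_funM.
move=> x Ox; rewrite !mxE !normrM.
apply: ler_pM => //; last exact: duM.
by apply: ler_pM => //; [exact: aA|exact: uM].
Qed.

(** With the test function u phi, whose gradient is u grad phi + phi grad u, the
    equation for u becomes an identity between quadratic quantities. *)
Lemma helm_test phi : test_fun U phi ->
  \int[leb R n]_(x in U) (helm_density x * phi x + dot (helm_flux x) (grad phi x)) = 0.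
Proof.
move=> tphi; have tO := test_funS UO tphi.
have hv := H10_mul_test oO fO H1_classical tO.
have [Lv LDv _] := H10_H1 hv.
have DuE := ae_forall_coord (weak_grad_unique oO fO HuD H1_classical).
rewrite -(helm hv) -(Rintegral_sub_dom mO mU UO); last first.
  move=> x nx; rewrite (test_fun_off tphi nx) mulr0 add0r.
  rewrite /dot big1// => i _.
  by rewrite [grad phi x _ _]mxE (test_fun_off (test_fun_partial i tphi) nx) mulr0.
apply: Rintegral_ae_eq => //.
- apply: measurable_funD.
    apply: measurable_funM; last exact: measurable_smooth (test_fun_smooth tphi).
    apply: measurable_funB; first by apply: measurable_funM => //; exact: measurable_dot.
    by apply: measurable_funM => //; apply: measurable_funM => //; exact: measurable_funM.
  apply: measurable_dot => i; under eq_fun do rewrite !mxE.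
    by apply: measurable_funM => //; exact: measurable_funM.
  exact: (measurable_smooth mO (smooth_partial i (test_fun_smooth tphi))).
- apply: measurable_funB.
    apply: measurable_funM => //; apply: measurable_dot => i; last exact: (LDv i).1.
    by have [_ /(_ i)[]] := HuD.
  apply: measurable_funM; last exact: Lv.1.
  by apply: measurable_funM => //; exact: measurable_funM.
- apply: filterS DuE => x DuE Ox.
  have -> : Du x = grad u x by apply/rowP => i; exact: DuE.
  rewrite /helm_density /helm_flux /mulgrad dotZl [dot (grad u x) (_ + _)]dotC dotDl !dotZl.
  by rewrite [dot (grad phi x) _]dotC; ring.
Qed.

Lemma helm_pairing v Dv : H10 U v Dv ->
  \int[leb R n]_(x in U) (helm_density x * v x + dot (helm_flux x) (Dv x)) = 0.
Proof.
exact: (H10_pairing oU fU L2_helm_density L2_helm_flux helm_test).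
Qed.

End helmholtz_products.

(** * The equation for the logarithm *)

Section balance.
Context {R : realType} {n : nat}.
Variable U : set 'rV[R]_n.
Hypotheses (oU : open U) (fU : (leb R n U < +oo)%E).
Let mU := open_measurable_rV oU.
Implicit Types (F : 'rV[R]_n -> R) (W : 'rV[R]_n -> 'rV[R]_n).

(** The weak form of - div W + F = 0, with the integrability that makes it
    additive in (F, W). *)
Definition balanced F W := [/\ L2 U F, forall i, L2 U (fun x => W x ord0 i) &
  forall v Dv, H10 U v Dv ->
    \int[leb R n]_(x in U) (F x * v x + dot (W x) (Dv x)) = 0].

Lemma balanced_integrable F W v Dv : balanced F W -> H10 U v Dv ->
  (leb R n).-integrable U (fun x => (F x * v x + dot (W x) (Dv x))%:E).
Proof.
move=> [LF LW _] /H10_H1[Lv LDv _]; apply: (intgD mU).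
  exact: L2_mul_integrable.
exact: L2_dot_integrable.
Qed.

Lemma balancedD F W F' W' : balanced F W -> balanced F' W' ->
  balanced (fun x => F x + F' x) (fun x => W x + W' x).
Proof.
move=> b b'; have [LF LW h] := b; have [LF' LW' h'] := b'.
split; first exact: L2D.
  by move=> i; under eq_fun do rewrite mxE; exact: L2D.
move=> v Dv Hv; transitivity (\int[leb R n]_(x in U)
    ((F x * v x + dot (W x) (Dv x)) + (F' x * v x + dot (W' x) (Dv x)))).
  by apply: eq_Rintegral => x _; rewrite dotDl; ring.
by rewrite RintegralD ?h ?h' ?addr0//; exact: balanced_integrable.
Qed.

Lemma balanced0 : balanced (fun=> 0) (fun=> 0).
Proof.
split; first exact: L20.
  by move=> i; under eq_fun do rewrite mxE; exact: L20.
move=> v Dv _; rewrite /Rintegral integral0_eq// => x _.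
by rewrite mul0r /dot big1 ?addr0// => i _; rewrite mxE mul0r.
Qed.

Lemma balanced_sum (I : eqType) (s : seq I) (F : I -> 'rV[R]_n -> R)
    (W : I -> 'rV[R]_n -> 'rV[R]_n) : (forall k, k \in s -> balanced (F k) (W k)) ->
  balanced (fun x => \sum_(k <- s) F k x) (fun x => \sum_(k <- s) W k x).
Proof.
elim: s => [|k s IH] Fs.
  by under eq_fun do rewrite big_nil; under [X in balanced _ X]eq_fun do rewrite big_nil;
    exact: balanced0.
under eq_fun do rewrite big_cons; under [X in balanced _ X]eq_fun do rewrite big_cons.
apply: balancedD; first by apply: Fs; rewrite mem_head.
by apply: IH => j js; apply: Fs; rewrite inE js orbT.
Qed.

End balance.

Section log_equation.
Context {R : realType} {n : nat}.
Variable U : set 'rV[R]_n.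
Hypotheses (oU : open U) (fU : (leb R n U < +oo)%E).
Variables (B : R) (i0 : 'I_n).
Hypothesis UB : U `<=` ball 0 B.
Variables (a q S F : 'rV[R]_n -> R) (Dq DS W : 'rV[R]_n -> 'rV[R]_n) (A b1 b2 c : R).
Hypotheses (ma : measurable_fun U a) (aA : forall x, U x -> `|a x| <= A).
Hypotheses (b10 : 0 < b1) (b12 : b1 <= b2)
  (qb : {ae leb R n, forall x, U x -> b1 <= q x <= b2}) (Hq : H1 U q Dq).
Hypotheses (HS : H1b U S DS) (c0 : 0 < c) (cS : forall x, U x -> c <= a x * S x).
Hypotheses (bal : balanced U F W) (WE : forall x, a x *: DS x = 2 *: W x).

Let mU := open_measurable_rV oU.
Let G x := a x / q x.
Let t x := q x * S x.
Let f x := 2 * F x.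
Let Dlog x := (q x)^-1 *: Dq x.
Let Dt := mulgrad q Dq S DS.

Let qbounded : {ae leb R n, forall x, U x -> `|q x| <= b2}.
Proof.
apply: filterS qb => x h /h /andP[qx ?].
by rewrite ger0_norm// (le_trans (ltW b10)).
Qed.

Let Hlog : H1b U (fun x => ln (q x)) Dlog. Proof. exact: H1b_ln qb Hq. Qed.

Let HqS : H1b U t Dt.
Proof. by apply: H1bM => //; split => //; exists b2. Qed.

Let mq : measurable_fun U q. Proof. by have [[]] := Hq. Qed.
Let mS : measurable_fun U S. Proof. by have [[[]]] := HS. Qed.
Let mF : measurable_fun U F. Proof. by have [[]] := bal. Qed.
Let mW i : measurable_fun U (fun x => W x ord0 i).
Proof. by have [_ /(_ i)[]] := bal. Qed.

Let mG : measurable_fun U G.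
Proof. by apply: measurable_funM => //; exact: measurable_funV. Qed.

Let mt : measurable_fun U t. Proof. exact: measurable_funM. Qed.
Let mGt : measurable_fun U (fun x => G x * t x). Proof. exact: measurable_funM. Qed.
Let maS : measurable_fun U (fun x => a x * S x). Proof. exact: measurable_funM. Qed.

Let GtE : {ae leb R n, forall x, U x -> G x * t x = a x * S x}.
Proof.
apply: filterS qb => x h /h /andP[qx _]; rewrite /G /t.
by rewrite mulrA divfK// gt_eqF// (lt_le_trans b10).
Qed.

Let L2_coef b g : measurable_fun U b -> {ae leb R n, forall x, U x -> b x = a x * S x} ->
  L2 U g -> L2 U (fun x => b x * g x).
Proof.
have [_ [M SM]] := HS => mb bE Lg.
apply: (@L2_ae_bounded_mul _ _ _ mU _ (A * M)) => //.
apply: filterS2 SM bE => x hS hb Ux; rewrite hb// normrM.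
by apply: ler_pM => //; [exact: aA|exact: hS].
Qed.

Let coef_integrable b (g h : 'rV[R]_n -> 'rV[R]_n) : measurable_fun U b ->
  {ae leb R n, forall x, U x -> b x = a x * S x} ->
  (forall i, L2 U (fun x => g x ord0 i)) -> (forall i, L2 U (fun x => h x ord0 i)) ->
  (leb R n).-integrable U (fun x => (b x * dot (g x) (h x))%:E).
Proof.
move=> mb bE Lg Lh; under eq_fun do rewrite -dotZl.
by apply: L2_dot_integrable => // i; under eq_fun do rewrite mxE; exact: L2_coef.
Qed.

(** With t = q S and G = a / q one has G t = a S, hence
    G t grad (log q) = a S grad q / q = G grad t - a grad S, and
    a grad S = 2 W has divergence 2 F. *)
Lemma log_identity v Dv : H10 U v Dv ->
  \int[leb R n]_(x in U) (G x * t x * dot (Dlog x) (Dv x)) =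
  \int[leb R n]_(x in U) (G x * dot (Dt x) (Dv x) + f x * v x).
Proof.
move=> Hv; have [Lv LDv _] := H10_H1 Hv; have [_ _ balv] := bal.
have iL : (leb R n).-integrable U (fun x => (G x * t x * dot (Dlog x) (Dv x))%:E).
  by apply: coef_integrable => //; have [[]] := Hlog.
have iB := balanced_integrable oU bal Hv.
have <- : \int[leb R n]_(x in U) (G x * t x * dot (Dlog x) (Dv x) +
    2 * (F x * v x + dot (W x) (Dv x))) =
    \int[leb R n]_(x in U) (G x * t x * dot (Dlog x) (Dv x)).
  rewrite RintegralD ?RintegralZl ?balv ?mulr0 ?addr0//.
  exact: (intgZ mU 2 iB).
have [_ LW _] := bal.
have mDv i := (LDv i).1.
have mv := Lv.1.
have mDlog i : measurable_fun U (fun x => Dlog x ord0 i).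
  by have [[_ /(_ i)[]]] := Hlog.
have mDt i : measurable_fun U (fun x => Dt x ord0 i).
  by have [[_ /(_ i)[]]] := HqS.
apply: Rintegral_ae_eq => //.
- apply: measurable_funD.
    by apply: measurable_funM => //; exact: measurable_dot.
  apply: measurable_funM => //; apply: measurable_funD; first exact: measurable_funM.
  exact: measurable_dot.
- apply: measurable_funD.
    by apply: measurable_funM => //; exact: measurable_dot.
  by apply: measurable_funM => //; exact: measurable_funM.
apply: filterS qb => x h Ux; have /andP[qx _] := h Ux.
have q0 : q x != 0 by rewrite gt_eqF// (lt_le_trans b10).
have dS : 2 * dot (W x) (Dv x) = a x * dot (DS x) (Dv x) by rewrite -!dotZl WE.
rewrite mulrDr dS /Dt /mulgrad dotDl /Dlog !dotZl /G /t /f.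
by field.
Qed.

Lemma log_solution : divergence_solution U G t f (fun x => ln (q x)) (fun x => ln (q x)).
Proof.
split; [|by exists Dlog; have [] := Hlog|].
  exists Dlog, Dt; split; [by have [] := Hlog|by have [] := HqS|].
  exact: log_identity.
exists (fun=> 0).
rewrite (_ : (fun x => _) = fun=> 0); last by apply/funext => x; rewrite subrr.
split; first exact: H1_cst.
move=> e e0; exists (fun=> 0); first exact: test_fun0.
rewrite /H1_norm2 /Rintegral integral0_eq// => x _.
rewrite subrr expr0n add0r /dot big1// => i _.
by rewrite !mxE partial_cst subrr mul0r.
Qed.

(** The difference z of two solutions lies in H^1_0 and satisfies
    div (a S grad z) = 0; testing with z itself gives grad z = 0. *)
Lemma log_unique w : divergence_solution U G t f (fun x => ln (q x)) w ->
  {ae leb R n, forall x, U x -> w x = ln (q x)}.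
Proof.
move=> [[Dw [Dt' [Hw Ht' wE]]] _ [Dz Hz]].
have [Lz LDz _] := H10_H1 Hz.
have mz := Lz.1; have mDz i := (LDz i).1.
have [Lw LDw _] := Hw; have mDw i := (LDw i).1.
have [[_ LDlog _] _] := Hlog; have mDlog i := (LDlog i).1.
have [[_ LDt _] _] := HqS; have mDt i := (LDt i).1.
have [_ LDt' _] := Ht'; have mDt' i := (LDt' i).1.
have Hdiff : H1 U (fun x => w x - ln (q x)) (fun x => Dw x - Dlog x).
  have := H1D oU fU Hw (H1Z oU fU (-1) Hlog.1).
  congr (H1 U _ _); apply/funext => x; last by rewrite scaleN1r.
  by rewrite mulN1r.
have DzE := ae_forall_coord (weak_grad_unique oU fU (H10_H1 Hz) Hdiff).
have DtE := ae_forall_coord (weak_grad_unique oU fU Ht' HqS.1).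
have rhsE : \int[leb R n]_(x in U) (G x * dot (Dt' x) (Dz x) + f x * (w x - ln (q x))) =
    \int[leb R n]_(x in U) (G x * dot (Dt x) (Dz x) + f x * (w x - ln (q x))).
  apply: Rintegral_ae_eq => //.
  - apply: measurable_funD; first by apply: measurable_funM => //; exact: measurable_dot.
    by apply: measurable_funM => //; exact: measurable_funM.
  - apply: measurable_funD; first by apply: measurable_funM => //; exact: measurable_dot.
    by apply: measurable_funM => //; exact: measurable_funM.
  apply: filterS DtE => x h Ux; congr (G x * dot _ _ + _).
  by apply/rowP => i; exact: h.
have e1 := wE _ _ Hz; rewrite rhsE -log_identity// in e1.
have iGt (g : 'rV[R]_n -> 'rV[R]_n) : (forall i, L2 U (fun x => g x ord0 i)) ->
    (leb R n).-integrable U (fun x => (G x * t x * dot (g x) (Dz x))%:E).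
  by move=> Lg; exact: coef_integrable.
have e2 : \int[leb R n]_(x in U) (a x * S x * dot (Dz x) (Dz x)) = 0.
  move/eqP: e1; rewrite -subr_eq0 -RintegralB//; try exact: iGt.
  move=> /eqP <-; apply: Rintegral_ae_eq => //.
  - by apply: measurable_funM => //; exact: measurable_dot.
  - by apply: measurable_funB; apply: measurable_funM => //; exact: measurable_dot.
  apply: filterS2 DzE GtE => x h hG Ux; rewrite -mulrBr hG//; congr (_ * _).
  rewrite -[X in _ = _ - X]mul1r -mulNr -dotZl -dotDl scaleN1r; congr (dot _ _).
  by apply/rowP => i; exact: h.
have le : c * sqn U (fun x => Dz x ord0 i0) <= 0.
  rewrite -e2 -RintegralZl//; last by have [] := LDz i0.
  apply: le_Rintegral => //.
  - by apply: (intgZ mU c); have [] := LDz i0.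
  - by apply: coef_integrable => //; exact: aeW.
  move=> x Ux; apply: ler_pM; [exact: ltW|exact: sqr_ge0|exact: cS|].
  rewrite /dot (bigD1 i0)//= -expr2 lerDl sumr_ge0// => i _.
  by rewrite -expr2 sqr_ge0.
have z0 : {ae leb R n, forall x, U x -> w x - ln (q x) = 0}.
  apply: (H10_grad0 oU fU (i := i0) UB Hz); apply: (sqn_eq0 mU (LDz i0)).
  by apply/eqP; rewrite eq_le sqn_ge0 andbT -(pmulr_rle0 _ c0).
by apply: filterS z0 => x h /h /eqP; rewrite subr_eq0 => /eqP.
Qed.

End log_equation.

Theorem theorem2p7 (R : realType) (d : nat) (al : R)
    (Om Om' : set 'rV[R]_d) (a q : 'rV[R]_d -> R)
    (lam Lam beta1 beta2 Kmin Kmax : R)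
    (K : {fset R}) (phi : 'I_3 -> 'rV[R]_d -> R)
    (u : R -> 'I_3 -> 'rV[R]_d -> R)
    (hd : d = 2%N \/ d = 3%N) (hal : 0 < al < 1)
    (hOm : bounded_domain_C1_holder al Om)
    (hOm' : bounded_domain_C1_holder al Om')
    (hsub : Om' `<=` Om)
    (ha : C0_holder al Om a)
    (hlam : 0 < lam) (hLam : 0 < Lam)
    (hab : forall x, closure Om x -> lam <= a x <= Lam)
    (hq : Linfty Om q)
    (hbeta1 : 0 < beta1) (hbeta2 : 0 < beta2)
    (hqb : {ae leb R d, forall x, Om x -> beta1 <= q x <= beta2})
    (hKmin : 0 < Kmin) (hKmax : Kmin < Kmax)
    (hK : forall k, k \in K ->
      Kmin <= k <= Kmax /\ ~ dirichlet_eigenvalue Om a q k)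
    (hphi : forall i, boundary_datum al Om (phi i))
    (hu : forall k, k \in K -> forall i,
      helmholtz_solution al Om a q k (phi i) (u k i) /\ C1_closure Om (u k i))
    (hproper : proper_measurements Om' K (fun k => u k (inord 0)) (fun k => u k (inord 1))
                            (fun k => u k (inord 2)))
    (hqH1 : exists Dq, H1 Om q Dq) :
  let G := fun x => a x / q x in
  let t := tr_e q u K in
  let f := fun x => 2 * \sum_(k <- K) \sum_(i < 3)
             (energy_E a u k i i x - k * energy_e q u k i i x) in
  let logq := fun x => ln (q x) in
  divergence_solution Om' G t f logq logq /\
  forall w, divergence_solution Om' G t f logq w ->
    {ae leb R d, forall x, Om' x -> w x = logq x}.
Proof.
move=> G t f logq.
have [_ oU _ bU _] := hOm'; have [_ oO _ bO _] := hOm.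
have fO : (leb R d Om < +oo)%E by apply: bounded_leb_lty => //; exact: open_measurable_rV.
have fU : (leb R d Om' < +oo)%E by apply: bounded_leb_lty => //; exact: open_measurable_rV.
have [B B0 UB] := bounded_ball0 bU.
have [Dq Hq] := hqH1.
have al0 : 0 < al by case/andP: hal.
have ma := holder_measurable al0 oO ha.
have aA x : Om x -> `|a x| <= Lam.
  move=> /subset_closure /hab/andP[lax axL].
  by rewrite ger0_norm// (le_trans (ltW hlam)).
have mq := hq.1.
have qQ : {ae leb R d, forall x, Om x -> `|q x| <= beta2}.
  apply: filterS hqb => x h /h/andP[bq qb].
  by rewrite ger0_norm// (le_trans (ltW hbeta1)).
have [p [r [p0 _ pu]]] := hproper.
pose u2 k (i : 'I_3) x := u k i x * u k i x.
pose Du2 k (i : 'I_3) := mulgrad (u k i) (grad (u k i)) (u k i) (grad (u k i)).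
have meas k (i : 'I_3) : k \in K -> H1b Om' (u2 k i) (Du2 k i) /\
    balanced Om' (helm_density a q (u k i) k) (helm_flux a (u k i)).
  move=> kK; have [[[Du HuD helm] _] c1] := hu k kK i.
  have [du [M [uM duM mdu]]] := C1_closure_regular oO bO c1.
  split; last first.
    split.
    - exact: (L2_helm_density oO fO oU hsub k ma aA mq qQ uM duM mdu HuD).
    - exact: (L2_helm_flux oO fO oU hsub ma aA uM duM mdu HuD).
    - exact: (helm_pairing oO fO oU hsub ma aA mq qQ du uM duM mdu HuD helm).
  have Hu := H1S oO oU hsub (H1_classical oO fO du uM duM mdu HuD).
  have Hub : H1b Om' (u k i) (grad (u k i)).
    by split => //; exists M; apply: aeW => x /hsub; exact: uM.
  exact: H1bM.
(* The trace of the e_k^{ij} is q S, and DS is the gradient of S. *)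
pose S x := \sum_(k <- K) \sum_(i < 3) u2 k i x.
pose DS x := \sum_(k <- K) \sum_(i < 3) Du2 k i x.
have HS : H1b Om' S DS.
  apply: (H1b_sum oU fU) => k kK; apply: (H1b_sum oU fU) => i _.
  by have [] := meas k i kK.
pose F x := \sum_(k <- K) \sum_(i < 3) helm_density a q (u k i) k x.
pose W x := \sum_(k <- K) \sum_(i < 3) helm_flux a (u k i) x.
have bal : balanced Om' F W.
  apply: (balanced_sum oU) => k kK; apply: (balanced_sum oU) => i _.
  by have [] := meas k i kK.
have WE x : a x *: DS x = 2 *: W x.
  rewrite !scaler_sumr; apply: eq_bigr => k _; rewrite !scaler_sumr; apply: eq_bigr => i _.
  by rewrite /Du2 /mulgrad /helm_flux -mulr2n -scaler_nat !scalerA [a x * _]mulrC -mulrA.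
(* Properness bounds one of the squares in S below by p^2. *)
have cS x : Om' x -> lam * p ^+ 2 <= a x * S x.
  move=> Ux; have /andP[la _] := hab x (subset_closure (hsub x Ux)).
  have [k [kK pk _]] := pu x Ux.
  apply: ler_pM => //; [exact: ltW|exact: sqr_ge0|].
  have S0 k' : 0 <= \sum_(i < 3) u2 k' i x.
    by apply: sumr_ge0 => i _; rewrite /u2 -expr2 sqr_ge0.
  rewrite /S (big_rem k)//= -[p ^+ 2]addr0; apply: lerD; last exact: sumr_ge0.
  rewrite (bigD1 (inord 0))//= -[p ^+ 2]addr0; apply: lerD; last first.
    by apply: sumr_ge0 => i _; rewrite /u2 -expr2 sqr_ge0.
  rewrite /u2 -expr2 -[leRHS]real_normK ?num_real//.
  by rewrite lerXn2r ?nnegrE ?(ltW p0).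
(* The maximum avoids deriving beta1 <= beta2, which needs Om of positive measure. *)
have b12 : beta1 <= Num.max beta1 beta2 by rewrite le_max lexx.
have qb : {ae leb R d, forall x, Om' x -> beta1 <= q x <= Num.max beta1 beta2}.
  apply: filterS hqb => x h /hsub/h/andP[-> qx] /=.
  by rewrite le_max qx orbT.
have d0 : (0 < d)%N by case: hd => ->.
have c0 : 0 < lam * p ^+ 2 by rewrite mulr_gt0 ?exprn_gt0.
have tE : t = fun x => q x * S x.
  apply/funext => x; rewrite /t /tr_e /S mulr_sumr; apply: eq_bigr => k _.
  by rewrite mulr_sumr; apply: eq_bigr => i _; rewrite /energy_e mulrA.
have maU : measurable_fun Om' a by exact: measurable_funS (open_measurable_rV oO) hsub ma.
have aAU x : Om' x -> `|a x| <= Lam by move=> /hsub; exact: aA.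
have HqU := H1S oO oU hsub Hq.
rewrite tE; split.
  exact: (log_solution oU fU maU aAU hbeta1 b12 qb HqU HS bal WE).
move=> w; apply: (log_unique oU fU (Ordinal d0) UB maU aAU hbeta1 b12 qb HqU HS c0 cS bal WE).
Qed.
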